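(* Let $(Z_N(i))_{0\le i\le N}$ be the breadth-first walk of a Poisson random hypergraph on $N$ vertices with parameters $(\beta_j)_{j\ge2}$, and suppose there exists $k\ge3$ such that $\beta_j=1/(j(j-1))$ for all $2\le j\le k-1$. Define $\bar Z_N(t)=N^{-\alpha(k)/2}Z_N(\lfloor N^{\alpha(k)}t\rfloor)$. Then $\bar Z_N\xrightarrow{d}W^k$ as $N\to\infty$ in $D[0,\infty)$ (with the topology of uniform convergence on compact time intervals).
   Context: Poisson random hypergraph: vertex set $V=\{1,\dots,N\}$; $(\beta_j)_{j\ge2}$ nonnegative reals, $\beta(t)=\sum_{j\ge2}\beta_jt^j$ with $\beta'(1)<\infty$; for each $A\subseteq V$ with $|A|=j\ge2$, the number of hyperedges on $A$ is Poisson with mean $N\beta_j/\binom{N}{j}$, independently over $A$. A 1-edge is a patch. Deleting (collapsing) a patched vertex $v$ removes $v$ and its patch and replaces each other hyperedge containing $v$ by the hyperedge on its remaining vertices (so 2-edges containing $v$ become patches). Breadth-first ordering and walk: start with no patches. Put a patch on the lowest-labelled vertex and call it $v(1)$. Having defined $v(1),\dots,v(i)$ and processed $v(1),\dots,v(i-1)$, the children of $v(i)$ are the vertices $w$ not yet assigned a number $v(\cdot)$ that are joined to $v(i)$ by a 2-edge in the current collapsed hypergraph (equivalently, some original hyperedge consists of $v(i)$, $w$ and a subset of $\{v(1),\dots,v(i-1)\}$); they receive the next available numbers in the order of their original labels (and carry patches), and then $v(i)$ is deleted with collapse. If after this no numbered-but-undeleted vertex remains, a patch is put on the lowest-labelled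 un-numbered vertex, which becomes the next numbered vertex. Let $c(i)$ be the number of children of $v(i)$; the breadth-first walk is $Z_N(0)=0$, $Z_N(i)=Z_N(i-1)+c(i)-1$ for $1\le i\le N$. Notation: $\alpha(k)=(2k-4)/(2k-3)$, $\mu_k=k(k-1)\beta_k-1$, $W^k(t)=B(t)+\frac{\mu_k}{k-1}t^{k-1}$ with $B$ a standard Brownian motion. *)

(* Defs.v *)
From HB Require Import structures.
From mathcomp Require Import all_boot all_order all_algebra.
From mathcomp Require Import all_classical all_reals all_analysis.
Set Implicit Arguments. Unset Strict Implicit. Unset Printing Implicit Defensive.
Import Order.TTheory GRing.Theory Num.Theory.
Import numFieldNormedType.Exports.
Local Open Scope classical_set_scope.
Local Open Scope ring_scope.

Section BFS.
Variable N : nat.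
Implicit Types (E : {set 'I_N} -> nat) (ord : seq 'I_N).

(* some original hyperedge (E A > 0) consists of v, w and a subset of
   the already processed vertices [done] *)
Definition bfs_joined E (done : seq 'I_N) (v w : 'I_N) : bool :=
  [exists A : {set 'I_N},
     [&& (0 < E A)%N, v \in A, w \in A & A \subset v |: (w |: [set x in done])]].

(* step processing vertex v(i+1) (0-indexed position i) *)
Definition bfs_step E ord (i : nat) : seq 'I_N * nat :=
  let ord1 :=
    if (size ord <= i)%N then
      match ohead [seq w <- enum 'I_N | w \notin ord] with
      | Some w => rcons ord w | None => ord end
    else ord in
  match onth ord1 i with
  | None => (ord1, 0%N)
  | Some v =>
      let kids := [seq w <- enum 'I_N | (w \notin ord1) && bfs_joined E (take i ord1) v w] in
      (ord1 ++ kids, size kids)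
  end.

Fixpoint bfs_run E (n : nat) : seq 'I_N * seq nat :=
  match n with
  | 0 => ([::], [::])
  | n'.+1 => let: (ord, cs) := bfs_run E n' in
             let: (ord2, c) := bfs_step E ord n' in (ord2, rcons cs c)
  end.

Definition bfs_children E (i : nat) : nat := nth 0%N (bfs_run E N).2 i.-1.

Definition bfs_walk {R : realType} E (i : nat) : R :=
  \sum_(1 <= m < (minn i N).+1) ((bfs_children E m)%:R - 1).
End BFS.

Section Prob.
Context {R : realType}.

Definition alpha (k : nat) : R := (2 * k%:R - 4) / (2 * k%:R - 3).
Definition mu (beta : nat -> R) (k : nat) : R := k%:R * (k%:R - 1) * beta k - 1.

Definition cadlag (f : R -> R) : Prop :=
  [/\ forall t, t < 0 -> f t = 0,
      forall t, 0 <= t -> f x @[x --> t^'+] --> f t &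
      forall t, 0 < t -> exists l : R, f x @[x --> t^'-] --> l].

Definition loc_unif_cvg (g : nat -> R -> R) (f : R -> R) : Prop :=
  forall T e, 0 < e -> \forall n \near \oo, forall t, 0 <= t <= T -> `|g n t - f t| < e.

Definition D_continuous (F : (R -> R) -> R) : Prop :=
  forall f (g : nat -> R -> R), cadlag f -> (forall n, cadlag (g n)) ->
    loc_unif_cvg g f -> F (g n) @[n --> \oo] --> F f.

Definition bounded_functional (F : (R -> R) -> R) : Prop :=
  exists M, forall f, `|F f| <= M.

Definition brownian_motion d (Om : measurableType d) (Q : probability Om R)
  (B : R -> Om -> R) : Prop :=
  [/\ (forall t, measurable_fun setT (B t)),
      (forall w, B 0 w = 0),
      (forall w, {within [set t | 0 <= t], continuous (fun t => B t w)}),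
      (forall s t (V : set R), 0 <= s < t -> measurable V ->
          Q [set w | V (B t w - B s w)] = normal_prob 0 (Num.sqrt (t - s)) V) &
      (forall n (tt : nat -> R) (V : nat -> set R), tt 0%N = 0 ->
          (forall i, (i < n)%N -> tt i < tt i.+1) -> (forall i, measurable (V i)) ->
          Q [set w | forall i, (i < n)%N -> V i (B (tt i.+1) w - B (tt i) w)] =
          (\prod_(i < n) Q [set w | V i (B (tt i.+1) w - B (tt i) w)%R])%E)].

Definition poisson_hypergraph (beta : nat -> R) (N : nat) d (Om : measurableType d)
  (P : probability Om R) (X : {set 'I_N} -> Om -> nat) : Prop :=
  [/\ (forall A U, measurable (X A @^-1` U)),
      (forall (A : {set 'I_N}) (n : nat), (2 <= #|A|)%N ->
         let m := N%:R * beta #|A| / 'C(N, #|A|)%:R in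
         P (X A @^-1` [set n]) = (m ^+ n / n`!%:R * expR (- m))%:E) &
      (forall (J : {set {set 'I_N}}) (U : {set 'I_N} -> set nat),
         (forall A, A \in J -> 2 <= #|A|)%N ->
         P [set w | forall A, A \in J -> U A (X A w)] =
         (\prod_(A in J) P (X A @^-1` U A))%E)].

Definition Zbar (k N : nat) (E : {set 'I_N} -> nat) (t : R) : R :=
  if t < 0 then 0 else
  (N%:R `^ (- alpha k / 2)) * bfs_walk E (Num.truncn (N%:R `^ alpha k * t)).

Definition Wk (beta : nat -> R) (k : nat) (b : R -> R) (t : R) : R :=
  if t < 0 then 0 else b t + mu beta k / (k%:R - 1) * t ^+ k.-1.
End Prob.

(* Main.v *)
(** When [v(i)] is processed, every vertex not yet numbered becomes a child independently and with
    the same probability, because the corresponding events involve disjoint families of hyperedges that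
    have not been examined before; so the numbers of children form an explicit binomial Markov chain.
    Split the walk into a martingale and a compensator. On the time scale [N^alpha] the equalities
    [beta_j = 1/(j(j-1))] cancel the terms of the compensator of order lower than [k-1] and leave
    [mu_k t^(k-1)/(k-1)], provided that the walk reflected at its minimum stays of order [N^(alpha/2)],
    which an exponential supermartingale guarantees. A Lipschitz function of the martingale increments
    over finitely many blocks hardly changes when these are replaced, one block at a time, by Brownian
    increments (Lindeberg), and the exponential bound also controls the oscillation inside the blocks.
    This gives the convergence of the means of functionals that are bounded and Lipschitz for the uniform
    distance on [[0, m]]. A bounded continuous [F] is on cadlag paths the limit of such functionals lying
    below [F] (infimal convolutions), whence a lower bound for the means of [F]; the upper bound is the
    same statement for [-F]. *)
Require Import Defs.
From HB Require Import structures.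
From mathcomp Require Import all_boot all_order all_algebra.
From mathcomp Require Import all_classical all_reals all_analysis.
From mathcomp Require Import measurable_realfun.
From mathcomp Require Import ring lra zify.
Import Order.TTheory GRing.Theory Num.Theory.
Import numFieldNormedType.Exports.
Local Open Scope classical_set_scope.
Local Open Scope ring_scope.
Set Implicit Arguments.
Unset Strict Implicit.
Unset Printing Implicit Defensive.

(** * Smoothing of Lipschitz functions *)

Section Smoothing.
Context {R : realType}.
Implicit Types (f g phi : R -> R) (L K e x y : R).

(** The exponent [alpha k] balances two effects. With [x = i/N], a step of the walk has mean
    [mu x^(k-2)] to leading order; [n] such steps add up to order [n^(k-1) / N^(k-2)], which is the
    diffusive order [sqrt n] exactly when [n] has order [N^alpha]. The balance is used in the form
    [rho^(k-2) = sqrt tau], with [tau = N^(-alpha)] and [i/N = (i tau) rho]. The compensator depends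
    on the reflected walk and the reflected walk on the compensator. The way out is one-sided: an
    upper bound for the mean holds whatever the number of waiting vertices, and it bounds the
    reflected walk as long as the martingale stays below [a / sqrt tau]. The functionals are
    arbitrary functions of paths, so measurability has to be produced. On the hypergraph side all
    means are finite sums, given by the recursion [chE]; on the Brownian side measurability comes
    with each limit. The order of limits matters: [N] tends to infinity with the mesh [delta = T/m]
    and the level [a] fixed, then the mesh is refined, and the probability
    [m expR (- x^2 / (32 delta))] that some block oscillates by [x] vanishes. *)

Definition lipschitzR L phi := forall x y, `|phi x - phi y| <= L * `|x - y|.

Lemma lipschitzR_continuous L phi : lipschitzR L phi -> continuous phi.
Proof.
move=> Lphi x; apply/cvgrPdist_lt => e e0.
have L1 : 0 < `|L| + 1 by rewrite ltr_wpDl.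
near=> y.
apply: le_lt_trans (Lphi x y) _.
apply: (@le_lt_trans _ _ ((`|L| + 1) * `|x - y|)).
  by rewrite ler_wpM2r// (le_trans (ler_norm _))// lerDl.
rewrite -ltr_pdivlMl// mulrC.
near: y; apply: (@cvgr_dist_lt _ _ _ (nbhs x) _ id) => //.
by rewrite divr_gt0.
Unshelve. all: by end_near. Qed.

Lemma is_derive_continuous f (df : R -> R) : (forall x, is_derive x 1 f (df x)) -> continuous f.
Proof.
by move=> fdf x; apply/differentiable_continuous/derivable1_diffP; case: (fdf x).
Qed.

Lemma MVT_point f (df : R -> R) x y : (forall x, is_derive x 1 f (df x)) ->
  exists2 c, `|c - x| <= `|y - x| & f y - f x = df c * (y - x).
Proof.
move=> fdf; have fc := is_derive_continuous fdf.
have [xy|/ltW yx] := leP x y.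
  have [c] := @MVT_segment R f df x y xy (fun z _ => fdf z) (continuous_subspaceT fc).
  rewrite in_itv/= => /andP[xc cy] ->; exists c => //.
  by rewrite !ger0_norm ?subr_ge0 ?lerD2r//.
have [c] := @MVT_segment R f df y x yx (fun z _ => fdf z) (continuous_subspaceT fc).
rewrite in_itv/= => /andP[yc cx] E; exists c.
  by rewrite !ler0_norm ?subr_le0// lerN2 lerD2r.
by rewrite -opprB E -mulrN opprB.
Qed.

Definition avg e phi x : R := e^-1 * \int[@lebesgue_measure R]_(t in `]x, x + e]) phi t.

Section avg.
Variables (phi : R -> R) (e : R).
Hypothesis cphi : continuous phi.
Hypothesis e0 : 0 < e.

Let prim (a x : R) := \int[@lebesgue_measure R]_(t in [set` Interval (BLeft a) (BRight x)]) phi t.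

Let integ (a b : R) : (@lebesgue_measure R).-integrable `[a, b] (EFin \o phi).
Proof.
apply: continuous_compact_integrable; first exact: segment_compact.
exact: continuous_subspaceT.
Qed.

Let is_derive_prim (a x : R) : a < x -> is_derive x 1 (prim a) (phi x).
Proof.
move=> ax; have xu : x < x + 1 by rewrite ltrDl.
have [|d1 d2] := @continuous_FTC1_closed R phi a x (x + 1) xu (integ _ _) ax.
  exact: cphi.
by apply: DeriveDef; [exact: d1|rewrite -derive1E; exact: d2].
Qed.

Let avgE (a x : R) : a <= x -> avg e phi x = e^-1 * (prim a (x + e) - prim a x).
Proof.
move=> ax; rewrite /avg /prim; congr (_ * _).
rewrite -(@Rintegral_itvB R phi (BLeft a) (BRight (x + e)) x (integ _ _))//.
by rewrite bnd_simp lerDl ltW.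
Qed.

Lemma is_derive_avg x : is_derive x 1 (avg e phi) (e^-1 * (phi (x + e) - phi x)).
Proof.
(* The primitive is based strictly to the left of [x], since the fundamental theorem is applied at
   interior points. *)
pose a := x - 1.
apply: (@near_eq_is_derive _ _ _ (fun y => e^-1 * (prim a (y + e) - prim a y))).
  near=> y; rewrite (@avgE a)//.
  by near: y; apply: lt_le_nbhsr; rewrite ltrBlDr ltrDl.
have d1 : is_derive x 1 (prim a) (phi x) by apply: is_derive_prim; rewrite ltrBlDr ltrDl.
have d2 : is_derive x 1 (fun y => prim a (y + e)) (phi (x + e)).
  have d2 : is_derive (x + e) 1 (prim a) (phi (x + e)).
    by apply: is_derive_prim; rewrite ltrBlDr -addrA ltrDl addr_gt0.
  have := @is_derive1_comp R (prim a) (shift e) x _ _ d2 (is_derive_shift _ _ _).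
  by rewrite mulr1.
exact: is_deriveZ.
Unshelve. all: by end_near. Qed.

Lemma avg_mean x : exists2 c, x <= c <= x + e & avg e phi x = phi c.
Proof.
pose a := x - 1.
have xe : x <= x + e by rewrite lerDl ltW.
have ax : a < x by rewrite ltrBlDr ltrDl.
have [z zx||c] := @MVT_segment R (prim a) phi x (x + e) xe.
- by apply: is_derive_prim; rewrite (lt_le_trans ax)// (itvP zx).
- apply: derivable_within_continuous => z zx.
  have [] := is_derive_prim (lt_le_trans ax _ : a < z) => //.
  by rewrite (itvP zx).
rewrite in_itv/= => xc E; exists c => //.
rewrite (@avgE a) ?ltW// E [x + e]addrC addrK mulrCA mulVf ?mulr1//.
by rewrite gt_eqF.
Qed.
End avg.

Lemma avg_close L phi e x : 0 < e -> 0 <= L -> lipschitzR L phi -> `|avg e phi x - phi x| <= L * e.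
Proof.
move=> e0 L0 Lphi; have [c /andP[xc cx] ->] := avg_mean (lipschitzR_continuous Lphi) e0 x.
apply: le_trans (Lphi _ _) _; rewrite ler_wpM2l//.
by rewrite ger0_norm ?subr_ge0// lerBlDl.
Qed.

Lemma avg_lipschitz L phi e : 0 < e -> lipschitzR L phi -> lipschitzR L (avg e phi).
Proof.
move=> e0 Lphi x y.
have [c _ ->] := MVT_point y x (is_derive_avg (lipschitzR_continuous Lphi) e0).
rewrite !normrM ler_wpM2r// normfV (gtr0_norm e0) ler_pdivrMl//.
by apply: le_trans (Lphi _ _) _; rewrite addrC addKr (gtr0_norm e0) mulrC.
Qed.

Lemma avg_bounded L K phi e x : 0 < e -> lipschitzR L phi ->
  (forall x, `|phi x| <= K) -> `|avg e phi x| <= K.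
Proof.
by move=> e0 Lphi pK; have [c _ ->] := avg_mean (lipschitzR_continuous Lphi) e0 x.
Qed.

(* Two averagings turn a bounded Lipschitz function into a function that has a second-order expansion with cubic remainder. *)
Lemma smooth_approx L K phi e : 0 < e -> 0 <= L -> lipschitzR L phi ->
  (forall x, `|phi x| <= K) ->
  exists f f1 f2 : R -> R, [/\ [/\ lipschitzR L f, continuous f1 & continuous f2],
    [/\ forall x, `|f x| <= K, forall x, `|f1 x| <= e^-1 * (2 * K) &
       forall x, `|f2 x| <= e ^-2 * (4 * K)],
    forall x, `|f x - phi x| <= 2 * L * e &
    forall x y, `|f (x + y) - (f x + f1 x * y + f2 x * (y ^+ 2 / 2))| <=
       e ^- 2 * (4 * L) * `|y| ^+ 3].
Proof.
move=> e0 L0 Lphi pK; have ei0 : 0 < e^-1 by rewrite invr_gt0.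
have cphi := lipschitzR_continuous Lphi.
have LA := avg_lipschitz e0 Lphi.
have cA := lipschitzR_continuous LA.
have LAA := avg_lipschitz e0 LA.
pose f := avg e (avg e phi).
pose f1 x := e^-1 * (avg e phi (x + e) - avg e phi x).
pose f2 x := e^-1 * (e^-1 * (phi (x + e + e) - phi (x + e)) - e^-1 * (phi (x + e) - phi x)).
have df x : is_derive x 1 f (f1 x) by exact: is_derive_avg.
have df1 x : is_derive x 1 f1 (f2 x).
  have d1 := is_derive_avg cphi e0 x.
  have d2 := is_derive_avg cphi e0 (x + e).
  have := @is_derive1_comp R (avg e phi) (shift e) x _ _ d2 (is_derive_shift _ _ _).
  rewrite mulr1 => d3; exact: is_deriveZ.
(* [f2] is [e ^- 2] times a second difference of [phi], with coefficients 1, -2, 1: hence the factor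
   4. This Lipschitz bound makes the remainder cubic. *)
have Lf2 : lipschitzR (e ^- 2 * (4 * L)) f2.
  move=> x y; rewrite /f2 -!mulrBr mulrA normrM -invfM -expr2 ger0_norm ?invr_ge0 ?sqr_ge0//.
  rewrite -!mulrA ler_pM2l ?invr_gt0 ?exprn_gt0//.
  have := Lphi x y; have := Lphi (x + e) (y + e); have := Lphi (x + e + e) (y + e + e).
  have shiftE (u v w : R) : u + w - (v + w) = u - v by rewrite opprD addrACA subrr addr0.
  rewrite !shiftE.
  set a := phi _; set b := phi _; set c := phi _; set d := phi _; set u := phi _; set v := phi _.
  move=> h1 h2 h3.
  have -> : a - c - (c - u) - (b - d - (d - v)) = (a - b) - (c - d) - (c - d) + (u - v) by ring.
  apply: le_trans (ler_normD _ _) _.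
  apply: le_trans (lerD (ler_normB _ _) h3) _.
  apply: le_trans (lerD (lerD (ler_normB _ _) h2) (lexx _)) _.
  apply: le_trans (lerD (lerD (lerD h1 h2) (lexx _)) (lexx _)) _.
  by rewrite !mulrA; lra.
exists f, f1, f2; split.
- split; [exact: LAA|exact: is_derive_continuous df1|exact: lipschitzR_continuous Lf2].
- have bA x : `|avg e phi x| <= K by exact: avg_bounded.
  split => x; first exact: avg_bounded.
    rewrite normrM (gtr0_norm ei0) ler_pM2l//.
    by apply: le_trans (ler_normB _ _) _; rewrite mulr_natl mulr2n lerD.
  rewrite /f2 -!mulrBr mulrA normrM -invfM -expr2 ger0_norm ?invr_ge0 ?sqr_ge0//.
  rewrite ler_pM2l ?invr_gt0 ?exprn_gt0//.
  apply: le_trans (ler_normB _ _) _.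
  apply: le_trans (lerD (ler_normB _ _) (ler_normB _ _)) _.
  by have := pK (x + e + e); have := pK (x + e); have := pK x; lra.
- move=> x; have := avg_close x e0 L0 LA; have := avg_close x e0 L0 Lphi.
  rewrite -/f => h1 h2; apply: le_trans (ler_distD (avg e phi x) _ _) _; lra.
- move=> x y; set C := e ^- 2 * (4 * L) in Lf2 *.
  have C0 : 0 <= C by rewrite mulr_ge0 ?invr_ge0 ?sqr_ge0 ?mulr_ge0.
  (* Taylor's formula by two mean value theorems: one for the remainder [r], whose derivative is a
     first-order remainder of [f1], and one for [f1], whose derivative [f2] is Lipschitz. *)
  pose r z := f (x + z) - (f x + f1 x * z + f2 x * (z ^+ 2 / 2)).
  have dr (z : R) : is_derive z 1 r (f1 (x + z) - (f1 x + f2 x * z)).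
    have d1 : is_derive z 1 (fun z => f (x + z)) (f1 (x + z)).
      have d2 := df (x + z).
      have d3 : is_derive z 1 (fun z : R => x + z) 1.
        have := is_derive_shift z (1:R) x.
        by rewrite (_ : shift x = (fun z => x + z))//; apply/funext => t /=; rewrite addrC.
      by have := is_derive1_comp d2 d3; rewrite mulr1.
    rewrite /r; apply: is_deriveB.
    apply: is_derive_eq.
    by rewrite /GRing.scale/=; field.
  have r0 : r 0 = 0 by rewrite /r addr0; ring.
  have [c cy E] := MVT_point 0 y dr.
  rewrite -/(r y) -[r y]subr0 -{1}r0 E subr0 normrM exprSr.
  rewrite mulrA ler_wpM2r//.
  have [c' cy' E'] := MVT_point x (x + c) df1.
  rewrite opprD addrA E' addrAC subrr add0r -mulrBl normrM expr2 mulrA.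
  rewrite !subr0 in cy; rewrite addrAC subrr add0r in cy'.
  apply: ler_pM => //; apply: le_trans (Lf2 _ _) _.
  by rewrite ler_wpM2l// (le_trans cy').
Qed.
End Smoothing.

(** * Binomial chains *)

Section BinomialChain.
Context {R : realType}.

(* Mean of [f] under the binomial law with parameters [n] and [p]. *)
Fixpoint binE (p : R) (n : nat) (f : nat -> R) : R :=
  if n is n'.+1 then p * binE p n' (fun c => f c.+1) + (1 - p) * binE p n' f
  else f 0%N.

Lemma binE_cst p n a : binE p n (fun=> a) = a.
Proof. by elim: n => //= n ->; ring. Qed.

Lemma binED p n f g : binE p n (fun c => f c + g c) = binE p n f + binE p n g.
Proof. by elim: n f g => //= n IH f g; rewrite !IH; ring. Qed.

Lemma binEZ p n a f : binE p n (fun c => a * f c) = a * binE p n f.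
Proof. by elim: n f => //= n IH f; rewrite !IH; ring. Qed.

Lemma eq_binE p n f g : f =1 g -> binE p n f = binE p n g.
Proof. by move=> /funext->. Qed.

Lemma le_binE p n f g : 0 <= p <= 1 -> (forall c, f c <= g c) ->
  binE p n f <= binE p n g.
Proof.
move=> /andP[p0 p1]; elim: n f g => //= n IH f g fg.
by apply: lerD; apply: ler_wpM2l; rewrite ?subr_ge0//; apply: IH.
Qed.

Lemma binEB p n f g : binE p n (fun c => f c - g c) = binE p n f - binE p n g.
Proof.
rewrite binED -[in RHS]mulN1r -binEZ; congr (_ + _).
by apply: eq_binE => c; rewrite mulN1r.
Qed.

Lemma ler_norm_binE p n f : 0 <= p <= 1 -> `|binE p n f| <= binE p n (fun c => `|f c|).
Proof.
move=> p01; rewrite ler_norml -mulN1r -binEZ; apply/andP.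
by split; apply: le_binE => // c; rewrite ?ler_norm// mulN1r lerNl -normrN ler_norm.
Qed.

Lemma binE_mean p n : binE p n (fun c => c%:R) = n%:R * p.
Proof.
elim: n => [|n IH] /=; first by rewrite mul0r.
under eq_binE do rewrite -natr1.
by rewrite binED binE_cst IH -natr1; ring.
Qed.

Lemma binE_var p n : binE p n (fun c => (c%:R - n%:R * p) ^+ 2) = n%:R * p * (1 - p).
Proof.
elim: n => [|n IH] /=; first by rewrite !mul0r subrr expr2 mul0r.
(* Conditioning on one trial recentres the square by [1 - p] or by [- p]; a general shift covers
   both. *)
have E (a : R) : binE p n (fun c => (c%:R - n%:R * p + a) ^+ 2) = n%:R * p * (1 - p) + a ^+ 2.
  rewrite -{}IH.
  under eq_binE => c.
    rewrite (_ : _ ^+ 2 = (c%:R - n%:R * p) ^+ 2 +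
       ((2 * a) * c%:R + (a ^+ 2 - 2 * a * (n%:R * p)))); last by ring.
    over.
  by rewrite binED binED binE_cst binEZ binE_mean; ring.
rewrite (@eq_binE _ _ _ (fun c => (c%:R - n%:R * p + (1 - p)) ^+ 2)); last first.
  by move=> c; rewrite -!natr1; ring.
rewrite E (@eq_binE _ _ _ (fun c => (c%:R - n%:R * p + (- p)) ^+ 2)); last first.
  by move=> c; rewrite -!natr1; ring.
by rewrite E -natr1; ring.
Qed.

(** Invert [1 - x <= expR (- x)]; then [(1 + x + 2 x^2) (1 - x) = 1 + x^2 (1 - 2 x)], which is where
    [x <= 1/2] enters. *)
Lemma expR_quad (x : R) : `|x| <= 2^-1 -> expR x <= 1 + x + 2 * x ^+ 2.
Proof.
rewrite ler_norml => /andP[x1 x2].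
have x0 : 0 < 1 - x by lra.
have h : expR x <= (1 - x)^-1.
  rewrite -[x in expR x]opprK expRN lef_pV2 ?posrE ?expR_gt0//.
  exact: expR_ge1Dx.
apply: le_trans h _; rewrite -[leLHS]mul1r ler_pdivrMr//.
nra.
Qed.

(** The trials are independent, and by [expR_quad] each centred trial contributes at most
    [expR (2 t^2 p)]. The exponent is governed by the mean, as for Poisson variables. *)
Lemma binE_mgf p n t : 0 <= p <= 1 -> `|t| <= 2^-1 ->
  binE p n (fun c => expR (t * (c%:R - n%:R * p))) <= expR (2 * t ^+ 2 * (n%:R * p)).
Proof.
move=> p01 ht; have /andP[p0 p1] := p01.
elim: n => [|n IH] /=; first by rewrite !mul0r subrr !mulr0.
have E (a : R) : binE p n (fun c => expR (t * (c%:R - n%:R * p) + a)) =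
   expR a * binE p n (fun c => expR (t * (c%:R - n%:R * p))).
  by under eq_binE do rewrite expRD mulrC; rewrite binEZ.
rewrite (@eq_binE _ _ _ (fun c => expR (t * (c%:R - n%:R * p) + t * (1 - p)))); last first.
  by move=> c; rewrite -!natr1; congr expR; ring.
rewrite E [in X in _ + X](@eq_binE _ _ _ (fun c => expR (t * (c%:R - n%:R * p) + (- (t * p))))); last first.
  by move=> c; rewrite -!natr1; congr expR; ring.
rewrite E [p * _]mulrA [(1 - p) * _]mulrA -mulrDl.
set b := binE _ _ _ in IH *.
have -> : expR (2 * t ^+ 2 * (n.+1%:R * p)) = expR (2 * t ^+ 2 * p) * expR (2 * t ^+ 2 * (n%:R * p)).
  by rewrite -expRD -natr1; congr expR; ring.
have b0 : 0 <= b.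
  by rewrite -(binE_cst p n 0); apply: le_binE => // c; rewrite expR_ge0.
apply: ler_pM => //; first by rewrite addr_ge0// mulr_ge0 ?expR_ge0// subr_ge0.
rewrite (_ : t * (1 - p) = t + (- (t * p))); last by ring.
rewrite expRD mulrA -mulrDl.
have -> : 2 * t ^+ 2 * p = p * (t + 2 * t ^+ 2) + (- (t * p)) by ring.
rewrite [leRHS]expRD ler_pM2r ?expR_gt0//.
apply: le_trans (expR_ge1Dx _).
have := expR_quad ht.
have : 0 <= p by []. nra.
Qed.

(** [216 = 6^3]: cube the inequality [x / 6 <= expR (x / 6)]. The exponent [x / 2] stays in the
    range [|t| <= 1/2] of [binE_mgf]. *)
Lemma expR_cube (x : R) : 0 <= x -> x ^+ 3 <= 216 * expR (x / 2).
Proof.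
move=> x0; have -> : expR (x / 2) = expR (x / 6) ^+ 3.
  by rewrite -expRM_natl; congr expR; field.
have h := expR_ge1Dx (x / 6).
have : (x / 6) ^+ 3 <= expR (x / 6) ^+ 3.
  rewrite lerXn2r ?nnegrE ?expR_ge0 ?divr_ge0//; lra.
rewrite exprMn; lra.
Qed.

Lemma cube_norm_expR (x : R) : `|x| ^+ 3 <= 216 * (expR (2^-1 * x) + expR (- 2^-1 * x)).
Proof.
apply: le_trans (expR_cube (normr_ge0 x)) _; rewrite ler_pM2l//.
have [x0|x0] := leP 0 x.
  by rewrite ger0_norm// [x / 2]mulrC lerDl expR_ge0.
by rewrite ltr0_norm// (_ : - x / 2 = - 2^-1 * x) ?lerDr ?expR_ge0//; ring.
Qed.

(** The generating function at [1/2] and [- 1/2] controls the third moment: [432 = 2 * 216], and a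
    mean at most 2 makes [expR (2 t^2 n p)] at most [expR 1]. *)
Lemma binE_abs3 p n : 0 <= p <= 1 -> n%:R * p <= 2 ->
  binE p n (fun c => `|c%:R - n%:R * p| ^+ 3) <= 432 * expR 1.
Proof.
move=> p01 np.
have -> : 432 * expR (1:R) = 216 * (expR 1 + expR 1) by ring.
apply: (le_trans (le_binE _ p01 (fun c => cube_norm_expR _))).
rewrite binEZ binED ler_pM2l//.
have h t : `|t| = 2^-1 -> binE p n (fun c => expR (t * (c%:R - n%:R * p))) <= expR 1.
  move=> ht; apply: le_trans (binE_mgf _ _ _) _ => //; first by rewrite ht.
  rewrite ler_expR -[t ^+ 2]real_normK ?num_real// ht.
  by have : 0 <= n%:R * p; [rewrite mulr_ge0//; case/andP: p01 | nra].
by apply: lerD; apply: h; rewrite ?normrN ger0_norm.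
Qed.

Variables (N : nat) (pr : nat -> R).

(* A history [h] lists the numbers of children of the processed vertices, the last one first;
   [maxn _ (size h).+1] accounts for the patch put on a new vertex when none is waiting. *)
Fixpoint numbered (h : seq nat) : nat :=
  if h is c :: h' then (maxn (numbered h') (size h').+1 + c)%N else 0%N.
Definition fresh (h : seq nat) : nat := (N - maxn (numbered h) (size h).+1)%N.

Definition mean (h : seq nat) : R := (fresh h)%:R * pr (size h).

(** Being an iterated finite sum, this mean over the next [n] steps makes sense for every [f]. New
    counts are put in front, so [f] is evaluated at [s ++ h] with [size s = n]. *)
Fixpoint chE (n : nat) (h : seq nat) (f : seq nat -> R) : R :=
  if n is n'.+1 then binE (pr (size h)) (fresh h) (fun c => chE n' (c :: h) f)
  else f h.

Fixpoint walk (h : seq nat) : R :=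
  if h is c :: h' then walk h' + (c%:R - 1) else 0.
Fixpoint mart (h : seq nat) : R :=
  if h is c :: h' then mart h' + (c%:R - mean h') else 0.
Fixpoint drift (h : seq nat) : R :=
  if h is c :: h' then drift h' + (mean h' - 1) else 0.

Lemma walkE h : walk h = mart h + drift h.
Proof. by elim: h => [|c h /= ->]; rewrite ?addr0//; ring. Qed.

Lemma chE_cst n h a : chE n h (fun=> a) = a.
Proof.
elim: n h => //= n IH h.
by under eq_binE do rewrite IH; rewrite binE_cst.
Qed.

Lemma chED n h f g : chE n h (fun s => f s + g s) = chE n h f + chE n h g.
Proof.
elim: n h => //= n IH h.
by under eq_binE do rewrite IH; rewrite binED.
Qed.

Lemma chEZ n h a f : chE n h (fun s => a * f s) = a * chE n h f.
Proof.
elim: n h => //= n IH h.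
by under eq_binE do rewrite IH; rewrite binEZ.
Qed.

Lemma chEN n h f : chE n h (fun s => - f s) = - chE n h f.
Proof. by rewrite -mulN1r -chEZ; congr chE; apply/funext => s; rewrite mulN1r. Qed.

Lemma chEB n h f g : chE n h (fun s => f s - g s) = chE n h f - chE n h g.
Proof. by rewrite chED chEN. Qed.

Lemma chE_add m n h f : chE (m + n) h f = chE m h (fun s => chE n s f).
Proof. by elim: m h => //= m IH h; under eq_binE do rewrite IH. Qed.

Hypothesis pr01 : forall i, 0 <= pr i <= 1.

Lemma le_chE n h f g : (forall s, size s = n -> f (s ++ h) <= g (s ++ h)) ->
  chE n h f <= chE n h g.
Proof.
elim: n h => [|n IH] h fg /=; first exact: (fg [::]).
apply: le_binE => // c; apply: IH => s sn.
by rewrite -cat_rcons; apply: fg; rewrite size_rcons sn.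
Qed.

Lemma eq_chE n h f g : (forall s, size s = n -> f (s ++ h) = g (s ++ h)) ->
  chE n h f = chE n h g.
Proof. by move=> fg; apply/le_anti/andP; split; apply: le_chE => s sn; rewrite fg. Qed.

Lemma chE_ge0 n h f : (forall s, size s = n -> 0 <= f (s ++ h)) -> 0 <= chE n h f.
Proof. by move=> f0; rewrite -(chE_cst n h 0); exact: le_chE. Qed.

Lemma chE_leC n h f a : (forall s, size s = n -> f (s ++ h) <= a) -> chE n h f <= a.
Proof. by move=> f0; rewrite -(chE_cst n h a); exact: le_chE. Qed.

Lemma ler_norm_chE n h f : `|chE n h f| <= chE n h (fun s => `|f s|).
Proof.
rewrite ler_norml -chEN; apply/andP.
by split; apply: le_chE => s _; rewrite ?ler_norm// lerNl -normrN ler_norm.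
Qed.

(** [drop j h] is the history [j] steps earlier, so the event looks back over the last [n.+1]
    times. *)
Definition ever (P : pred (seq nat)) (n : nat) (h : seq nat) : bool :=
  has (fun j => P (drop j h)) (iota 0 n.+1).

Lemma everS P n h : ever P n.+1 h = ever P n h || P (drop n.+1 h).
Proof. by rewrite /ever -[n.+2]addn1 iotaD has_cat/= orbF. Qed.

Lemma everP (P : pred (seq nat)) n h : reflect (exists2 j, (j <= n)%N & P (drop j h)) (ever P n h).
Proof.
apply: (iffP hasP) => -[j]; first by rewrite mem_iota add0n ltnS => jn Pj; exists j.
by move=> jn Pj; exists j => //; rewrite mem_iota add0n ltnS.
Qed.

Lemma ever_maximal (Y : seq nat -> R) (l : R) n h : 0 < l ->
  (forall s, 0 <= Y s) ->
  (forall s, (size s < n)%N -> chE 1 (s ++ h) Y <= Y (s ++ h)) ->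
  chE n h (fun s => (ever (fun t => l <= Y t) n s)%:R) <= Y h / l.
Proof.
move=> l0 Y0; elim: n h => [|n IH] h sup.
  rewrite /= /ever/= drop0 orbF.
  by case: (leP l (Y h)) => hl; rewrite ?divr_ge0// ?ler_pdivlMr ?mul1r// ltW.
have [hl|hl] := leP l (Y h).
  apply: (@le_trans _ _ 1); last by rewrite ler_pdivlMr ?mul1r.
  by apply: chE_leC => s _; rewrite lern1 leq_b1.
have -> : chE n.+1 h (fun s => (ever (fun t => l <= Y t) n.+1 s)%:R) =
   chE n.+1 h (fun s => (ever (fun t => l <= Y t) n s)%:R).
  apply: eq_chE => s sn; rewrite everS drop_size_cat//.
  by rewrite (leNgt l) hl orbF.
apply: (@le_trans _ _ (chE 1 h Y / l)); last first.
  by rewrite ler_pM2r ?invr_gt0//; exact: (sup [::]).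
rewrite mulrC -chEZ; apply: le_binE => // c /=; rewrite mulrC; apply: IH => s sn.
by rewrite -cat_rcons; apply: sup; rewrite size_rcons.
Qed.

Lemma mart_cat_mgf t h : `|t| <= 2^-1 -> mean h <= 2 ->
  chE 1 h (fun s => expR (t * mart s)) <= expR (4 * t ^+ 2) * expR (t * mart h).
Proof.
move=> ht h2 /=.
under eq_binE do rewrite mulrDr expRD.
rewrite binEZ mulrC ler_pM2r ?expR_gt0//.
apply: le_trans (binE_mgf _ (pr01 _) ht) _; rewrite ler_expR.
have : 0 <= t ^+ 2 by rewrite sqr_ge0.
by rewrite -/(mean h); nra.
Qed.

(* Markov's inequality for the supermartingale [exp (t * mart - 4 t^2 * time)]. *)
Lemma mart_maximal n h t x : 0 < t <= 2^-1 ->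
  (forall s, (size s < n)%N -> mean (s ++ h) <= 2) ->
  chE n h (fun s => (ever (fun u => x < `|mart u - mart h|) n s)%:R) <=
  2 * expR (4 * t ^+ 2 * n%:R - t * x).
Proof.
move=> /andP[t0 t2] hm.
(* [e] will be [t] or [- t]: one supermartingale for each tail, whence the factor 2. *)
pose Y (e : R) (s : seq nat) := expR (e * (mart s - mart h) - 4 * t ^+ 2 * ((size s)%:R - (size h)%:R)).
have key e : `|e| = t ->
   chE n h (fun s => (ever (fun u => expR (t * x - 4 * t ^+ 2 * n%:R) <= Y e u) n s)%:R) <=
   expR (4 * t ^+ 2 * n%:R - t * x).
  move=> et.
  have := @ever_maximal (Y e) (expR (t * x - 4 * t ^+ 2 * n%:R)) n h (expR_gt0 _)
    (fun s => expR_ge0 _).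
  rewrite {4}/Y !subrr !mulr0 subrr expR0 div1r -expRN opprB; apply => s sn.
  have E u : Y e u = expR (e * mart u) * expR (- e * mart h - 4 * t ^+ 2 * ((size u)%:R - (size h)%:R)).
    by rewrite -expRD /Y; congr expR; ring.
  rewrite [leRHS]E /=.
  under eq_binE do rewrite E mulrC /=.
  rewrite binEZ; have := @mart_cat_mgf e (s ++ h); rewrite et => /(_ t2 (hm _ sn)) /= H.
  apply: le_trans (ler_wpM2l (expR_ge0 _) H) _.
  rewrite mulrA mulrC ler_pM2l ?expR_gt0// -expRD ler_expR -natr1.
  rewrite -[e ^+ 2]real_normK ?num_real// et; lra.
rewrite mulr_natl mulr2n.
apply: le_trans (lerD (key t (gtr0_norm t0)) (key (- t) (etrans (normrN _) (gtr0_norm t0)))).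
rewrite -chED; apply: le_chE => s sn.
case: everP => [[j jn xj]|_]; last by rewrite addr_ge0.
have sz : (size (drop j (s ++ h)))%:R - (size h)%:R <= n%:R :> R.
  rewrite size_drop size_cat sn lerBlDr -natrD ler_nat; lia.
have t4 : 0 <= 4 * t ^+ 2 by rewrite mulr_ge0 ?sqr_ge0.
set u := drop j (s ++ h) in xj sz.
have hit (e : R) : e * (mart u - mart h) = t * `|mart u - mart h| ->
    (ever (fun u => expR (t * x - 4 * t ^+ 2 * n%:R) <= Y e u) n (s ++ h))%:R = 1 :> R.
  move=> eu; suff -> : ever (fun u => expR (t * x - 4 * t ^+ 2 * n%:R) <= Y e u) n (s ++ h) by [].
  apply/everP; exists j => //.
  rewrite /Y ler_expR -/u eu lerB//; last by rewrite ler_wpM2l.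
  by rewrite ler_pM2l// ltW.
rewrite -[leLHS]/(1 : R).
have [m0|m0] := leP 0 (mart u - mart h).
  by rewrite hit ?ger0_norm// lerDl.
by rewrite [X in _ + X]hit ?lerDr// ltr0_norm// mulrN mulNr.
Qed.
End BinomialChain.

(** * Expectations *)

Section Expectation.
Context {R : realType} d (Om : measurableType d) (Q : probability Om R).
Implicit Types (f g : Om -> R).

Lemma bounded_integrable f (K : R) : measurable_fun setT f -> (forall w, `|f w| <= K) ->
  Q.-integrable setT (EFin \o f).
Proof.
move=> mf fK; apply: measurable_bounded_integrable => //; first by rewrite /= probability_setT ltry.
by exists K; split => //; rewrite ?num_real// => M /ltW KM w _; exact: le_trans (fK w) KM.
Qed.

Lemma expect_cst (a : R) : \int[Q]_w a = a.
Proof. by rewrite Rintegral_cst//= probability_setT mulr1. Qed.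

Lemma ler_norm_expect f (K : R) : measurable_fun setT f -> (forall w, `|f w| <= K) ->
  `|\int[Q]_w f w| <= K.
Proof.
move=> mf fK; have If := bounded_integrable mf fK.
apply: le_trans (le_normr_Rintegral _ _) _ => //.
rewrite -[leRHS]expect_cst; apply: le_Rintegral => //.
- apply: (@bounded_integrable _ K); first exact: measurableT_comp.
  by move=> w; rewrite normr_id.
- exact: (@bounded_integrable _ `|K|).
Qed.

(** Bounded convergence. Measurability of the limit belongs to the conclusion: for functionals of
    paths it is known only through approximation. *)
Lemma expect_cvg (f_ : nat -> Om -> R) f (K : R) :
  (forall n, measurable_fun setT (f_ n)) -> (forall n w, `|f_ n w| <= K) ->
  (forall w, f_ ^~ w @ \oo --> f w) ->
  measurable_fun setT f /\ \int[Q]_w f_ n w @[n --> \oo] --> \int[Q]_w f w.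
Proof.
move=> mf_ fK ff.
have mf : measurable_fun setT f by apply: (measurable_fun_cvg mf_) => w _; exact: ff.
split=> //.
have fK' w : `|f w| <= K.
  apply: (@closed_cvg _ _ \oo _ (fun n => `|f_ n w|) [set x | x <= K]).
  - exact: closed_le.
  - by apply: nearW => n; exact: fK.
  - by apply: cvg_norm; exact: ff.
have If := bounded_integrable mf fK'.
apply: (@fine_cvg R nat \oo _ (fun n => \int[Q]_w (f_ n w)%:E)%E).
rewrite fineK; last exact: integrable_fin_num.
apply: (@dominated_cvg _ _ _ Q setT measurableT (fun n w => (f_ n w)%:E) _ (cst K%:E)) => //.
- by move=> n; apply/measurable_EFinP.
- by move=> w _; apply: cvg_EFin => //; [exact: nearW|exact: ff].
- by apply: (@bounded_integrable (cst K) `|K|).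
- by move=> n w _; rewrite /= lee_fin.
Qed.

Lemma expect_sum (I : finType) (f_ : I -> Om -> R) :
  (forall i, Q.-integrable setT (EFin \o f_ i)) ->
  \int[Q]_w (\sum_i f_ i w) = \sum_i \int[Q]_w f_ i w.
Proof.
move=> If; rewrite /index_enum; elim: (Finite.enum I) => [|i s IH].
  by under eq_Rintegral do rewrite big_nil; rewrite big_nil expect_cst.
under eq_Rintegral do rewrite big_cons.
rewrite big_cons -IH RintegralD//.
rewrite (_ : _ \o _ = fun w => (\sum_(j <- s) (EFin \o f_ j) w)%E).
  exact: integrable_sum.
by apply/funext => w; rewrite /= sumEFin.
Qed.

Lemma finite_expect (T : finType) (tau : Om -> T) (g : T -> R) :
  (forall t, measurable (tau @^-1` [set t])) ->
  measurable_fun setT (g \o tau) /\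
  \int[Q]_w g (tau w) = \sum_t g t * fine (Q (tau @^-1` [set t])).
Proof.
move=> mtau.
have E w : g (tau w) = \sum_t g t * \1_(tau @^-1` [set t]) w.
  rewrite (bigD1 (tau w))//= indicE mem_set//= mulr1 big1 ?addr0// => t tw.
  rewrite indicE memNset ?mulr0//= => /esym/eqP; exact/negP.
have mg t : measurable_fun setT (fun w => g t * \1_(tau @^-1` [set t]) w).
  by apply: measurable_funM => //; exact: measurable_indic.
split.
  rewrite (_ : g \o tau = fun w => \sum_t g t * \1_(tau @^-1` [set t]) w).
    exact: measurable_sum.
  by apply/funext => w; exact: E.
under eq_Rintegral do rewrite E.
have I1 t : Q.-integrable setT (EFin \o \1_(tau @^-1` [set t])).
  apply: (@bounded_integrable _ 1); first exact: measurable_indic.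
  by move=> w; rewrite indicE; case: (_ \in _); rewrite ?normr1 ?normr0.
rewrite expect_sum => [|t].
  apply: eq_bigr => t _; rewrite RintegralZl//; congr (_ * _).
  by rewrite /Rintegral integral_indic// setIT.
apply: (@bounded_integrable _ `|g t|) => // w.
by rewrite indicE normrM; case: (_ \in _); rewrite ?normr1 ?normr0 ?mulr1 ?mulr0.
Qed.
End Expectation.

(** * Means determined by the probabilities of boxes *)

Section BoxLaw.
Context {R : realType}.

(** Vectors are whole sequences; the inequality itself forces [g] to depend on the first [m] terms
    only. *)
Definition lipN (m : nat) (L : R) (g : (nat -> R) -> R) :=
  forall y z, `|g y - g z| <= L * \sum_(i < m) `|y i - z i|.

(** Each coordinate is compared with the points of mesh [1 / (r + 1)] filling []-r, r]]; the number
    of successful comparisons recovers it up to the mesh, which is what [decode] computes. A code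
    thus determines a box. *)
Let grid (r j : nat) : R := - r%:R + j.+1%:R / r.+1%:R.
Let nodes (r : nat) := (r * r.+1 * 2)%N.
Let code m r (y : nat -> R) : {ffun 'I_m * 'I_(nodes r) -> bool} :=
  [ffun ij : 'I_m * 'I_(nodes r) => grid r ij.2 <= y ij.1].
Let decode m r (v : {ffun 'I_m * 'I_(nodes r) -> bool}) (i : nat) : R :=
  - r%:R + \sum_(j < nodes r)
     (if insub i is Some i' then v (i', j) else false)%:R / r.+1%:R.

Let count_le (K : nat) (z : R) : 0 <= z -> z < K.+1%:R ->
  `|\sum_(j < K) (j.+1%:R <= z :> R)%:R - z| <= 1.
Proof.
elim: K => [|K IH] z0 zK.
  by rewrite big_ord0 sub0r normrN ger0_norm// ltW.
rewrite big_ord_recr/=; have [Kz|zK'] := leP K.+1%:R z; last first.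
  by rewrite addr0; exact: IH.
rewrite (eq_bigr (fun=> 1)) => [|j _].
  rewrite sumr_const card_ord -[_ *+ K]/(K%:R) natr1 distrC ger0_norm ?subr_ge0//.
  by rewrite lerBlDl natr1 ltW.
by rewrite (le_trans _ Kz)// ler_nat ltnS ltnW.
Qed.

Let decode_code m r y i : (i < m)%N -> `|y i| < r%:R ->
  `|decode (code m r y) i - y i| <= r.+1%:R^-1.
Proof.
move=> im yr; rewrite /decode insubT -mulr_suml.
have r0 : 0 < r.+1%:R :> R by rewrite ltr0n.
pose z := (y i + r%:R) * r.+1%:R.
have E : \sum_(j < nodes r) (code m r y (Sub i im, j))%:R = \sum_(j < nodes r) (j.+1%:R <= z :> R)%:R :> R.
  apply: eq_bigr => j _; rewrite ffunE/= /grid /z.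
  by rewrite addrC -lerBrDr opprK ler_pdivrMr.
rewrite E.
have : `|\sum_(j < nodes r) (j.+1%:R <= z :> R)%:R - z| <= 1 :> R.
  move: yr; rewrite ltr_norml => /andP[y1 y2].
  apply: count_le; first by rewrite mulr_ge0 ?ler0n// -lerBlDr sub0r ltW.
  apply: (@lt_le_trans _ _ ((r%:R + r%:R) * r.+1%:R)).
    by rewrite ltr_pM2r// ltrD2r.
  by rewrite -natrD -natrM ler_nat /nodes; lia.
move=> h; set S := \sum_(j < _) _ in h *.
have -> : - r%:R + S / r.+1%:R - y i = (S - z) / r.+1%:R.
  by rewrite /z; field; rewrite gt_eqF.
by rewrite normrM normfV (gtr0_norm r0) ler_pdivrMr// mulVf ?gt_eqF.
Qed.

Let cellset m r (v : {ffun 'I_m * 'I_(nodes r) -> bool}) (i : nat) : set R :=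
  \bigcap_(j in [set: 'I_(nodes r)]) (if insub i is Some i' then
     [set y | (grid r j <= y) = v (i', j)] else setT).

Let measurable_cellset m r v i : measurable (@cellset m r v i).
Proof.
apply: fin_bigcap_measurable => // j _; case: insubP => // i' _ _.
case: (v _).
  rewrite (_ : [set y | _] = `[grid r j, +oo[%classic) ?measurable_itv//.
  by apply/seteqP; split => y /=; rewrite in_itv/= andbT.
rewrite (_ : [set y | _] = `]-oo, grid r j[%classic) ?measurable_itv//.
by apply/seteqP; split => y /=; rewrite in_itv/= ltNge; [move=> ->|move/negbTE].
Qed.

Let preimage_code d (Om : measurableType d) m r (Y : nat -> Om -> R) v :
  (fun w => code m r (Y^~ w)) @^-1` [set v] =
  [set w | forall i, (i < m)%N -> cellset v i (Y i w)].
Proof.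
apply/seteqP; split => w /=.
  move=> <- i im j _; rewrite insubT/=; by rewrite ffunE.
move=> h; apply/ffunP => -[i j]; have := h i (ltn_ord i) j Logic.I.
by rewrite valK/= ffunE.
Qed.

Let measurable_code d (Om : measurableType d) m r (Y : nat -> Om -> R) v :
  (forall i, (i < m)%N -> measurable_fun setT (Y i)) ->
  measurable ((fun w => code m r (Y^~ w)) @^-1` [set v]).
Proof.
move=> mY; rewrite preimage_code.
rewrite (_ : [set w | _] = \bigcap_(i in `I_m) (Y i @^-1` cellset v i)); last first.
  by apply/seteqP; split => w.
apply: fin_bigcap_measurable => // i /= im.
by rewrite -[X in measurable X]setTI; exact: mY.
Qed.

Let decode_cvg (m : nat) L g (y : nat -> R) : lipN m L g ->
  g (decode (code m r y)) @[r --> \oo] --> g y.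
Proof.
move=> Lg.
apply/cvgrPdist_le => e e0.
have [M yM] : exists M : nat, forall i, (i < m)%N -> `|y i| < M%:R.
  exists (Num.bound (\sum_(i < m) `|y i|)) => i im.
  apply: le_lt_trans (archi_boundP _); last exact: sumr_ge0.
  by rewrite (bigD1 (Ordinal im))//= lerDl sumr_ge0.
pose C := `|L| * m%:R + 1.
have C0 : 0 < C by rewrite ltr_wpDl ?mulr_ge0.
near=> r.
have Mr : (M <= r)%N by near: r; exact: nbhs_infty_ge.
have re : r.+1%:R^-1 <= e / C.
  by apply: ltW; near: r; exact: (near_infty_natSinv_lt (PosNum (divr_gt0 e0 C0))).
rewrite distrC; apply: le_trans (Lg _ _) _.
apply: (@le_trans _ _ (`|L| * \sum_(i < m) r.+1%:R^-1)).
  apply: (@le_trans _ _ (`|L| * \sum_(i < m) `|decode (code m r y) i - y i|)).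
    by apply: ler_wpM2r; [exact: sumr_ge0|exact: ler_norm].
  apply: ler_wpM2l => //; apply: ler_sum => i _; apply: decode_code => //.
  by rewrite (lt_le_trans (yM _ _))// ler_nat.
rewrite sumr_const card_ord -[_ *+ m]mulr_natl mulrA.
apply: (@le_trans _ _ (C * r.+1%:R^-1)); first by rewrite ler_wpM2r ?invr_ge0// lerDl.
by rewrite mulrC -ler_pdivlMr.
Unshelve. all: by end_near. Qed.

Lemma lipN_measurable d (Om : measurableType d) (Q : probability Om R) m L g (Y : nat -> Om -> R) :
  lipN m L g -> (forall i, (i < m)%N -> measurable_fun setT (Y i)) ->
  measurable_fun setT (fun w => g (Y^~ w)).
Proof.
move=> Lg mY.
apply: (@measurable_fun_cvg _ _ _ _ (fun r w => g (decode (code m r (Y^~ w))))).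
  move=> r; apply: (finite_expect Q (fun v => g (decode v)) _).1.
  by move=> v; exact: measurable_code.
by move=> w _; exact: decode_cvg Lg.
Qed.

(** [g] is the limit of functions of the finite code, whose level sets are boxes; bounded
    convergence turns equal probabilities of boxes into equal means. *)
Lemma box_law_expect d (Om : measurableType d) (Q : probability Om R)
    d' (Om' : measurableType d') (Q' : probability Om' R) m L K g
    (Y : nat -> Om -> R) (Y' : nat -> Om' -> R) :
  lipN m L g -> (forall y, `|g y| <= K) ->
  (forall i, (i < m)%N -> measurable_fun setT (Y i)) ->
  (forall i, (i < m)%N -> measurable_fun setT (Y' i)) ->
  (forall V : nat -> set R, (forall i, measurable (V i)) ->
     Q [set w | forall i, (i < m)%N -> V i (Y i w)] =
     Q' [set w | forall i, (i < m)%N -> V i (Y' i w)]) ->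
  \int[Q]_w g (Y^~ w) = \int[Q']_w g (Y'^~ w).
Proof.
move=> Lg gK mY mY' box.
have mc r v := @measurable_code _ Om m r Y v mY.
have mc' r v := @measurable_code _ Om' m r Y' v mY'.
have E r : \int[Q]_w g (decode (code m r (Y^~ w))) = \int[Q']_w g (decode (code m r (Y'^~ w))).
  rewrite (finite_expect Q (fun v => g (decode v)) (mc r)).2.
  rewrite (finite_expect Q' (fun v => g (decode v)) (mc' r)).2.
  apply: eq_bigr => v _; rewrite !preimage_code box//.
have [|n w|w|_ h1] := @expect_cvg _ _ _ Q (fun r w => g (decode (code m r (Y^~ w))))
  (fun w => g (Y^~ w)) K.
- by move=> r; exact: (finite_expect Q (fun v => g (decode v)) (mc r)).1.
- exact: gK.
- exact: decode_cvg Lg.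
have [|n w|w|_ h2] := @expect_cvg _ _ _ Q' (fun r w => g (decode (code m r (Y'^~ w))))
  (fun w => g (Y'^~ w)) K.
- by move=> r; exact: (finite_expect Q' (fun v => g (decode v)) (mc' r)).1.
- exact: gK.
- exact: decode_cvg Lg.
apply: (@cvg_unique _ _ _ _ _ _ h1) => //.
by rewrite /= (funext E); exact: h2.
Qed.
End BoxLaw.

(** * Gaussian and Brownian expectations *)

Section GaussianMoments.
Context {R : realType}.
Local Notation mu := (@lebesgue_measure R).

(** The change of variables involves the Radon-Nikodym derivative, which agrees almost everywhere
    with [normal_pdf] because both have the same integrals over measurable sets. *)
Lemma ge0_integral_normal_prob (m s : R) (f : R -> R) : s != 0 -> (forall x, 0 <= f x) ->
  measurable_fun setT f ->
  (\int[normal_prob m s]_x (f x)%:E = \int[mu]_x (f x * normal_pdf m s x)%:E)%E.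
Proof.
move=> s0 f0 mf.
rewrite -(Radon_Nikodym_SigmaFinite.change_of_variables (normal_prob_dominates m s))//=; last first.
  exact/measurable_EFinP.
under [RHS]eq_integral do rewrite EFinM.
apply: ae_eq_integral => //.
- apply: emeasurable_funM; first exact/measurable_EFinP.
  apply: (measurable_int mu).
  exact: Radon_Nikodym_SigmaFinite.f_integrable (normal_prob_dominates m s).
- apply: emeasurable_funM; first exact/measurable_EFinP.
  by apply/measurable_EFinP; exact: measurable_normal_pdf.
- apply: ae_eqe_mul2l => /=.
  apply: integral_ae_eq => //=.
  + exact: Radon_Nikodym_SigmaFinite.f_integrable (normal_prob_dominates m s).
  + by apply/measurable_EFinP; exact: measurable_normal_pdf.
  + move=> E _ mE.
    by rewrite -(Radon_Nikodym_SigmaFinite.f_integral (normal_prob_dominates m s)).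
Qed.

Lemma normal_mgf (s t : R) : s != 0 ->
  (\int[normal_prob 0 s]_x (expR (t * x))%:E = (expR (t ^+ 2 * s ^+ 2 / 2))%:E)%E.
Proof.
move=> s0; rewrite ge0_integral_normal_prob//; last first.
  by apply: measurableT_comp => //; exact: measurable_funM.
(* Completing the square: the exponential tilt shifts the mean by [t s^2]. *)
have E x : expR (t * x) * normal_pdf 0 s x =
    expR (t ^+ 2 * s ^+ 2 / 2) * normal_pdf (t * s ^+ 2) s x.
  rewrite !normal_pdfE// mulrCA [RHS]mulrCA; congr (_ * _).
  rewrite /normal_fun -!expRD; congr expR; rewrite -mulr_natl; field.
  exact: s0.
under eq_integral do rewrite E EFinM.
rewrite ge0_integralZl//=.
- by rewrite integral_normal_pdf mule1.
- by apply/measurable_EFinP; exact: measurable_normal_pdf.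
- by move=> x _; rewrite lee_fin normal_pdf_ge0.
Qed.

Lemma expR_norm_le (x : R) : expR `|x| <= expR x + expR (- x).
Proof.
have [x0|x0] := leP 0 x; first by rewrite ger0_norm// lerDl expR_ge0.
by rewrite ltr0_norm// lerDr expR_ge0.
Qed.

(** Each use of the mean value theorem raises the order of the remainder by one; the constant is 1
    instead of the sharp one. *)
Lemma expR_taylor2 (y : R) :
  `|expR y - 1 - y - y ^+ 2 / 2| <= `|y| ^+ 3 * expR `|y|.
Proof.
have mono (c z : R) : `|c| <= `|z| -> expR c <= expR `|z|.
  by move=> cz; rewrite ler_expR (le_trans (ler_norm _)).
have b1 (z : R) : `|expR z - 1| <= `|z| * expR `|z|.
  have [c cz E] := MVT_point 0 z (@is_derive_expR R).
  rewrite -{1}expR0 E subr0 normrM mulrC ler_wpM2l//.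
  by rewrite !subr0 in cz; rewrite ger0_norm ?expR_ge0// mono.
have b2 (z : R) : `|expR z - 1 - z| <= `|z| ^+ 2 * expR `|z|.
  have D (x : R) : is_derive x 1 (fun x => expR x - 1 - x) (expR x - 1).
    by apply: is_derive_eq; rewrite subr0.
  have [c cz E] := MVT_point 0 z D.
  rewrite expR0 subrr !subr0 in E cz.
  rewrite E normrM expr2 [leRHS]mulrAC ler_wpM2r//.
  apply: le_trans (b1 c) _; apply: ler_pM => //.
  by rewrite ler_expR.
have D (x : R) : is_derive x 1 (fun x => expR x - 1 - x - x ^+ 2 / 2) (expR x - 1 - x).
  by apply: is_derive_eq; rewrite /GRing.scale/=; field.
have [c cz E] := MVT_point 0 y D.
rewrite expR0 subrr !subr0 [0 ^+ 2]expr2 !mul0r subrr subr0 in E cz.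
rewrite E normrM exprSr [leRHS]mulrAC ler_wpM2r//.
apply: le_trans (b2 c) _; apply: ler_pM => //.
- by rewrite lerXn2r.
- by rewrite ler_expR.
Qed.

Section variable_with_normal_law.
Context d (Om : measurableType d) (Q : probability Om R) (X : Om -> R) (v : R).
Hypothesis v0 : 0 < v.
Hypothesis mX : measurable_fun setT X.
Hypothesis lawX : forall V, measurable V -> Q (X @^-1` V) = normal_prob 0 (Num.sqrt v) V.

Lemma mgf_integrable t : Q.-integrable setT (EFin \o (fun w => expR (t * X w))) /\
  \int[Q]_w expR (t * X w) = expR (t ^+ 2 * v / 2).
Proof.
have mexp : measurable_fun setT (fun x : R => expR (t * x)).
  by apply: measurableT_comp => //; exact: measurable_funM.
have mexpX : measurable_fun setT (fun w => expR (t * X w)).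
  exact: measurableT_comp mexp mX.
have E : (\int[Q]_w (expR (t * X w))%:E = (expR (t ^+ 2 * v / 2))%:E)%E.
  have s0 : Num.sqrt v != 0 by rewrite gt_eqF// sqrtr_gt0.
  have := normal_mgf t s0; rewrite sqr_sqrtr ?ltW// => <-.
  pose X' : {mfun Om >-> measurableTypeR R} :=
    HB.pack X (isMeasurableFun.Build _ _ Om (measurableTypeR R) X mX).
  rewrite -(@eq_measure_integral _ (measurableTypeR R) R setT _ (distribution Q X')).
    rewrite (@ge0_integral_pushforward _ _ Om (measurableTypeR R) R X mX Q setT
      (fun x => (expR (t * x))%:E) measurableT)//.
    by apply/measurable_EFinP; exact: mexp.
  by move=> V mV _; exact: lawX.
split; last by rewrite /Rintegral E.
apply/integrableP; split; first exact/measurable_EFinP.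
under eq_integral do rewrite gee0_abs ?lee_fin ?expR_ge0//.
by rewrite E ltry.
Qed.

Let dominated (f : Om -> R) (C a : R) : measurable_fun setT f ->
  (forall w, `|f w| <= C * (expR (a * X w) + expR (- a * X w))) ->
  Q.-integrable setT (EFin \o f) /\
  \int[Q]_w `|f w| <= C * (2 * expR (a ^+ 2 * v / 2)).
Proof.
move=> mf fC.
have [I1 E1] := mgf_integrable a; have [I2 E2] := mgf_integrable (- a).
have I12 : Q.-integrable setT (EFin \o (fun w => expR (a * X w) + expR (- a * X w))).
  by rewrite (_ : _ \o _ = ((EFin \o (fun w => expR (a * X w))) \+ (EFin \o (fun w => expR (- a * X w))))%E) //;
  exact: integrableD.
have I3 : Q.-integrable setT (EFin \o (fun w => C * (expR (a * X w) + expR (- a * X w)))).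
  have := integrableZl measurableT C I12.
  by apply: eq_integrable => // w _; rewrite /= EFinM.
have If : Q.-integrable setT (EFin \o f).
  apply: le_integrable I3 => //; first exact/measurable_EFinP.
  move=> w _; rewrite /= lee_fin (le_trans (fC w))//.
  exact: ler_norm.
split => //; apply: (@le_trans _ _ (\int[Q]_w (C * (expR (a * X w) + expR (- a * X w))))).
  apply: le_Rintegral => //.
  by have := integrable_abse If; apply: eq_integrable => // w _; rewrite /= abse_EFin.
by rewrite RintegralZl// RintegralD// E1 E2 sqrrN mulr_natl mulr2n.
Qed.

Lemma gauss_integrable : [/\ Q.-integrable setT (EFin \o X),
   Q.-integrable setT (EFin \o (fun w => X w ^+ 2)) &
   Q.-integrable setT (EFin \o (fun w => `|X w| ^+ 3))].
Proof.
have cube w : `|X w| ^+ 3 <= 216 * (expR (1 * X w) + expR (- 1 * X w)).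
  apply: le_trans (expR_cube (normr_ge0 _)) _; rewrite ler_pM2l//.
  rewrite mul1r mulN1r; apply: le_trans (expR_norm_le _); rewrite ler_expR.
  by have := normr_ge0 (X w); lra.
have one w : 1 <= expR (1 * X w) + expR (- 1 * X w).
  by rewrite mul1r mulN1r; apply: le_trans (expR_norm_le _); rewrite -expR0 ler_expR.
have pos w : 0 <= expR (1 * X w) + expR (- 1 * X w) by rewrite addr_ge0 ?expR_ge0.
(* Lower powers are at most [1 + |X|^3], whence [217 = 1 + 216]. *)
have pow n w : (n <= 3)%N -> `|X w| ^+ n <= 217 * (expR (1 * X w) + expR (- 1 * X w)).
  move=> n3; apply: (@le_trans _ _ (1 + `|X w| ^+ 3)).
    have [x1|x1] := leP `|X w| 1.
      by rewrite (le_trans (exprn_ile1 n (normr_ge0 _) x1))// lerDl exprn_ge0.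
    by rewrite ler_wpDl// ler_eXn2l.
  by have := cube w; have := one w; lra.
split.
- apply: (@dominated _ 217 1 _ _).1 => // w.
  exact: (pow 1).
- apply: (@dominated _ 217 1 _ _).1; first exact: measurable_funX.
  by move=> w; rewrite normrX; exact: pow.
- apply: (@dominated _ 217 1 _ _).1.
    by apply: measurable_funX; exact: measurableT_comp.
  by move=> w; rewrite normrX normr_id; exact: pow.
Qed.

Let small0 (x M : R) : (forall t, 0 < t <= 1 -> `|x| <= t * M) -> x = 0.
Proof.
move=> h; apply/eqP; rewrite -normr_eq0; apply/negPn/negP => x0.
have {}x0 : 0 < `|x| by rewrite lt_def x0 normr_ge0.
have M0 : 0 < M by have := h 1; rewrite ltr01 lexx mul1r => /(_ isT); exact: lt_le_trans.
pose t := Num.min 1 (`|x| / (2 * M)).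
have t0 : 0 < t by rewrite /t lt_min ltr01 divr_gt0// mulr_gt0.
have := h t; rewrite t0 ge_min lexx => /(_ isT).
suff : t * M <= `|x| / 2 by lra.
rewrite -ler_pdivlMr// -mulrA -invfM /t ge_min lexx orbT//.
Qed.

(** Mean and variance are read off the generating function, expanded at [t = 0] with an error of
    order [t^3]. *)
Let second_order : exists M : R, 0 <= M /\ forall t, `|t| <= 1 ->
  `|expR (t ^+ 2 * v / 2) - 1 - t * \int[Q]_w X w - t ^+ 2 / 2 * \int[Q]_w (X w ^+ 2)| <=
     `|t| ^+ 3 * M.
Proof.
(* The rate [3 / 2] adds the [1/2] of [expR_cube] to the factor [expR |t X|] of the Taylor
   remainder, with [|t| <= 1]. *)
exists (216 * (2 * expR ((3 / 2) ^+ 2 * v / 2))).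
split; first by rewrite !mulr_ge0 ?expR_ge0.
move=> t t1; have [I1 I2 _] := gauss_integrable; have [It Et] := mgf_integrable t.
have Z1 := integrableZl measurableT t I1; have Z2 := integrableZl measurableT (t ^+ 2 / 2) I2.
have I0 : Q.-integrable setT (EFin \o cst (1 : R)).
  exact: (@bounded_integrable _ _ _ _ _ `|1|).
have := @dominated (fun w => expR (t * X w) - 1 - t * X w - t ^+ 2 / 2 * X w ^+ 2)
  (`|t| ^+ 3 * 216) (3 / 2).
have mexp : measurable_fun setT (fun w => expR (t * X w)).
  by apply: measurableT_comp => //; exact: measurable_funM.
case.
- apply: measurable_funB; last by apply: measurable_funM => //; exact: measurable_funX.
  apply: measurable_funB; last exact: measurable_funM.
  exact: measurable_funB.
- move=> w; have := expR_taylor2 (t * X w).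
  rewrite (_ : (t * X w) ^+ 2 / 2 = t ^+ 2 / 2 * X w ^+ 2); last by ring.
  move=> h; apply: le_trans h _; rewrite normrM exprMn -[leRHS]mulrA -[leLHS]mulrA ler_wpM2l ?exprn_ge0//.
  apply: (@le_trans _ _ (216 * expR (`|X w| / 2) * expR `|X w|)).
    apply: ler_pM; rewrite ?exprn_ge0 ?expR_ge0//; first exact: expR_cube.
    by rewrite ler_expR ler_piMl.
  rewrite -mulrA ler_pM2l// -expRD.
  rewrite (_ : _ + _ = `|3 / 2 * X w|); last by rewrite normrM ger0_norm//; field.
  by rewrite mulNr; exact: expR_norm_le.
move=> If h.
have {h} := h; rewrite -[leRHS]mulrA => h; apply: le_trans h.
have -> : expR (t ^+ 2 * v / 2) - 1 - t * \int[Q]_w X w - t ^+ 2 / 2 * \int[Q]_w (X w ^+ 2) =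
   \int[Q]_w (expR (t * X w) - 1 - t * X w - t ^+ 2 / 2 * X w ^+ 2).
  have IB (f g : Om -> R) : Q.-integrable setT (EFin \o f) -> Q.-integrable setT (EFin \o g) ->
    Q.-integrable setT (EFin \o (fun w => f w - g w)).
    by move=> If' Ig; have := integrableB measurableT If' Ig; apply: eq_integrable.
  have IZ a (f : Om -> R) : Q.-integrable setT (EFin \o f) ->
    Q.-integrable setT (EFin \o (fun w => a * f w)).
    by move=> If'; have := integrableZl measurableT a If'; apply: eq_integrable.
  rewrite RintegralB; [|by []|exact: IB (IB _ _ It I0) (IZ _ _ I1)|exact: IZ].
  rewrite RintegralB; [|by []|exact: IB It I0|exact: IZ].
  by rewrite RintegralB// Et expect_cst RintegralZl// RintegralZl.
exact: le_normr_Rintegral.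
Qed.

Lemma gauss_mean : \int[Q]_w X w = 0.
Proof.
have [M [M0 h]] := second_order.
apply: (@small0 _ M) => t /andP[t0 t1].
have nt : `|t| = t by rewrite gtr0_norm.
(* The generating function is even, so subtracting the expansions at [t] and [- t] leaves the mean
   alone, up to order [t^3]. *)
have := h t; have := h (- t); rewrite !normrN nt => /(_ t1) + /(_ t1).
rewrite !sqrrN; set a := expR _; set e := \int[Q]_w X w; set b := t ^+ 2 / 2 * _.
move=> h1 h2.
have h3 : `|2 * t * e| <= 2 * (t ^+ 3 * M).
  rewrite (_ : 2 * t * e = (a - 1 - - t * e - b) - (a - 1 - t * e - b)); last by ring.
  by apply: le_trans (ler_normB _ _) _; rewrite mulr_natl mulr2n lerD.
have h4 : `|e| <= t ^+ 2 * M.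
  move: h3; rewrite !normrM nt ger0_norm// -mulrA ler_pM2l// exprS -mulrA ler_pM2l//.
apply: le_trans h4 _; rewrite ler_wpM2r// expr2 ler_piMl// ltW//.
Qed.

Lemma gauss_var : \int[Q]_w (X w ^+ 2) = v.
Proof.
have [M [M0 h]] := second_order.
pose M' := 2 * (M + v ^+ 2 / 8 + (v / 2) ^+ 3 * expR (v / 2)).
apply/esym/eqP; rewrite -subr_eq0; apply/eqP.
apply: (@small0 _ M') => t /andP[t0 t1].
have nt : `|t| = t by rewrite gtr0_norm.
have := h t; rewrite nt => /(_ t1); rewrite gauss_mean mulr0 subr0.
set w2 := \int[Q]_w _ => h1.
have tt : t ^+ 2 <= 1 by rewrite exprn_ile1// ltW.
(* Once the mean is gone, the expansion is compared with that of [expR u]: at order [t^2] only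
   [v - w2] is left, and [M'] collects the other errors. *)
pose u := t ^+ 2 * v / 2.
have u0 : 0 <= u by rewrite !mulr_ge0 ?sqr_ge0// ltW.
have uv : u <= v / 2 by rewrite /u -mulrA ler_piMl// divr_ge0// ltW.
have h2 := expR_taylor2 u.
rewrite -/u in h1; rewrite (ger0_norm u0) in h2.
have u2 : u ^+ 2 / 2 <= t ^+ 3 * (v ^+ 2 / 8).
  rewrite (_ : u ^+ 2 / 2 = t ^+ 3 * t * (v ^+ 2 / 8)); last by rewrite /u; field.
  rewrite ler_wpM2r//; first by rewrite divr_ge0 ?sqr_ge0.
  by rewrite ler_piMr// exprn_ge0// ltW.
have u3 : u ^+ 3 * expR u <= t ^+ 3 * ((v / 2) ^+ 3 * expR (v / 2)).
  rewrite mulrA; apply: ler_pM; rewrite ?exprn_ge0 ?expR_ge0 ?ler_expR//.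
  rewrite -exprMn lerXn2r ?nnegrE//; first by rewrite mulr_ge0 ?divr_ge0// ltW.
  rewrite /u expr2 -!mulrA ler_pM2l// ler_piMl// divr_ge0// ltW//.
have u20 : 0 <= u ^+ 2 / 2 by rewrite divr_ge0 ?sqr_ge0.
have h3 : t ^+ 2 / 2 * `|v - w2| <= t ^+ 3 * (M' / 2).
  rewrite -[t ^+ 2 / 2]ger0_norm ?divr_ge0 ?sqr_ge0// -normrM.
  rewrite (_ : t ^+ 2 / 2 * (v - w2) = (expR u - 1 - t ^+ 2 / 2 * w2) - (expR u - 1 - u - u ^+ 2 / 2) - u ^+ 2 / 2); last first.
    by rewrite /u; ring.
  apply: le_trans (ler_normB _ _) _; rewrite (ger0_norm u20).
  apply: le_trans (lerD (ler_normB _ _) (lexx _)) _.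
  have -> : t ^+ 3 * (M' / 2) = t ^+ 3 * M + t ^+ 3 * ((v / 2) ^+ 3 * expR (v / 2)) + t ^+ 3 * (v ^+ 2 / 8).
    by rewrite /M'; field.
  by apply: lerD => //; apply: lerD => //; exact: le_trans h2 _.
have t20 : 0 < t ^+ 2 / 2 by rewrite divr_gt0 ?exprn_gt0.
rewrite -(ler_pM2l t20); apply: le_trans h3 _; rewrite le_eqVlt; apply/orP; left; apply/eqP.
by field.
Qed.

(** Apply [expR_cube] to [X / sqrt v]. The constant is weakened to that of [binE_abs3], so that
    chain steps and Gaussian steps have the same error term. *)
Lemma gauss_abs3 : \int[Q]_w (`|X w| ^+ 3) <= 432 * expR 1 * (v * Num.sqrt v).
Proof.
have s0 : 0 < Num.sqrt v by rewrite sqrtr_gt0.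
have E : v * Num.sqrt v = Num.sqrt v ^+ 3 by rewrite exprSr sqr_sqrtr// ltW.
have [|w|_ h] := @dominated (fun w => `|X w| ^+ 3) (216 * (v * Num.sqrt v)) (Num.sqrt v)^-1.
- by apply: measurable_funX; exact: measurableT_comp.
- have := expR_cube (normr_ge0 ((Num.sqrt v)^-1 * X w)).
  set z := _ * X w; rewrite mulNr -/z normrX normr_id => h.
  have -> : `|X w| ^+ 3 = v * Num.sqrt v * `|z| ^+ 3.
    rewrite /z normrM exprMn normfV (gtr0_norm s0) exprVn -E mulrA divff ?mul1r//.
    by rewrite mulf_neq0 ?gt_eqF.
  rewrite [216 * _]mulrC -[leRHS]mulrA ler_wpM2l//; first by rewrite mulr_ge0// ltW.
  apply: le_trans h _; rewrite ler_pM2l//; apply: le_trans (expR_norm_le _).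
  by rewrite ler_expR ler_pdivrMr// ler_peMr// ler1n.
under eq_Rintegral do rewrite -[X in X ^+ 3]normr_id -normrX.
apply: le_trans h _.
rewrite exprVn sqr_sqrtr ?(ltW v0)// mulVf ?gt_eqF//.
have -> : 432 * expR 1 * (v * Num.sqrt v) = 216 * (v * Num.sqrt v) * (2 * expR (1 : R)) by ring.
rewrite ler_wpM2l//; first by rewrite !mulr_ge0// ltW.
by rewrite ler_pM2l// ler_expR; lra.
Qed.
End variable_with_normal_law.
End GaussianMoments.

(** * Brownian increments and the heat semigroup *)

Section Brownian.
Context {R : realType} d (Om : measurableType d) (Q : probability Om R) (B : R -> Om -> R).
Implicit Types (f g : R -> R).
Hypothesis hB : brownian_motion Q B.

Lemma brownian_measurable t : measurable_fun setT (B t).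
Proof. by case: hB. Qed.

Lemma brownian0 w : B 0 w = 0.
Proof. by case: hB. Qed.

Lemma brownian_law s V : 0 < s -> measurable V ->
  Q (B s @^-1` V) = normal_prob 0 (Num.sqrt s) V.
Proof.
move=> s0 mV; have [_ _ _ /(_ 0 s V)] := hB.
rewrite lexx s0 subr0 => /(_ isT mV) <- _; congr (Q _).
by apply/seteqP; split => w /=; rewrite brownian0 subr0.
Qed.

Definition heat s (f : R -> R) x := \int[Q]_w f (x + B s w).

Lemma heat0 f x : heat 0 f x = f x.
Proof.
by rewrite /heat -[RHS](expect_cst Q); apply: eq_Rintegral => w _; rewrite brownian0 addr0.
Qed.

Lemma heat_measurable s f x : continuous f -> measurable_fun setT (fun w => f (x + B s w)).
Proof.
move=> cf; apply: (@measurableT_comp _ _ _ _ _ _ f); first exact: continuous_measurable_fun.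
by apply: measurable_funD => //; exact: brownian_measurable.
Qed.

Lemma heat_bounded s f K x : continuous f -> (forall x, `|f x| <= K) -> `|heat s f x| <= K.
Proof. by move=> cf fK; apply: ler_norm_expect => //; exact: heat_measurable. Qed.

Lemma heat_close s f g K e x : continuous f -> continuous g ->
  (forall x, `|f x| <= K) -> (forall x, `|g x| <= K) -> (forall x, `|f x - g x| <= e) ->
  `|heat s f x - heat s g x| <= e.
Proof.
move=> cf cg fK gK fg; rewrite /heat -RintegralB//.
- apply: ler_norm_expect => //; apply: measurable_funB; exact: heat_measurable.
- by apply: (@bounded_integrable _ _ _ _ _ K) => //; exact: heat_measurable.
- by apply: (@bounded_integrable _ _ _ _ _ K) => //; exact: heat_measurable.
Qed.

Lemma heat_lipschitz s f L K : lipschitzR L f -> (forall x, `|f x| <= K) ->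
  lipschitzR L (heat s f).
Proof.
move=> Lf fK x y; have cf := lipschitzR_continuous Lf.
rewrite /heat -RintegralB//.
- apply: ler_norm_expect => [|w].
    by apply: measurable_funB; exact: heat_measurable.
  by apply: le_trans (Lf _ _) _; rewrite opprD addrACA subrr addr0.
- by apply: (@bounded_integrable _ _ _ _ _ K) => //; exact: heat_measurable.
- by apply: (@bounded_integrable _ _ _ _ _ K) => //; exact: heat_measurable.
Qed.

(** Averaging over translates keeps the expansion with the same [C], whatever [s]: one smoothing of
    [f] serves all steps of a block. *)
Lemma heat_taylor s f f1 f2 K K1 K2 C x y :
  [/\ continuous f, continuous f1 & continuous f2] ->
  [/\ forall x, `|f x| <= K, forall x, `|f1 x| <= K1 & forall x, `|f2 x| <= K2] ->
  (forall x y, `|f (x + y) - (f x + f1 x * y + f2 x * (y ^+ 2 / 2))| <= C * `|y| ^+ 3) ->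
  `|heat s f (x + y) - (heat s f x + heat s f1 x * y + heat s f2 x * (y ^+ 2 / 2))| <= C * `|y| ^+ 3.
Proof.
move=> [cf cf1 cf2] [bf bf1 bf2] tay.
have I g M z : continuous g -> (forall x, `|g x| <= M) ->
   Q.-integrable setT (EFin \o (fun w => g (z + B s w))).
  by move=> cg gM; apply: (@bounded_integrable _ _ _ _ _ M) => //; exact: heat_measurable.
have If z := I f K z cf bf; have If1 z := I f1 K1 z cf1 bf1; have If2 z := I f2 K2 z cf2 bf2.
have IZ a (g : Om -> R) : Q.-integrable setT (EFin \o g) ->
    Q.-integrable setT (EFin \o (fun w => g w * a)).
  by move=> Ig; have := integrableZr measurableT a Ig; apply: eq_integrable.
have ID (g h : Om -> R) : Q.-integrable setT (EFin \o g) -> Q.-integrable setT (EFin \o h) ->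
    Q.-integrable setT (EFin \o (fun w => g w + h w)).
  by move=> Ig Ih; have := integrableD measurableT Ig Ih; apply: eq_integrable.
rewrite /heat -!RintegralZr// -RintegralD//; last exact: IZ.
rewrite -RintegralD//; [|exact: ID (IZ _ _ _)|exact: IZ].
rewrite -RintegralB//; last first.
  by have := ID _ _ (ID _ _ (If x) (IZ y _ (If1 x))) (IZ (y ^+ 2 / 2) _ (If2 x)).
apply: ler_norm_expect => [|w].
  apply: measurable_funB; first exact: heat_measurable.
  apply: measurable_funD; last by apply: measurable_funM => //; exact: heat_measurable.
  apply: measurable_funD; first exact: heat_measurable.
  by apply: measurable_funM => //; exact: heat_measurable.
by rewrite addrAC; exact: tay.
Qed.

Definition upd (y : nat -> R) (j : nat) (a : R) : nat -> R :=
  fun i => if i == j then a else y i.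

Section increments.
Variables (m : nat) (tt : nat -> R).
Hypothesis tt0 : tt 0%N = 0.
Hypothesis tt_lt : forall i, (i < m)%N -> tt i < tt i.+1.

Definition incr i w := B (tt i.+1) w - B (tt i) w.

Let tt_ge0 i : (i <= m)%N -> 0 <= tt i.
Proof.
elim: i => [_|i IH im]; first by rewrite tt0.
by rewrite (le_trans (IH (ltnW im)))// ltW// tt_lt.
Qed.

Lemma measurable_incr i : measurable_fun setT (incr i).
Proof. by apply: measurable_funB; exact: brownian_measurable. Qed.

Lemma incr_law i V : (i < m)%N -> measurable V ->
  Q (incr i @^-1` V) = Q (B (tt i.+1 - tt i) @^-1` V).
Proof.
move=> im mV; have [_ _ _ h _] := hB.
rewrite (brownian_law _ mV); last by rewrite subr_gt0 tt_lt.
apply: h => //; apply/andP; split; first exact: tt_ge0 (ltnW im).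
exact: tt_lt.
Qed.

(** Independence in Fubini form: on [Q \x Q] the increment [j] is taken from the first factor and
    the others from the second, and this family gives every box the same probability as the original
    one. *)
Lemma brownian_resample L K (g : (nat -> R) -> R) j : (j < m)%N -> lipN m L g -> (forall y, `|g y| <= K) ->
  \int[Q]_w g (incr^~ w) =
  \int[Q]_w (\int[Q]_w' g (upd (incr^~ w') j (B (tt j.+1 - tt j) w))).
Proof.
move=> jm Lg gK.
pose v := tt j.+1 - tt j.
pose Y' i (ww : Om * Om) := if i == j then B v ww.1 else incr i ww.2.
have mY' i : measurable_fun setT (Y' i).
  rewrite /Y'; case: eqP => _.
    by apply: measurableT_comp; [exact: brownian_measurable|exact: measurable_fst].
  by apply: measurableT_comp; [exact: measurable_incr|exact: measurable_snd].
have [_ _ _ _ indep] := hB.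
have E : \int[Q]_w g (incr^~ w) = \int[(Q \x Q)%E]_ww g (Y'^~ ww).
  apply: (box_law_expect Lg gK) => [i _|i _|V mV].
  - exact: measurable_incr.
  - exact: mY'.
  rewrite indep//.
  pose V' i := if i == j then setT else V i.
  have mV' i : measurable (V' i) by rewrite /V'; case: eqP.
  transitivity ((Q \x Q)%E ((B v @^-1` V j) `*` [set w | forall i, (i < m)%N -> V' i (incr i w)])).
    have m1 : measurable (B v @^-1` V j).
      by rewrite -[X in measurable X]setTI; exact: brownian_measurable.
    have m2 : measurable [set w | forall i, (i < m)%N -> V' i (incr i w)].
      rewrite (_ : [set w | _] = \bigcap_(i in `I_m) (incr i @^-1` V' i)); last first.
        by apply/seteqP; split => w.
      apply: fin_bigcap_measurable => // i _.
      by rewrite -[X in measurable X]setTI; exact: measurable_incr.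
    rewrite (product_measure1E Q Q m1 m2)/=.
    have -> : Q [set w | forall i, (i < m)%N -> V' i (incr i w)] =
        (\prod_(i < m) Q [set w | V' i (B (tt i.+1) w - B (tt i) w)%R])%E by exact: indep.
    rewrite (bigD1 (Ordinal jm))//= -(incr_law jm (mV j)); congr (_ * _)%E.
    rewrite [RHS](bigD1 (Ordinal jm))//= /V' eqxx (_ : [set w | _] = setT) ?probability_setT ?mul1e.
      by apply: eq_bigr => i /eqP ij; case: eqP => // ij'; case: ij; exact/val_inj.
    by apply/seteqP; split.
  congr (_ _); apply/seteqP; split => -[w w'] /=.
    move=> [h1 h2] i im; rewrite /Y'; case: eqP => [->//|/eqP ij].
    by have := h2 i im; rewrite /V' (negbTE ij).
  move=> h; split; first by have := h j jm; rewrite /Y' eqxx.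
  by move=> i im; have := h i im; rewrite /V' /Y'; case: eqP.
rewrite E {1}/Rintegral -integral12_prod_meas1; last first.
  have := @bounded_integrable _ _ _ (Q \x Q)%E (fun ww => g (Y'^~ ww)) K _ (fun ww => gK _).
  by apply; apply: (lipN_measurable (Q \x Q)%E Lg) => i _; exact: mY'.
congr fine; apply: eq_integral => w _.
rewrite /fubini_F /Rintegral fineK; last first.
  apply: (@integrable_fin_num _ _ _ Q setT measurableT
    (EFin \o (fun w' => g (upd (incr^~ w') j (B v w))))).
  have := @bounded_integrable _ _ _ Q (fun w' => g (upd (incr^~ w') j (B v w))) K _ (fun w' => gK _).
  apply; apply: (lipN_measurable Q Lg) => i _; rewrite /upd; case: eqP => // _.
  exact: measurable_incr.
by apply: eq_integral.
Qed.
End increments.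

Lemma heat_add s t f L K x : 0 <= s -> 0 <= t -> lipschitzR L f -> (forall x, `|f x| <= K) ->
  heat (s + t) f x = heat s (heat t f) x.
Proof.
move=> s0 t0 Lf fK.
(* Increments are taken along a strictly increasing grid, so zero lengths are treated apart. *)
have [->|sn0] := eqVneq s 0; first by rewrite heat0 add0r.
have [->|tn0] := eqVneq t 0.
  by rewrite addr0; congr (heat s _ x); apply/funext => y; rewrite heat0.
have {s0}s0 : 0 < s by rewrite lt_def sn0.
have {t0}t0 : 0 < t by rewrite lt_def tn0.
pose tt i : R := if i is j.+1 then (if j is 0%N then s else s + t) else 0.
have tt_lt i : (i < 2)%N -> tt i < tt i.+1.
  by case: i => [|[|]]//= _; rewrite ltrDl.
pose g (y : nat -> R) := f (x + (y 0%N + y 1%N)).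
have Lg : lipN 2 `|L| g.
  move=> y z; rewrite /g big_ord_recr big_ord1/=.
  apply: le_trans (Lf _ _) _; apply: (@le_trans _ _ (`|L| * `|(y 0%N - z 0%N) + (y 1%N - z 1%N)|)).
    rewrite [X in _ * `|X| <= _](_ : _ = (y 0%N - z 0%N) + (y 1%N - z 1%N)); last by ring.
    by rewrite ler_wpM2r// ler_norm.
  by rewrite ler_wpM2l// ler_normD.
have tt0 : tt 0%N = 0 by [].
transitivity (\int[Q]_w g ((incr tt)^~ w)).
  rewrite /heat; apply: eq_Rintegral => w _; rewrite /g /incr/= brownian0 subr0.
  by rewrite [B s w + _]addrC subrK.
rewrite (brownian_resample tt0 tt_lt (isT : (0 < 2)%N) Lg (fun y => fK _)).
apply: eq_Rintegral => w _; rewrite subr0 /g /upd/=.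
have L1 : lipN 1 `|L| (fun y => f (x + (B s w + y 0%N))).
  move=> y z; rewrite big_ord1; apply: le_trans (Lf _ _) _.
  rewrite [X in _ * `|X| <= _](_ : _ = (y 0%N - z 0%N)); last by ring.
  by rewrite ler_wpM2r// ler_norm.
have box (U : nat -> set R) (Y : Om -> R) :
    [set w | forall i, (i < 1)%N -> U i (Y w)] = Y @^-1` U 0%N.
  by apply/seteqP; split => w' /=; [move=> /(_ 0%N isT)|move=> h [|]].
rewrite (@box_law_expect _ _ _ Q _ _ Q _ _ K (fun y => f (x + (B s w + y 0%N)))
   (fun _ => incr tt 1%N) (fun _ => B t) L1) => [||_ _|_ _|V mV].
- by rewrite /heat; apply: eq_Rintegral => w' _; rewrite addrA.
- by move=> y; exact: fK.
- exact: measurable_incr.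
- exact: brownian_measurable.
rewrite !box; have := @incr_law 2 tt tt0 tt_lt 1 (V 0%N) isT (mV _).
by rewrite {2 3}/tt [s + t]addrC addrK.
Qed.
End Brownian.

(** * Lindeberg replacement within a block *)

Section Lindeberg.
Context {R : realType} d (Om : measurableType d) (Q : probability Om R) (B : R -> Om -> R).
Hypothesis hB : brownian_motion Q B.
Variables (N : nat) (pr : nat -> R) (nmax : nat) (tau : R).
Hypothesis pr01 : forall i, 0 <= pr i <= 1.
Hypothesis tau0 : 0 < tau.
Hypothesis mean_le2 : forall h, (size h < nmax)%N -> mean N pr h <= 2.
Local Notation stau := (Num.sqrt tau).
Local Notation mart := (mart N pr).
Local Notation mean := (mean N pr).
Local Notation chE := (chE N pr).
Local Notation fresh := (fresh N).

(** Centring removes the first-order term, [binE_var] evaluates the second-order one, and the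
    remainder is a third absolute moment. *)
Lemma binE_taylor p n (psi psi1 psi2 : R -> R) C x : 0 <= p <= 1 -> n%:R * p <= 2 -> 0 <= C ->
  (forall y, `|psi (x + y) - (psi x + psi1 x * y + psi2 x * (y ^+ 2 / 2))| <= C * `|y| ^+ 3) ->
  `|binE p n (fun c => psi (x + stau * (c%:R - n%:R * p))) -
     (psi x + psi2 x * (n%:R * p * (1 - p) * tau / 2))| <= C * (432 * expR 1) * (tau * stau).
Proof.
move=> p01 np2 C0 tay; have s2 : stau ^+ 2 = tau by rewrite sqr_sqrtr// ltW.
have -> : psi x + psi2 x * (n%:R * p * (1 - p) * tau / 2) =
   binE p n (fun c => psi x + psi1 x * (stau * (c%:R - n%:R * p)) +
      psi2 x * ((stau * (c%:R - n%:R * p)) ^+ 2 / 2)).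
  rewrite (@eq_binE _ _ _ _ (fun c => psi x + ((psi1 x * stau) * c%:R +
    (psi1 x * stau * - (n%:R * p) + (psi2 x * tau / 2) * (c%:R - n%:R * p) ^+ 2)))); last first.
    by move=> c; rewrite exprMn s2; ring.
  by rewrite !binED !binEZ !binE_cst binE_mean binE_var; ring.
rewrite -binEB.
have -> : C * (432 * expR 1) * (tau * stau) = C * stau ^+ 3 * (432 * expR 1).
  by rewrite exprSr s2; ring.
apply: le_trans (ler_norm_binE _ _ p01) _.
apply: le_trans (_ : _ <= binE p n (fun c => C * stau ^+ 3 * `|c%:R - n%:R * p| ^+ 3)) _.
  apply: le_binE => // c; apply: le_trans (tay _) _.
  by rewrite normrM exprMn mulrA ger0_norm ?sqrtr_ge0.
rewrite binEZ ler_wpM2l//; first by rewrite mulr_ge0// exprn_ge0// sqrtr_ge0.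
exact: binE_abs3.
Qed.

(** The expansion of [binE_taylor] with variance exactly [tau]: a chain step and a Gaussian step are
    compared through their Taylor polynomials. *)
Lemma heat_step (psi psi1 psi2 : R -> R) (C K x : R) : continuous psi -> (forall x, `|psi x| <= K) -> 0 <= C ->
  (forall y, `|psi (x + y) - (psi x + psi1 x * y + psi2 x * (y ^+ 2 / 2))| <= C * `|y| ^+ 3) ->
  `|heat Q B tau psi x - (psi x + psi2 x * (tau / 2))| <= C * (432 * expR 1) * (tau * stau).
Proof.
move=> cpsi bpsi C0 tay.
have mX := brownian_measurable hB tau.
have law V (mV : measurable V) := brownian_law hB tau0 mV.
have [I1 I2 I3] := gauss_integrable tau0 mX law.
have IZ a (g : Om -> R) : Q.-integrable setT (EFin \o g) ->
    Q.-integrable setT (EFin \o (fun w => a * g w)).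
  by move=> Ig; have := integrableZl measurableT a Ig; apply: eq_integrable.
have ID (g h : Om -> R) : Q.-integrable setT (EFin \o g) -> Q.-integrable setT (EFin \o h) ->
    Q.-integrable setT (EFin \o (fun w => g w + h w)).
  by move=> Ig Ih; have := integrableD measurableT Ig Ih; apply: eq_integrable.
have IB (f g : Om -> R) : Q.-integrable setT (EFin \o f) -> Q.-integrable setT (EFin \o g) ->
    Q.-integrable setT (EFin \o (fun w => f w - g w)).
  by move=> If' Ig; have := integrableB measurableT If' Ig; apply: eq_integrable.
have I0 : Q.-integrable setT (EFin \o cst (psi x)).
  exact: (@bounded_integrable _ _ _ _ _ `|psi x|).
have Ipsi : Q.-integrable setT (EFin \o (fun w => psi (x + B tau w))).
  by apply: (@bounded_integrable _ _ _ _ _ K) => //; exact: (heat_measurable hB).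
have I4 := ID _ _ (ID _ _ I0 (IZ (psi1 x) _ I1)) (IZ (psi2 x / 2) _ I2).
have E : psi x + psi2 x * (tau / 2) =
   \int[Q]_w (psi x + psi1 x * B tau w + psi2 x / 2 * (B tau w ^+ 2)).
  rewrite RintegralD; [|by []|exact: ID I0 (IZ _ _ I1)|exact: IZ].
  rewrite RintegralD; [|by []|exact: I0|exact: IZ].
  rewrite expect_cst RintegralZl// RintegralZl//.
  by rewrite (gauss_mean tau0 mX law) (gauss_var tau0 mX law); ring.
rewrite E /heat -RintegralB//; apply: le_trans (le_normr_Rintegral _ _) _ => //.
  exact: IB.
rewrite -mulrA; apply: le_trans (ler_wpM2l C0 (gauss_abs3 tau0 mX law)).
rewrite -RintegralZl//; apply: le_Rintegral => //.
- by have := integrable_abse (IB _ _ Ipsi I4); apply: eq_integrable.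
- exact: IZ.
- by move=> w _; rewrite (_ : psi2 x / 2 * _ = psi2 x * (B tau w ^+ 2 / 2)) ?tay//; ring.
Qed.

Variables (bad : pred (seq nat)) (eta : R).
Hypothesis eta0 : 0 <= eta.
Hypothesis bad_mono : forall c h, bad h -> bad (c :: h).
Hypothesis var_ok : forall h, (size h < nmax)%N -> ~~ bad h ->
  `|mean h * (1 - pr (size h)) - 1| <= eta.

Lemma bad_cat s h : bad h -> bad (s ++ h).
Proof. by move=> hb; elim: s => //= c s IH; exact: bad_mono. Qed.

(** On a bad history the crude bound 1 comes from [0 <= mean h * (1 - p) <= 2]. *)
Let var_bad h : (size h < nmax)%N -> `|mean h * (1 - pr (size h)) - 1| <= eta + (bad h)%:R.
Proof.
move=> hn; case: (boolP (bad h)) => [_|nb]; last by rewrite addr0 var_ok.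
apply: ler_wpDl => //; have m2 := mean_le2 hn.
have /andP[p0 p1] := pr01 (size h).
have m0 : 0 <= mean h by rewrite /mean mulr_ge0.
by rewrite -[leRHS]/(1 : R) ler_norml; apply/andP; split; nra.
Qed.

(** Induction on the number of steps, by conditioning on the next one: [psi] is [f] smoothed by the
    heat semigroup over the remaining time. A chain step and a Gaussian step acting on [psi] differ
    by two cubic errors, [864 = 2 * 432], and by the variance defect. *)
Lemma lindeberg_block (f f1 f2 : R -> R) (L K K1 K2 C : R) : 0 <= K2 -> 0 <= C -> lipschitzR L f ->
  continuous f1 -> continuous f2 ->
  [/\ forall x, `|f x| <= K, forall x, `|f1 x| <= K1 & forall x, `|f2 x| <= K2] ->
  (forall x y, `|f (x + y) - (f x + f1 x * y + f2 x * (y ^+ 2 / 2))| <= C * `|y| ^+ 3) ->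
  forall n h x, (size h + n <= nmax)%N ->
  `|chE n h (fun s => f (x + stau * (mart s - mart h))) - heat Q B (n%:R * tau) f x| <=
  n%:R * tau * (K2 / 2 * (eta + chE n h (fun s => (bad s)%:R)) + 864 * expR 1 * C * stau).
Proof.
move=> K20 C0 Lf cf1 cf2 bds tay; have [bf bf1 bf2] := bds.
have cf := lipschitzR_continuous Lf.
elim=> [|n IH] h x hn.
  by rewrite /= mul0r (heat0 hB) subrr mulr0 addr0 subrr normr0 !mul0r.
pose psi := heat Q B (n%:R * tau) f.
pose psi2 := heat Q B (n%:R * tau) f2.
have hsz : (size h < nmax)%N by apply: leq_trans hn; rewrite addnS ltnS leq_addr.
have p01 := pr01 (size h).
have Lpsi : lipschitzR L psi by exact: heat_lipschitz Lf bf.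
have cpsi := lipschitzR_continuous Lpsi.
have bpsi z : `|psi z| <= K by exact: heat_bounded.
have tpsi z y := heat_taylor hB (n%:R * tau) z y (And3 cf cf1 cf2) bds tay.
have nt0 : 0 <= n%:R * tau by rewrite mulr_ge0// ltW.
have st0 : 0 <= stau by rewrite sqrtr_ge0.
have E1 : heat Q B (n.+1%:R * tau) f x = heat Q B tau psi x.
  rewrite (_ : n.+1%:R * tau = tau + n%:R * tau); last by rewrite -natr1; ring.
  by apply: (heat_add hB) Lf bf => //; exact: ltW.
have S1 : `|chE n.+1 h (fun s => f (x + stau * (mart s - mart h))) -
     binE (pr (size h)) (fresh h) (fun c => psi (x + stau * (c%:R - mean h)))| <=
   n%:R * tau * (K2 / 2 * (eta + chE n.+1 h (fun s => (bad s)%:R)) + 864 * expR 1 * C * stau).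
  rewrite /= -binEB.
  apply: le_trans (ler_norm_binE _ _ p01) _.
  apply: le_trans (_ : _ <= binE (pr (size h)) (fresh h) (fun c => n%:R * tau *
     (K2 / 2 * (eta + chE n (c :: h) (fun s => (bad s)%:R)) + 864 * expR 1 * C * stau))) _.
    apply: le_binE => // c.
    have := IH (c :: h) (x + stau * (c%:R - mean h)); rewrite /= addSnnS => /(_ hn).
    apply: le_trans; rewrite le_eqVlt; apply/orP; left; apply/eqP; congr (`|_ - _|).
    by congr chE; apply/funext => s /=; congr f; ring.
  rewrite le_eqVlt; apply/orP; left; apply/eqP.
  by rewrite binEZ binED binEZ binED !binE_cst.
have S2 := binE_taylor p01 (mean_le2 hsz) C0 (tpsi x).
rewrite -/psi -/psi2 -/(mean h) in S2.
have S3 := heat_step cpsi bpsi C0 (tpsi x).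
rewrite -/psi2 -/psi in S3.
have S4 : `|psi2 x * (mean h * (1 - pr (size h)) * tau / 2) - psi2 x * (tau / 2)| <=
    tau * (K2 / 2 * (eta + chE n.+1 h (fun s => (bad s)%:R))).
  rewrite (_ : _ - _ = psi2 x / 2 * tau * (mean h * (1 - pr (size h)) - 1)); last by ring.
  rewrite normrM [leRHS]mulrA [tau * _]mulrC; apply: ler_pM => //.
    rewrite !normrM (gtr0_norm tau0) ler_pM2r// normfV [`|2|]ger0_norm// ler_pM2r//.
    exact: heat_bounded.
  apply: le_trans (var_bad hsz) _; rewrite lerD2l.
  (* A history that is bad now stays bad, so its indicator is at most the final probability. *)
  rewrite -[leLHS](chE_cst N pr n.+1 h); apply: le_chE => // s _.
  by case: (boolP (bad h)) => // /(bad_cat s) ->.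
rewrite E1.
have -> : n.+1%:R * tau * (K2 / 2 * (eta + chE n.+1 h (fun s => (bad s)%:R)) + 864 * expR 1 * C * stau) =
  n%:R * tau * (K2 / 2 * (eta + chE n.+1 h (fun s => (bad s)%:R)) + 864 * expR 1 * C * stau) +
  (C * (432 * expR 1) * (tau * stau) + tau * (K2 / 2 * (eta + chE n.+1 h (fun s => (bad s)%:R))) +
   C * (432 * expR 1) * (tau * stau)).
  by rewrite -natr1; ring.
set u := chE _ _ _ in S1 *; set v := binE _ _ _ in S1 S2; set w := heat _ _ _ _ _ in S3 *.
have -> : u - w = (u - v) + ((v - (psi x + psi2 x * (mean h * (1 - pr (size h)) * tau / 2))) +
   (psi2 x * (mean h * (1 - pr (size h)) * tau / 2) - psi2 x * (tau / 2)) -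
   (w - (psi x + psi2 x * (tau / 2)))) by ring.
apply: le_trans (ler_normD _ _) _; apply: lerD => //.
apply: le_trans (ler_normB _ _) _; apply: lerD => //.
by apply: le_trans (ler_normD _ _) _; apply: lerD.
Qed.
End Lindeberg.

(** * The critical window *)

Section Asymptotics.
Context {R : realType}.
Variables (beta : nat -> R) (k : nat) (Cb : R).
Hypothesis beta_ge0 : forall j, (2 <= j)%N -> 0 <= beta j.
Hypothesis beta_bd : forall j, (2 <= j)%N -> j%:R * beta j <= Cb.
Hypothesis k_ge3 : (3 <= k)%N.
Hypothesis beta_crit : forall j, (2 <= j <= k.-1)%N -> beta j = (j%:R * (j%:R - 1))^-1.
Local Notation mu := (mu beta k).

(** Mean number of hyperedges made of two given vertices and of some of the [i] processed ones, [a]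
    being the number of the latter. By the Poisson law, [joinp] is the probability that there is at
    least one. *)
Definition rate (N i : nat) : R :=
  \sum_(a < i.+1) 'C(i, a)%:R * (N%:R * beta a.+2 / 'C(N, a.+2)%:R).
Definition joinp (N i : nat) : R := 1 - expR (- rate N i).

(** [wgt a] is the coefficient of [x^a] in the second derivative of [beta(x)], and [q N i a] is
    close to [(i/N)^a]: thus [N * rate N i] is a discrete version of [beta''(i/N)]. *)
Let wgt (a : nat) : R := a.+2%:R * a.+1%:R * beta a.+2.
Let q (N i a : nat) : R := N%:R ^+ 2 * (i ^_ a)%:R / (N ^_ a.+2)%:R.

Lemma rate_ge0 N i : 0 <= rate N i.
Proof. by apply: sumr_ge0 => a _; rewrite !mulr_ge0 ?invr_ge0 ?beta_ge0. Qed.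

Lemma joinp01 N i : 0 <= joinp N i <= 1.
Proof.
rewrite /joinp subr_ge0 -[X in _ <= X]expR0 ler_expR oppr_le0 rate_ge0/=.
by rewrite gerBl expR_ge0.
Qed.

Lemma joinp_le N i : joinp N i <= rate N i.
Proof. by rewrite /joinp lerBlDr -lerBlDl; have := expR_ge1Dx (- rate N i); lra. Qed.

Lemma joinp_ge N i : rate N i <= 2^-1 -> rate N i - 2 * rate N i ^+ 2 <= joinp N i.
Proof.
move=> r2; have r0 := rate_ge0 N i.
have := @expR_quad R (- rate N i); rewrite normrN ger0_norm// => /(_ r2).
by rewrite /joinp sqrrN; lra.
Qed.

Let wgt_ge0 a : 0 <= wgt a.
Proof. by rewrite !mulr_ge0 ?beta_ge0. Qed.

Let wgt_crit a : (a < k.-2)%N -> wgt a = 1.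
Proof.
move=> ak; rewrite /wgt beta_crit; last by lia.
rewrite -[a.+2%:R - 1]/(a.+2%:R - 1%:R) -natrB// subn1 divff// mulf_neq0// pnatr_eq0.
Qed.

Let wgt_k : wgt k.-2 = 1 + mu.
Proof.
rewrite /wgt /mu; have -> : k.-2.+2 = k by lia.
have -> : k.-2.+1%:R = k%:R - 1 :> R by rewrite -[1]/(1%:R) -natrB; [congr (_%:R); lia|lia].
by ring.
Qed.

Let mu1_ge0 : 0 <= 1 + mu. Proof. by rewrite -wgt_k. Qed.

Let Cb_ge0 : 0 <= Cb.
Proof. by apply: le_trans (beta_bd (leqnn 2)); rewrite mulr_ge0// beta_ge0. Qed.

Let rate_term N i a : N%:R * ('C(i, a)%:R * (N%:R * beta a.+2 / 'C(N, a.+2)%:R)) = wgt a * q N i a.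
Proof.
rewrite /wgt /q -!bin_ffact (factS a.+1) (factS a) !natrM.
have [NC|NC] := eqVneq 'C(N, a.+2) 0%N; first by rewrite NC !(mul0r, invr0, mulr0).
field.
rewrite !pnatr_eq0 -lt0n fact_gt0 NC andbT /=.
by apply/andP; split; rewrite gt_eqF// ltr_wpDr.
Qed.

Section bounds.
Variables (N i : nat).
Hypothesis iN : (4 * i <= N)%N.
Hypothesis kN : (4 * k.+2 <= N)%N.
Let x : R := i%:R / N%:R.

Let N0 : 0 < N%:R :> R. Proof. by rewrite ltr0n; lia. Qed.
Let x0 : 0 <= x. Proof. by rewrite divr_ge0. Qed.
Let x4 : x <= 4^-1.
Proof. by rewrite ler_pdivrMr// ler_pdivlMl// -natrM ler_nat. Qed.

Let q_ge0 a : 0 <= q N i a. Proof. by rewrite divr_ge0 ?mulr_ge0. Qed.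

Let q_zero a : (i < a)%N -> q N i a = 0.
Proof. by move=> ia; rewrite /q ffact_small// mulr0 mul0r. Qed.

Let qS a : (a.+2 < N)%N -> q N i a.+1 = q N i a * ((i%:R - a%:R) / (N%:R - a.+2%:R)).
Proof.
move=> aN; have [ia|ai] := ltnP i a; first by rewrite !q_zero ?mul0r// ltnW.
rewrite /q (ffactnSr i a) (ffactnSr N a.+2) !natrM !natrB ?(ltnW aN)//.
rewrite invfM; ring.
Qed.

Let half a : (a <= i)%N || (a <= k)%N -> N%:R / 2 <= N%:R - a.+2%:R :> R.
Proof.
move=> h; rewrite -natrB; last by lia.
by rewrite ler_pdivrMr// -natrM ler_nat; lia.
Qed.

Let q0 : q N i 0 = N%:R / (N%:R - 1).
Proof.
rewrite /q ffactn0 ffactnS ffactn1 natrM.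
have -> : N.-1%:R = N%:R - 1 :> R by rewrite -subn1 natrB//; lia.
have N1 : N%:R - 1 != 0 :> R by rewrite subr_eq0 pnatr_eq1; lia.
by field; rewrite ?N1 ?gt_eqF.
Qed.

Let q_le2 a : q N i a <= 2.
Proof.
elim: a => [|a IH].
  by rewrite q0 ler_pdivrMr ?subr_gt0 ?ltr1n; [have : 4 <= N%:R :> R by rewrite ler_nat; lia|lia]; lra.
have [ai|ia] := leqP i a; first by rewrite q_zero// ltnS.
rewrite qS; last by lia.
apply: (@le_trans _ _ (q N i a * 1)); last by rewrite mulr1.
have h := half (_ : (a <= i)%N || (a <= k)%N); rewrite (ltnW ia) in h.
have {}h := h isT; have Np : 0 < N%:R - a.+2%:R :> R by apply: lt_le_trans h; rewrite divr_gt0.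
rewrite ler_wpM2l// ler_pdivrMr// mul1r lerBlDr.
have : i%:R * 4 <= N%:R :> R by rewrite -natrM ler_nat mulnC.
have : 0 <= a%:R :> R by []. lra.
Qed.

(** By [qS] consecutive terms have ratio [x] up to an error of order [a / N]; as [x <= 1/4], earlier
    errors are not amplified and the sum grows like [a^2 / N]. *)
Let q_close a : (a <= k)%N -> `|q N i a - x ^+ a| <= 4 * a.+1%:R ^+ 2 / N%:R.
Proof.
elim: a => [_|a IH ak].
  have N1 : 4 <= N%:R :> R by rewrite ler_nat; lia.
  rewrite q0 expr0 expr1n mulr1 (_ : _ - 1 = (N%:R - 1)^-1); last by field; rewrite gt_eqF; lra.
  rewrite ger0_norm ?invr_ge0; last by lra.
  have -> : 4 / N%:R = (N%:R / 4)^-1 :> R by field; rewrite gt_eqF.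
  by rewrite lef_pV2 ?posrE; lra.
have h := half (_ : (a <= i)%N || (a <= k)%N); rewrite (ltnW ak) orbT in h.
have {}h := h isT; have Np : 0 < N%:R - a.+2%:R :> R by apply: lt_le_trans h; rewrite divr_gt0.
have S1 : `|q N i a.+1 - x * q N i a| <= 4 * a.+2%:R / N%:R.
  rewrite qS; last by lia.
  have -> : q N i a * ((i%:R - a%:R) / (N%:R - a.+2%:R)) - x * q N i a =
     q N i a * ((a.+2%:R * x - a%:R) / (N%:R - a.+2%:R)).
    have xN : x * N%:R = i%:R by rewrite divfK ?gt_eqF.
    have -> : x * q N i a = q N i a * (x * (N%:R - a.+2%:R) / (N%:R - a.+2%:R)).
      by rewrite mulfK ?gt_eqF// mulrC.
    by rewrite -mulrBr -mulrBl -xN; congr (_ * (_ / _)); ring.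
  rewrite normrM (ger0_norm (q_ge0 a)).
  have -> : 4 * a.+2%:R / N%:R = 2 * (a.+2%:R / (N%:R / 2)) :> R by field; rewrite gt_eqF.
  apply: ler_pM => //; rewrite normrM normfV (gtr0_norm Np).
  apply: ler_pM => //; rewrite ?invr_ge0 ?(ltW Np)//; last first.
    by rewrite lef_pV2// posrE divr_gt0.
  have a20 : 0 <= a.+2%:R :> R by [].
  have a0 : 0 <= a%:R :> R by [].
  have a2 : a%:R <= a.+2%:R :> R by rewrite ler_nat (leq_trans (leqnSn a)).
  have := x4; have := x0; rewrite ler_norml => ? ?; apply/andP; split; nra.
have {}IH := IH (ltnW ak).
rewrite exprS (_ : q N i a.+1 - x * x ^+ a = (q N i a.+1 - x * q N i a) + x * (q N i a - x ^+ a)); last by ring.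
apply: le_trans (ler_normD _ _) _; rewrite [`|x * _|]normrM (ger0_norm x0).
have S2 : x * `|q N i a - x ^+ a| <= 4 * a.+1%:R ^+ 2 / N%:R.
  apply: le_trans IH; rewrite ler_piMl//; have := x4; lra.
apply: le_trans (lerD S1 S2) _; rewrite -mulrDl ler_pM2r ?invr_gt0//.
rewrite -!natr1; have : 0 <= a%:R :> R by []. nra.
Qed.

(** The ratio [(i - a) / (N - a - 2)] is at most [x] once [a >= 1], because [4 i <= N]. The factor 4
    comes from [q N i 0 <= 2] and from the first ratio, at most [2 x]. *)
Let q_tail a : (0 < a)%N -> q N i a <= 4 * x ^+ a.
Proof.
case: a => // a _; elim: a => [|a IH].
  rewrite qS; last by lia.
  have h : N%:R / 2 <= N%:R - 2%:R :> R by apply: (half (a := 0)); rewrite orbT.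
  have Np : 0 < N%:R - 2%:R :> R by apply: lt_le_trans h; rewrite divr_gt0.
  rewrite subr0 expr1 (_ : 4 * x = 2 * (i%:R / (N%:R / 2))); last by rewrite /x; field; rewrite gt_eqF.
  apply: ler_pM => //; first by rewrite divr_ge0// ltW.
  by rewrite ler_wpM2l// lef_pV2// posrE divr_gt0.
have [ai|ia] := leqP i a.+1; first by rewrite q_zero// mulr_ge0// exprn_ge0.
rewrite qS; last by lia.
apply: (@le_trans _ _ (4 * x ^+ a.+1 * x)); last by rewrite -mulrA -exprSr.
have h := half (_ : (a.+1 <= i)%N || (a.+1 <= k)%N); rewrite (ltnW ia) in h.
have {}h := h isT; have Np : 0 < N%:R - a.+3%:R :> R by apply: lt_le_trans h; rewrite divr_gt0.
apply: ler_pM => //.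
  by rewrite divr_ge0 ?(ltW Np)// subr_ge0 ler_nat ltnW.
rewrite ler_pdivrMr// /x mulrAC ler_pdivlMr//.
rewrite -!natrB; [|by lia|by lia].
by rewrite -!natrM ler_nat; nia.
Qed.

(** One summand for each error: replacing [q] by powers of [x], the term [(1 + mu) x^(k-1)] left by
    the factor [1 - x], and the tail of the series. *)
Let C1 : R := 4 * k%:R ^+ 3 * (1 + mu + 1) + (1 + mu) + 8 * Cb * 2 ^+ k.-1.

(** The reason for the critical values: they make [beta''(x)] start as
    [1 + x + ... + x^(k-3) + (1 + mu) x^(k-2)], so that [(1 - x) beta''(x)] telescopes to
    [1 + mu x^(k-2)] up to order [x^(k-1)]. *)
Lemma rate_expansion :
  `|N%:R * rate N i * (1 - x) - 1 - mu * x ^+ k.-2| <= C1 * (x ^+ k.-1 + N%:R^-1).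
Proof.
have kE : k.-2.+1 = k.-1 by lia.
have kE2 : k.-1.+1 = k by lia.
(* Terms beyond [i] vanish; the range is extended by them so that it can be cut at [k.-1] whatever
   the order of [i] and [k]. *)
have E : N%:R * rate N i = \sum_(a < k.-1) wgt a * q N i a +
    \sum_(b < i.+1) wgt (k.-1 + b)%N * q N i (k.-1 + b)%N.
  transitivity (\sum_(0 <= a < (k.-1 + i.+1)%N) wgt a * q N i a).
    rewrite mulr_sumr; under eq_bigr do rewrite rate_term.
    rewrite -(big_mkord predT (fun a => wgt a * q N i a)).
    rewrite [RHS](@big_cat_nat _ _ _ i.+1)//=; last by lia.
    rewrite [X in _ = _ + X]big_nat_cond [X in _ = _ + X]big1 ?addr0// => a /andP[/andP[ia _] _].
    by rewrite q_zero ?mulr0.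
  rewrite (@big_cat_nat _ _ _ k.-1)//=; last by lia.
  rewrite big_mkord; congr (_ + _).
  rewrite -{1}[k.-1]add0n big_addn addnC addnK big_mkord.
  by apply: eq_bigr => b _; rewrite addnC.
set tail := \sum_(b < i.+1) _ in E.
have tail0 : 0 <= tail by apply: sumr_ge0 => b _; rewrite mulr_ge0.
(* With [wgt a <= (a + 1) Cb], [a + 1 <= 2^a] and [2 x <= 1/2], the tail is dominated by a geometric
   series of ratio [1/2]. *)
have taille : tail <= 8 * Cb * 2 ^+ k.-1 * x ^+ k.-1.
  apply: (@le_trans _ _ (\sum_(b < i.+1) 4 * Cb * (2 * x) ^+ k.-1 * 2^-1 ^+ b)).
    apply: ler_sum => b _; set a := (k.-1 + b)%N.
    have wle : wgt a <= a.+1%:R * Cb.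
      by rewrite /wgt mulrAC mulrC ler_wpM2l// beta_bd.
    apply: (@le_trans _ _ (a.+1%:R * Cb * (4 * x ^+ a))).
      by apply: ler_pM => //; apply: q_tail; rewrite /a; lia.
    rewrite [a.+1%:R * Cb]mulrC -mulrA mulrCA !mulrA [4 * Cb]mulrC -!mulrA ler_wpM2l// ler_pM2l//.
    apply: (@le_trans _ _ (2 ^+ a * x ^+ a)).
      rewrite ler_wpM2r ?exprn_ge0// -natrX ler_nat ltn_expl//.
    rewrite -exprMn /a exprD ler_wpM2l ?exprn_ge0 ?mulr_ge0//.
    by rewrite lerXn2r ?nnegrE ?mulr_ge0//; have := x4; lra.
  rewrite -mulr_sumr.
  have geo n : \sum_(b < n) 2^-1 ^+ b <= 2 :> R.
    have -> : \sum_(b < n) 2^-1 ^+ b = 2 - 2 * 2^-1 ^+ n :> R.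
      elim: n => [|n IH]; first by rewrite big_ord0 expr0; ring.
      by rewrite big_ord_recr /= IH exprS; field.
    by rewrite gerBl mulr_ge0// exprn_ge0.
  rewrite exprMn (_ : 8 * Cb * _ * _ = 4 * Cb * (2 ^+ k.-1 * x ^+ k.-1) * 2); last by ring.
  by rewrite ler_wpM2l// !mulr_ge0 ?exprn_ge0.
have main : \sum_(a < k.-1) wgt a * x ^+ a = \sum_(a < k.-2) x ^+ a + (1 + mu) * x ^+ k.-2.
  rewrite -kE big_ord_recr /= wgt_k; congr (_ + _).
  by apply: eq_bigr => a _; rewrite wgt_crit ?mul1r.
have geo : (\sum_(a < k.-2) x ^+ a) * (1 - x) = 1 - x ^+ k.-2.
  by rewrite mulrC -opprB mulNr -subrX1 opprB.
have close : `|\sum_(a < k.-1) wgt a * q N i a - \sum_(a < k.-1) wgt a * x ^+ a| <=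
    4 * k%:R ^+ 3 * (1 + mu + 1) / N%:R.
  rewrite -sumrB; apply: le_trans (ler_norm_sum _ _ _) _.
  apply: (@le_trans _ _ (\sum_(a < k.-1) (1 + mu + 1) * (4 * k%:R ^+ 2 / N%:R))).
    apply: ler_sum => a _; rewrite -mulrBr normrM (ger0_norm (wgt_ge0 a)).
    apply: ler_pM => //.
      have [ak|ak] := ltnP a k.-2; first by rewrite wgt_crit// lerDr.
      have -> : a = k.-2 :> nat by have := ltn_ord a; lia.
      by rewrite wgt_k lerDl.
    apply: le_trans (q_close _) _; first by have := ltn_ord a; lia.
    rewrite ler_pM2r ?invr_gt0// ler_pM2l// lerXn2r ?nnegrE// ler_nat.
    by have := ltn_ord a; lia.
  rewrite sumr_const card_ord -[leLHS]mulr_natl.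
  rewrite [leRHS](_ : _ = k%:R * ((1 + mu + 1) * (4 * k%:R ^+ 2 / N%:R))); last by ring.
  apply: ler_wpM2r; last by rewrite ler_nat leq_pred.
  by apply: mulr_ge0; [exact: addr_ge0|rewrite !mulr_ge0 ?exprn_ge0 ?invr_ge0].
set A := \sum_(a < k.-1) wgt a * q N i a in E close.
set A' := \sum_(a < k.-1) _ in main close.
have -> : N%:R * rate N i * (1 - x) - 1 - mu * x ^+ k.-2 =
   (A - A') * (1 - x) + tail * (1 - x) - (1 + mu) * x ^+ k.-1.
  have -> : x ^+ k.-1 = x * x ^+ k.-2 by rewrite -kE exprS.
  rewrite E; have -> : (A + tail) * (1 - x) = (A - A') * (1 - x) + tail * (1 - x) + A' * (1 - x) by ring.
  by rewrite main [(_ + (1 + mu) * _) * _]mulrDl geo; ring.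
have x1 : 0 <= 1 - x <= 1 by have := x4; have := x0; lra.
have /andP[x1a x1b] := x1.
have xk0 : 0 <= x ^+ k.-1 by rewrite exprn_ge0.
apply: le_trans (ler_normB _ _) _.
apply: le_trans (lerD (ler_normD _ _) (lexx _)) _.
rewrite !normrM (ger0_norm x1a) (ger0_norm tail0) (ger0_norm mu1_ge0) (ger0_norm xk0).
have h1 : `|A - A'| * (1 - x) <= 4 * k%:R ^+ 3 * (1 + mu + 1) / N%:R.
  by apply: le_trans close; rewrite ler_piMr.
have h2 : tail * (1 - x) <= 8 * Cb * 2 ^+ k.-1 * x ^+ k.-1.
  by apply: le_trans taille; rewrite ler_piMr.
apply: le_trans (lerD (lerD h1 h2) (lexx _)) _.
have Ni0 : 0 <= N%:R^-1 :> R by rewrite invr_ge0.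
rewrite /C1; set u := 4 * k%:R ^+ 3 * _; set v := 8 * _ * _.
have u0 : 0 <= u by apply: mulr_ge0; [rewrite mulr_ge0 ?exprn_ge0|exact: addr_ge0].
have v0 : 0 <= v by rewrite !mulr_ge0 ?exprn_ge0.
have := mu1_ge0.
set z := 1 + mu; set y := x ^+ k.-1 in xk0 *; set n := N%:R^-1 in Ni0 *.
move=> z0.
have := mulr_ge0 u0 xk0; have := mulr_ge0 z0 Ni0; have := mulr_ge0 v0 Ni0.
rewrite !mulrDl !mulrDr; lra.
Qed.
End bounds.

(** Telescoping: [(i+1)^(p+1) - i^(p+1)] lies between [(p+1) i^p] and [(p+1) (i+1)^p]. *)
Lemma sum_powers (p n : nat) :
  0 <= n%:R ^+ p.+1 / p.+1%:R - \sum_(i < n) (i%:R ^+ p : R) <= n%:R ^+ p.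
Proof.
have p0 : 0 < p.+1%:R :> R by rewrite ltr0n.
have step (i : nat) : p.+1%:R * i%:R ^+ p <= (i.+1%:R ^+ p.+1 - i%:R ^+ p.+1 : R) <= p.+1%:R * i.+1%:R ^+ p.
  rewrite subrXX -[X in (X - _) * _]natr1 addrAC subrr add0r mul1r.
  have sc (a : R) : p.+1%:R * a = \sum_(j < p.+1) a by rewrite sumr_const card_ord mulr_natl.
  rewrite !sc.
  apply/andP; split; apply: ler_sum => j _.
    have -> : (i%:R : R) ^+ p = i%:R ^+ (p - j) * i%:R ^+ j.
      by rewrite -exprD subnK// -ltnS.
    by rewrite ler_wpM2r ?exprn_ge0// lerXn2r ?nnegrE// ler_nat.
  have -> : (i.+1%:R : R) ^+ p = i.+1%:R ^+ (p - j) * i.+1%:R ^+ j.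
    by rewrite -exprD subnK// -ltnS.
  by rewrite ler_wpM2l ?exprn_ge0// lerXn2r ?nnegrE// ler_nat.
suff h : p.+1%:R * \sum_(i < n) (i%:R ^+ p : R) <= n%:R ^+ p.+1 <=
    p.+1%:R * (\sum_(i < n) (i%:R ^+ p : R) + n%:R ^+ p).
  move: h => /andP[h1 h2].
  by rewrite subr_ge0 ler_pdivlMr// mulrC h1 /= lerBlDl ler_pdivrMr// mulrC.
elim: n => [|n /andP[IH1 IH2]].
  by rewrite !big_ord0 mulr0 exprS mul0r lexx/= add0r mulr_ge0// exprn_ge0.
have /andP[s1 s2] := step n.
rewrite big_ord_recr/= !mulrDr; rewrite !mulrDr in IH2.
by apply/andP; split; lra.
Qed.

Let C1 : R := 4 * k%:R ^+ 3 * (1 + mu + 1) + (1 + mu) + 8 * Cb * 2 ^+ k.-1.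
Let C1_ge0 : 0 <= C1.
Proof.
rewrite /C1; apply: addr_ge0; last by rewrite !mulr_ge0 ?exprn_ge0.
by apply: addr_ge0 => //; apply: mulr_ge0; [rewrite mulr_ge0 ?exprn_ge0|exact: addr_ge0].
Qed.

(** Number of patched vertices when the next step begins; at least 1, since a new vertex is patched
    when none is waiting. *)
Definition excess (h : seq nat) : nat := (maxn (numbered h) (size h).+1 - size h)%N.

Lemma excess_cons c h : excess (c :: h) = maxn (excess h + c - 1) 1.
Proof. by rewrite /excess /=; lia. Qed.

Lemma excess_gt0 h : (0 < excess h)%N.
Proof. by rewrite /excess; lia. Qed.

Definition escapes (N : nat) (b : R) (h : seq nat) : bool :=
  ever (fun u => b < `|mart N (joinp N) u|) (size h) h.

Lemma escapes_cons N b c h : escapes N b h -> escapes N b (c :: h).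
Proof. by rewrite /escapes => /everP[j jh hj]; apply/everP; exists j.+1. Qed.

Lemma escapes_self N b h : ~~ escapes N b h -> `|mart N (joinp N) h| <= b.
Proof.
move=> nb; rewrite leNgt; apply/negP => hb; case/negP: nb.
by apply/everP; exists 0%N; rewrite ?drop0.
Qed.

Lemma escapes_tail N b c h : ~~ escapes N b (c :: h) -> ~~ escapes N b h.
Proof. by apply: contra; exact: escapes_cons. Qed.

(* [excess] is the walk reflected at its running minimum. *)
Lemma excess_le N b dmax n h : (size h <= n)%N -> 0 <= b ->
  (forall s, (size s < n)%N -> mean N (joinp N) s - 1 <= dmax) -> 0 <= dmax ->
  ~~ escapes N b h ->
  (excess h)%:R <= 1 + mart N (joinp N) h + b + (size h)%:R * dmax.
Proof.
move=> hn b0 hd dmax0; elim: h hn => [_ _|c h IH /= hn nb].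
  by rewrite -[excess [::]]/1%N /= mul0r; lra.
have {}IH := IH (ltnW hn) (escapes_tail nb).
have := escapes_self nb; rewrite /= ler_norml => /andP[hm _].
have hdh := hd _ hn.
have e0 : (1 <= (excess h)%:R :> R) by rewrite ler1n excess_gt0.
(* If the reflection acts, the value is 1 and [mart >= - b] suffices; otherwise the increment is
   [c - 1], that is, a martingale increment plus at most [dmax]. *)
rewrite excess_cons natr_max ge_max -natr1; apply/andP; split.
  rewrite natrB ?natrD; last by have := excess_gt0 h; lia.
  by move: IH; lra.
have : 0 <= (size h)%:R * dmax by rewrite mulr_ge0.
by move: hm; lra.
Qed.

Section step_mean.
Variables (N : nat) (h : seq nat).
Hypothesis iN : (4 * size h <= N)%N.
Hypothesis kN : (4 * k.+2 <= N)%N.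
Let x : R := (size h)%:R / N%:R.
Hypothesis small : `|mu| * x ^+ k.-2 + C1 * (x ^+ k.-1 + N%:R^-1) <= 4^-1.

Let N0 : 0 < N%:R :> R. Proof. by rewrite ltr0n; lia. Qed.
Let x0 : 0 <= x. Proof. by rewrite divr_ge0. Qed.
Let x4 : x <= 4^-1.
Proof. by rewrite ler_pdivrMr// ler_pdivlMl// -natrM ler_nat. Qed.

Let expansion := rate_expansion iN kN.

Lemma Nrate_le2 : N%:R * rate N (size h) <= 2.
Proof.
have := expansion; rewrite -/x -/C1 => e.
have : N%:R * rate N (size h) * (1 - x) <= 5 / 4.
  have := ler_norm (mu * x ^+ k.-2).
  rewrite normrM (ger0_norm (exprn_ge0 _ x0)).
  by move: e; rewrite ler_norml => /andP[_]; move: small; lra.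
have : 0 <= N%:R * rate N (size h) by rewrite mulr_ge0 ?rate_ge0.
have := x4; nra.
Qed.

Let rate_N : rate N (size h) <= 2 / N%:R.
Proof. by rewrite ler_pdivlMr// mulrC Nrate_le2. Qed.

(** Counting the waiting vertices as fresh only raises the mean. This one-sided bound yields,
    through [excess_le], the control of [excess] that the two-sided [mean_close] requires. *)
Lemma mean_upper : mean N (joinp N) h <= 1 + mu * x ^+ k.-2 + C1 * (x ^+ k.-1 + N%:R^-1).
Proof.
apply: (@le_trans _ _ (N%:R * rate N (size h) * (1 - x))).
  rewrite /mean (_ : N%:R * _ * (1 - x) = (N%:R - (size h)%:R) * rate N (size h)); last first.
    by rewrite /x; field; rewrite gt_eqF.
  rewrite -natrB; last by lia.
  apply: ler_pM; rewrite ?joinp_le//; first by case/andP: (joinp01 N (size h)).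
  by rewrite /fresh ler_nat; lia.
by have := expansion; rewrite -/x -/C1 ler_norml => /andP[_]; lra.
Qed.

Lemma mean_le2 : mean N (joinp N) h <= 2.
Proof.
apply: le_trans mean_upper _; have := ler_norm (mu * x ^+ k.-2).
by rewrite normrM (ger0_norm (exprn_ge0 _ x0)); move: small; lra.
Qed.

(** [10 = 2 + 8]: the [excess] vertices that cannot be joined account for [2 / N] each, and the
    second-order error between [joinp] and [rate] for [8 / N] in all, absorbed because
    [excess >= 1]. *)
Lemma mean_close : (excess h + size h <= N)%N ->
  `|mean N (joinp N) h - 1 - mu * x ^+ k.-2| <=
   C1 * (x ^+ k.-1 + N%:R^-1) + 10 * (excess h)%:R / N%:R.
Proof.
move=> eN; have up := mean_upper.
have e1 : 1 <= (excess h)%:R :> R by rewrite ler1n excess_gt0.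
have Ni0 : 0 < N%:R^-1 :> R by rewrite invr_gt0.
have e0 : 0 <= 10 * (excess h)%:R / N%:R :> R by rewrite divr_ge0.
rewrite ler_norml; apply/andP; split; last by lra.
have r0 := rate_ge0 N (size h).
have N4 : 4 <= N%:R :> R by rewrite ler_nat; apply: leq_trans kN; rewrite leq_pmulr.
have rN := rate_N.
have r2 : rate N (size h) <= 2^-1.
  by apply: le_trans rN _; rewrite ler_pdivrMr//; lra.
have pl := joinp_ge r2.
have F : (fresh N h)%:R = N%:R - (size h)%:R - (excess h)%:R :> R.
  rewrite -natrB; last by move: eN; clear; lia.
  rewrite -natrB; last by move: eN; clear; lia.
  by congr (_%:R); move: eN; rewrite /fresh /excess; clear; lia.
have F0 : 0 <= (fresh N h)%:R :> R by [].
have FN : (fresh N h)%:R <= N%:R :> R by rewrite ler_nat /fresh leq_subr.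
have m1 : (fresh N h)%:R * (rate N (size h) - 2 * rate N (size h) ^+ 2) <= mean N (joinp N) h.
  by rewrite /mean ler_wpM2l.
have m2 : (fresh N h)%:R * (2 * rate N (size h) ^+ 2) <= 8 / N%:R.
  have -> : 8 / N%:R = N%:R * (2 * (2 / N%:R) ^+ 2) :> R by field; rewrite gt_eqF.
  apply: ler_pM => //; first by rewrite mulr_ge0 ?sqr_ge0.
  by rewrite ler_pM2l// lerXn2r ?nnegrE ?divr_ge0.
have m3 : (excess h)%:R * rate N (size h) <= (excess h)%:R * (2 / N%:R) by rewrite ler_wpM2l.
have m4 : 8 / N%:R <= 8 * (excess h)%:R / N%:R :> R by rewrite ler_pM2r// ler_peMr.
have E : N%:R * rate N (size h) * (1 - x) = (N%:R - (size h)%:R) * rate N (size h).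
  by rewrite /x; field; rewrite gt_eqF.
have := expansion; rewrite -/x -/C1 E ler_norml => /andP[h1 _].
have m5 : (excess h)%:R * (2 / N%:R) + 8 * (excess h)%:R / N%:R = 10 * (excess h)%:R / N%:R :> R by ring.
move: m1; rewrite mulrBr {1}F [(_ - (excess h)%:R) * _]mulrBl.
by move: h1 m2 m3 m4 m5; lra.
Qed.

Lemma joinp_small : joinp N (size h) <= 2 / N%:R.
Proof. exact: le_trans (joinp_le _ _) rate_N. Qed.
End step_mean.

(** [tau] is the length of a step in rescaled time and [i/N = (i tau) rho]. By
    [rho^(k-2) = sqrt tau], the mean [mu x^(k-2)] of a step has order [sqrt tau] and sums to order
    [1 / sqrt tau] over [T / tau] steps, like the martingale. The last two bounds hold pathwise, on
    every history that has not escaped. *)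
Lemma critical_window (T a : R) : 0 <= T -> 0 <= a -> exists A rho0 : R,
  [/\ 0 <= A, 0 < rho0 & forall (N : nat) (tau rho : R), 0 < tau -> 0 < rho -> rho <= rho0 ->
  tau * rho * N%:R = 1 -> rho ^+ k.-2 = Num.sqrt tau ->
  forall h, (size h)%:R * tau <= T ->
  [/\ mean N (joinp N) h <= 2,
   ~~ escapes N (a / Num.sqrt tau) h ->
     `|mean N (joinp N) h * (1 - joinp N (size h)) - 1| <= A * Num.sqrt tau &
   ~~ escapes N (a / Num.sqrt tau) h ->
     `|Num.sqrt tau * drift N (joinp N) h - mu / (k%:R - 1) * ((size h)%:R * tau) ^+ k.-1| <= A * rho]].
Proof.
move=> T0 a0.
(* With [s = sqrt tau]: [Tk] bounds the powers up to [k] of rescaled time, [V * s] the mean of a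
   step of the walk, [E / s] the reflected walk and [W * (rho * s)] the error in [mean_close]. *)
pose T' := T + 1; have T1 : 1 <= T' by rewrite /T' lerDr.
pose Tk := T' ^+ k; have Tk1 : 1 <= Tk by rewrite exprn_ege1.
pose M := `|mu|; have M0 : 0 <= M by rewrite normr_ge0.
pose U := C1 * (Tk + 1); have U0 : 0 <= U by rewrite mulr_ge0// addr_ge0// (le_trans ler01).
pose V := M * Tk + U; have V0 : 0 <= V by rewrite addr_ge0// mulr_ge0// (le_trans ler01).
pose E := 1 + 2 * a + T' * V.
have E0 : 0 <= E by rewrite !addr_ge0 ?mulr_ge0// (le_trans ler01).
pose W := U + 10 * E; have W0 : 0 <= W by rewrite addr_ge0// mulr_ge0.
pose A := M * Tk + W + 4 + T' * W + M * Tk.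
have MTk0 : 0 <= M * Tk by rewrite mulr_ge0// (le_trans ler01).
have T'W0 : 0 <= T' * W by rewrite mulr_ge0// (le_trans ler01).
(* [rho <= G^-1] makes [rho] times any of [V], [T'], [k + 2] and [E] at most [1/4]: these are the
   smallness conditions of the preceding lemmas. *)
pose G := 4 * (V + 1 + T' + k.+2%:R + E).
have G0 : 0 < G by rewrite mulr_gt0// ltr_wpDr// ltr_wpDr// ltr_wpDr ?(le_trans ler01)// ltr_wpDl.
exists A, (Num.min 1 G^-1); split.
- by rewrite /A; lra.
- by rewrite lt_min ltr01 invr_gt0.
move=> N tau rho tau0 rho0 + tN rk.
rewrite le_min => /andP[rho1 rhoG].
have st0 : 0 < Num.sqrt tau by rewrite sqrtr_gt0.
set s := Num.sqrt tau in st0 rk *.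
have s2 : tau = s * s by rewrite -expr2 sqr_sqrtr// ltW.
have kE : k.-2.+1 = k.-1 by move: k_ge3; clear; lia.
have kE3 : k.-2 = (k - 3).+1 by move: k_ge3; clear; lia.
have srho : s <= rho.
  by rewrite -rk kE3 exprS ler_piMr ?(ltW rho0)// exprn_ile1// ltW.
have s1 : s <= 1 by exact: le_trans srho _.
have taus : tau <= s by rewrite s2 ler_piMl// ltW.
have tau1 : tau <= 1 by exact: le_trans taus _.
have rG : rho * G <= 1 by move: rhoG; rewrite -[G^-1]mul1r ler_pdivlMr.
have N0 : 0 < N%:R :> R.
  by rewrite -(pmulr_rgt0 _ (mulr_gt0 tau0 rho0)) tN.
have NE : N%:R^-1 = tau * rho by apply: (mulIf (lt0r_neq0 N0)); rewrite mulVf ?gt_eqF// tN.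
have NE' : N%:R = (tau * rho)^-1 by rewrite -NE invrK.
have rpos : 0 <= rho by exact: ltW.
have kN : (4 * k.+2 <= N)%N.
  rewrite -(ler_nat R) NE' -[leRHS]mul1r ler_pdivlMr ?mulr_gt0// natrM.
  apply: le_trans (_ : 4 * k.+2%:R * rho <= _).
    by rewrite ler_wpM2l// ler_piMl.
  apply: le_trans rG; rewrite mulrC ler_wpM2l// /G ler_pM2l//; lra.
have rho_part c : 0 <= c -> c <= V + 1 + T' + k.+2%:R + E -> c * rho <= 4^-1.
  move=> c0 cle; have := ler_wpM2r rpos cle; move: rG; rewrite /G.
  by set z := _ + E; lra.
have kp : 0 <= k.+2%:R :> R by [].
have T'0 : 0 <= T' by rewrite (le_trans ler01).
have main (h : seq nat) : (size h)%:R * tau <= T ->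
  let x := (size h)%:R / N%:R in
  [/\ (4 * size h <= N)%N, x ^+ k.-2 <= Tk * s, C1 * (x ^+ k.-1 + N%:R^-1) <= U * (rho * s) &
   `|mu| * x ^+ k.-2 + C1 * (x ^+ k.-1 + N%:R^-1) <= V * s].
  move=> hT x.
  have xE : x = (size h)%:R * tau * rho by rewrite /x NE mulrA.
  have it0 : 0 <= (size h)%:R * tau by rewrite mulr_ge0// ltW.
  have itT : (size h)%:R * tau <= T' by rewrite /T'; lra.
  have pw n : (n <= k)%N -> ((size h)%:R * tau) ^+ n <= Tk.
    move=> nk; apply: (@le_trans _ _ (T' ^+ n)); first by rewrite lerXn2r.
    by rewrite ler_weXn2l.
  have x2 : x ^+ k.-2 <= Tk * s.
    by rewrite xE exprMn rk ler_wpM2r ?(ltW st0)// pw//; move: k_ge3; clear; lia.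
  have x1 : x ^+ k.-1 <= Tk * (rho * s).
    rewrite xE exprMn -{2}kE [rho ^+ _]exprS rk ler_wpM2r ?mulr_ge0 ?(ltW st0)// pw//.
    by move: k_ge3; clear; lia.
  have c1 : C1 * (x ^+ k.-1 + N%:R^-1) <= U * (rho * s).
    rewrite /U -mulrA ler_wpM2l// NE mulrDl mul1r; apply: lerD => //.
    by rewrite mulrC ler_wpM2l.
  split => //.
    rewrite -(ler_nat R) natrM -ler_pdivlMl// -ler_pdivrMr// -/x xE.
    apply: le_trans (rho_part T' T'0 _); first by rewrite ler_wpM2r.
    by lra.
  rewrite /V [leRHS]mulrDl; apply: lerD; first by rewrite -mulrA ler_wpM2l.
  by apply: le_trans c1 _; rewrite ler_wpM2l// ler_piMl// ltW.
have Vs : V * s <= 4^-1.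
  apply: le_trans (rho_part V V0 _); first by rewrite ler_wpM2l.
  by lra.
have sm (h : seq nat) (hT : (size h)%:R * tau <= T) : `|mu| * ((size h)%:R / N%:R) ^+ k.-2 +
     C1 * (((size h)%:R / N%:R) ^+ k.-1 + N%:R^-1) <= 4^-1.
  by have [_ _ _ h4] := main h hT; exact: le_trans Vs.
have sub (h s' : seq nat) : (size s' <= size h)%N -> (size h)%:R * tau <= T -> (size s')%:R * tau <= T.
  by move=> sh; apply: le_trans; rewrite ler_pM2r// ler_nat.
(* The parts of [E / s]: the unit, twice the level [a / s], and the accumulated drift, at most [V s]
   over at most [T' / s^2] steps. *)
have exc h : (size h)%:R * tau <= T -> ~~ escapes N (a / s) h -> (excess h)%:R <= E / s.
  move=> hT nb; have b0 : 0 <= a / s by rewrite divr_ge0// ltW.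
  have := @excess_le N (a / s) (V * s) (size h) h (leqnn _) b0 _ _ nb.
  have md s' : (size s' < size h)%N -> mean N (joinp N) s' - 1 <= V * s.
    move=> sh; have s'T := sub _ _ (ltnW sh) hT; have [i4 _ _ h4] := main _ s'T.
    have := mean_upper i4 kN; have := ler_norm (mu * ((size s')%:R / N%:R) ^+ k.-2).
    rewrite normrM [`|_ ^+ k.-2|]ger0_norm ?exprn_ge0 ?divr_ge0//.
    by move: h4; rewrite /C1; lra.
  move=> /(_ md (mulr_ge0 V0 (ltW st0))) h1; apply: le_trans h1 _.
  have := escapes_self nb => /(le_trans (ler_norm _)) h2.
  have h3 : (size h)%:R * (V * s) <= T' * V / s.
    rewrite ler_pdivlMr// (_ : _ * s = (size h)%:R * tau * V); last by rewrite s2; ring.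
    by rewrite ler_wpM2r// /T'; lra.
  have h4 : 1 <= 1 / s by rewrite ler_pdivlMr// mul1r.
  have Es : E / s = 1 / s + a / s + a / s + T' * V / s by rewrite /E; ring.
  by rewrite Es; lra.
have excN h : (size h)%:R * tau <= T -> ~~ escapes N (a / s) h ->
    10 * (excess h)%:R / N%:R <= 10 * E * (rho * s) /\ (excess h + size h <= N)%N.
  move=> hT nb; have he := exc h hT nb.
  have heN : (excess h)%:R / N%:R <= E * (rho * s).
    rewrite NE; apply: le_trans (_ : E / s * (tau * rho) <= _).
      by rewrite ler_wpM2r// mulr_ge0// ltW.
    by rewrite le_eqVlt; apply/orP; left; apply/eqP; rewrite s2; field; rewrite gt_eqF.
  split; first by rewrite -!mulrA ler_pM2l// mulrA.
  have e4 : (4 * excess h <= N)%N.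
    rewrite -(ler_nat R) natrM -ler_pdivlMl// -ler_pdivrMr//.
    apply: le_trans heN _; apply: le_trans (rho_part E E0 _).
      by rewrite ler_wpM2l// ler_piMr.
    by lra.
  by have [i4 _ _ _] := main h hT; move: e4 i4; clear; lia.
have mc h : (size h)%:R * tau <= T -> ~~ escapes N (a / s) h ->
    `|mean N (joinp N) h - 1 - mu * ((size h)%:R / N%:R) ^+ k.-2| <= W * (rho * s).
  move=> hT nb; have [e10 eN] := excN h hT nb; have [i4 _ c1 _] := main h hT.
  apply: le_trans (mean_close i4 kN (sm h hT) eN) _.
  by rewrite /W [leRHS]mulrDl; apply: lerD.
have rs : rho * s <= s by rewrite ler_piMl// ltW.
move=> h hT; have [i4 x2 c1 _] := main h hT; split.
- exact: mean_le2 i4 kN (sm h hT).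
- move=> nb; have h1 := mc h hT nb.
  have h2 : `|mu * ((size h)%:R / N%:R) ^+ k.-2| <= M * Tk * s.
    rewrite normrM [`|_ ^+ k.-2|]ger0_norm ?exprn_ge0 ?divr_ge0//.
    by rewrite -mulrA ler_wpM2l.
  have /andP[p0 _] := joinp01 N (size h).
  have m2 := mean_le2 i4 kN (sm h hT).
  have m0 : 0 <= mean N (joinp N) h by rewrite mulr_ge0.
  have h3 : mean N (joinp N) h * joinp N (size h) <= 4 * s.
    have := joinp_small i4 kN (sm h hT); rewrite NE => jp.
    apply: le_trans (_ : 2 * (2 * (tau * rho)) <= _); first exact: ler_pM.
    rewrite mulrA -natrM ler_pM2l//; apply: le_trans taus; rewrite ler_piMr// ltW//.
  have h30 : 0 <= mean N (joinp N) h * joinp N (size h) by rewrite mulr_ge0.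
  set m := mean N (joinp N) h in h1 h3 h30 m0 *; set y := mu * _ in h1 h2.
  have -> : m * (1 - joinp N (size h)) - 1 = (m - 1 - y) + y - m * joinp N (size h) by ring.
  apply: le_trans (ler_normB _ _) _; rewrite (ger0_norm h30).
  apply: le_trans (lerD (ler_normD _ _) (lexx _)) _.
  have h4 : W * (rho * s) <= W * s by rewrite ler_wpM2l.
  have h5 : 0 <= T' * W * s by rewrite mulr_ge0// ltW.
  have h6 : 0 <= M * Tk * s by rewrite mulr_ge0// ltW.
  have As : A * s = M * Tk * s + W * s + 4 * s + T' * W * s + M * Tk * s by rewrite /A; ring.
  by rewrite As; lra.
move=> nb.
have dr : `|drift N (joinp N) h - mu * \sum_(i < size h) (i%:R / N%:R) ^+ k.-2| <=
    (size h)%:R * (W * (rho * s)).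
  elim: h hT nb {i4 x2 c1} => [|c h IH] hT nb.
    by rewrite /= big_ord0 mulr0 subrr normr0 mul0r.
  have hT' := sub (c :: h) h (leqnSn _) hT; have nb' := escapes_tail nb.
  have {}IH := IH hT' nb'.
  rewrite /= big_ord_recr/= mulrDr -[(size h).+1%:R]natr1 [leRHS]mulrDl mul1r.
  set D := drift _ _ _ in IH *; set S := mu * \sum_(i < _) _ in IH *.
  rewrite (_ : _ - _ = (D - S) + (mean N (joinp N) h - 1 - mu * ((size h)%:R / N%:R) ^+ k.-2)); last by ring.
  by apply: le_trans (ler_normD _ _) _; apply: lerD => //; exact: mc.
(* Since [s (tau rho)^(k-2) = s tau^(k-2) s = tau^(k-1)], the rescaled drift is a Riemann sum for
   the integral of [t^(k-2)]. *)
have st : s * \sum_(i < size h) (i%:R / N%:R) ^+ k.-2 = tau ^+ k.-1 * \sum_(i < size h) (i%:R : R) ^+ k.-2.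
  rewrite !mulr_sumr; apply: eq_bigr => i _.
  by rewrite NE exprMn exprMn rk -kE exprS {2}s2; ring.
have it0 : 0 <= (size h)%:R * tau by rewrite mulr_ge0// ltW.
have k1 : k%:R - 1 = k.-1%:R :> R.
  by rewrite -subn1 natrB//; move: k_ge3; clear; lia.
have riem : `|tau ^+ k.-1 * \sum_(i < size h) (i%:R : R) ^+ k.-2 - ((size h)%:R * tau) ^+ k.-1 / (k%:R - 1)| <= Tk * rho.
  have := sum_powers k.-2 (size h); rewrite kE k1.
  set S := \sum_(i < _) _; set P := _ / _ => /andP[p1 p2].
  have -> : ((size h)%:R * tau) ^+ k.-1 / k.-1%:R = tau ^+ k.-1 * P by rewrite /P exprMn; ring.
  rewrite -mulrBr normrM distrC (ger0_norm p1) ger0_norm ?exprn_ge0 ?(ltW tau0)//.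
  apply: le_trans (ler_wpM2l (exprn_ge0 _ (ltW tau0)) p2) _.
  rewrite -kE exprS -mulrA -exprMn mulrC [tau * _]mulrC.
  apply: ler_pM; rewrite ?(ltW tau0) ?exprn_ge0 ?mulr_ge0 ?(ltW tau0)//; last exact: le_trans taus _.
  apply: (@le_trans _ _ (T' ^+ k.-2)).
    by rewrite lerXn2r ?nnegrE ?mulr_ge0 ?(ltW tau0)// mulrC /T'; lra.
  by rewrite ler_weXn2l//; move: k_ge3; clear; lia.
set D := drift _ _ _ in dr *; set S := \sum_(i < _) _ in dr st.
rewrite (_ : s * D - _ = s * (D - mu * S) + mu * (s * S - ((size h)%:R * tau) ^+ k.-1 / (k%:R - 1))); last by ring.
apply: le_trans (ler_normD _ _) _.
rewrite normrM (gtr0_norm st0) [`|mu * _|]normrM st.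
have h1 : s * `|D - mu * S| <= T' * W * rho.
  apply: le_trans (ler_wpM2l (ltW st0) dr) _.
  rewrite (_ : s * _ = (size h)%:R * tau * (W * rho)); last by rewrite s2; ring.
  by rewrite -[leRHS]mulrA ler_wpM2r ?mulr_ge0 ?(ltW r0)// /T'; lra.
have h2 := ler_wpM2l M0 riem.
have h3 : 0 <= (M * Tk + W + 4) * rho by rewrite mulr_ge0//; lra.
have Ar : A * rho = (M * Tk + W + 4) * rho + T' * W * rho + M * (Tk * rho) by rewrite /A; ring.
by apply: le_trans (lerD h1 h2) _; rewrite Ar; lra.
Qed.
End Asymptotics.

(** * Law of the exploration *)

Section ProductExpectation.
Context {R : realType} (I : finType) (w : I -> R).
Implicit Types (b : {ffun I -> bool}) (f g : {ffun I -> bool} -> R).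

Definition bern (i : I) (x : bool) : R := if x then w i else 1 - w i.
Definition prodE f : R := \sum_(b : {ffun I -> bool}) (\prod_i bern i (b i)) * f b.

Lemma prodE_prod (F : I -> bool -> R) :
  prodE (fun b => \prod_i F i (b i)) = \prod_i (w i * F i true + (1 - w i) * F i false).
Proof.
under [RHS]eq_bigr => i _.
  rewrite (_ : _ + _ = \sum_(x : bool) bern i x * F i x); last first.
    by rewrite (bigD1 true)//= (bigD1 false)//= big1 ?addr0//; case.
  over.
rewrite bigA_distr_bigA /prodE; apply: eq_bigr => b _.
by rewrite -big_split.
Qed.

Lemma prodE_cst a : prodE (fun=> a) = a.
Proof.
rewrite /prodE -mulr_suml.
have := prodE_prod (fun _ _ => 1); rewrite [X in _ = X]big1 => [H|i _]; last by ring.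
suff -> : \sum_(b : {ffun I -> bool}) \prod_i bern i (b i) = 1 by rewrite mul1r.
by rewrite -[RHS]H /prodE; apply: eq_bigr => b _; rewrite big1_eq mulr1.
Qed.

Lemma prodED f g : prodE (fun b => f b + g b) = prodE f + prodE g.
Proof. by rewrite /prodE -big_split; apply: eq_bigr => b _; rewrite mulrDr. Qed.

Lemma prodEZ a f : prodE (fun b => a * f b) = a * prodE f.
Proof. by rewrite /prodE mulr_sumr; apply: eq_bigr => b _; rewrite mulrCA. Qed.

Lemma prodE_sum (J : finType) (F : J -> {ffun I -> bool} -> R) :
  prodE (fun b => \sum_j F j b) = \sum_j prodE (F j).
Proof. by rewrite /prodE exchange_big; apply: eq_bigr => b _; rewrite mulr_sumr. Qed.

Lemma eq_prodE f g : f =1 g -> prodE f = prodE g.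
Proof. by move=> /funext ->. Qed.

Definition depends (J : pred I) (T : Type) (f : {ffun I -> bool} -> T) :=
  forall b b', (forall i, J i -> b i = b' i) -> f b = f b'.

(* Exchange the coordinates outside [J] of two independent copies. *)
Lemma prodE_indep (J : pred I) f g : depends J f -> depends (predC J) g ->
  prodE (fun b => f b * g b) = prodE f * prodE g.
Proof.
move=> fJ gJ.
pose wt b := \prod_i bern i (b i).
pose mix b b' : {ffun I -> bool} := [ffun i => if J i then b i else b' i].
have wtm b b' : wt (mix b b') * wt (mix b' b) = wt b * wt b'.
  rewrite /wt -!big_split; apply: eq_bigr => i _ /=.
  by rewrite !ffunE; case: (J i) => //; rewrite mulrC.
have mixK : involutive (fun p : {ffun I -> bool} * {ffun I -> bool} => (mix p.1 p.2, mix p.2 p.1)).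
  by move=> [b b'] /=; congr (_, _); apply/ffunP => i; rewrite !ffunE; case: (J i).
rewrite /prodE mulr_suml.
under [RHS]eq_bigr do rewrite mulr_sumr.
rewrite pair_big /= (reindex_inj (inv_inj mixK)) /=.
transitivity (\sum_(p : {ffun I -> bool} * {ffun I -> bool}) wt p.1 * (f p.1 * g p.1) * wt p.2).
  rewrite -(pair_big predT predT (fun b b' => wt b * (f b * g b) * wt b')) /=.
  apply: eq_bigr => b _; rewrite -mulr_sumr.
  have -> : \sum_i wt i = 1.
    rewrite -[RHS](prodE_cst 1) /prodE.
    by apply: eq_bigr => b' _; rewrite mulr1.
  by rewrite mulr1.
apply: eq_bigr => -[b b'] _ /=.
have -> : f (mix b b') = f b by apply: fJ => i Ji; rewrite ffunE Ji.
have -> : g (mix b' b) = g b by apply: gJ => i /negbTE Ji; rewrite ffunE Ji.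
by rewrite -/(wt _) -/(wt _) mulrACA wtm; ring.
Qed.
End ProductExpectation.

(** * Combinatorics of the breadth-first search *)

Section Exploration.
Context {R : realType} (N : nat).
Local Notation bits := {ffun {set 'I_N} -> bool}.
Implicit Types (E : {set 'I_N} -> nat) (ord : seq 'I_N).

Definition fill ord (i : nat) : seq 'I_N :=
  if (size ord <= i)%N then
    match ohead [seq w <- enum 'I_N | w \notin ord] with
    | Some w => rcons ord w | None => ord end
  else ord.

Definition kids E ord1 (i : nat) (v : 'I_N) : seq 'I_N :=
  [seq w <- enum 'I_N | (w \notin ord1) && bfs_joined E (take i ord1) v w].

Lemma bfs_stepE E ord i v : onth (fill ord i) i = Some v ->
  bfs_step E ord i = (fill ord i ++ kids E (fill ord i) i v, size (kids E (fill ord i) i v)).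
Proof. by rewrite /bfs_step -/(fill ord i) => ->. Qed.

Lemma fillP ord i : uniq ord -> (i <= size ord)%N -> (i < N)%N ->
  [/\ uniq (fill ord i), size (fill ord i) = maxn (size ord) i.+1,
      exists s, fill ord i = ord ++ s & exists v, onth (fill ord i) i = Some v].
Proof.
move=> u io iN.
have [h1 h2 h3] : [/\ uniq (fill ord i), size (fill ord i) = maxn (size ord) i.+1 &
      exists s, fill ord i = ord ++ s].
  rewrite /fill; case: leqP => [oi|oi]; last by split => //; [lia|exists [::]; rewrite cats0].
  have so : size ord = i by apply/eqP; rewrite eqn_leq oi io.
  case E : [seq w <- enum 'I_N | w \notin ord] => [|x s] /=.
    have : (N <= size ord)%N.
      rewrite -{1}[N]size_enum_ord; apply: uniq_leq_size; first exact: enum_uniq.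
      move=> x xin; apply/negPn/negP => xo.
      suff : x \in [seq w <- enum 'I_N | w \notin ord] by rewrite E.
      by rewrite mem_filter xo.
    by lia.
  split; last by exists [:: x]; rewrite cats1.
    rewrite rcons_uniq u andbT.
    have : x \in [seq w <- enum 'I_N | w \notin ord] by rewrite E inE eqxx.
    by rewrite mem_filter => /andP[].
  by rewrite size_rcons so; lia.
split => //.
have : (i < size (fill ord i))%N by rewrite h2; lia.
by move=> lt; case: (fill ord i) lt => // x s lt; exists (nth x (x :: s) i); rewrite onthE (nth_map x).
Qed.

Lemma bfs_runS E n : bfs_run E n.+1 =
  ((bfs_step E (bfs_run E n).1 n).1, rcons (bfs_run E n).2 (bfs_step E (bfs_run E n).1 n).2).
Proof. by rewrite /=; case: bfs_run => o cs /=; case: bfs_step. Qed.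

Lemma bfs_run_inv E n : (n <= N)%N ->
  [/\ uniq (bfs_run E n).1, (n <= size (bfs_run E n).1)%N, size (bfs_run E n).2 = n &
      size (bfs_run E n).1 = numbered (rev (bfs_run E n).2)].
Proof.
elim: n => [|n IH] nN; first by split.
have [u nle sz num] := IH (ltnW nN).
rewrite bfs_runS; set ord := (bfs_run E n).1 in u nle num *; set cs := (bfs_run E n).2 in sz num *.
have [fu fs [s fE] [v fv]] := fillP u nle nN.
rewrite (bfs_stepE _ fv) /=; split.
- rewrite cat_uniq fu filter_uniq ?enum_uniq// andbT /=.
  by apply/hasPn => x; rewrite mem_filter => /andP[/andP[]].
- by rewrite size_cat fs; lia.
- by rewrite size_rcons sz.
- by rewrite size_cat fs rev_rcons /= size_rev sz -num.
Qed.

Lemma onth_mem (T : eqType) (s : seq T) i x : onth s i = Some x -> x \in take i.+1 s /\ x \in drop i s.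
Proof.
elim: s i => [|y s IH] [|i] //=; first by move=> [->]; rewrite take0 !inE eqxx.
by move=> /IH[h1 h2]; rewrite inE h1 orbT.
Qed.

Lemma onth_notin (s : seq 'I_N) i x : uniq s -> onth s i = Some x -> x \notin take i s.
Proof.
move=> u /onth_mem[_ xd]; apply/negP => xt.
by move: u; rewrite -{1}(cat_take_drop i s) cat_uniq => /and3P[_ /hasPn/(_ _ xd)]; rewrite /= xt.
Qed.

Definition doneset ord n : {set 'I_N} := [set x in take n ord].

(* The hyperedges whose presence has been examined after [n] steps: at most one vertex unprocessed. *)
Definition explored ord n : pred {set 'I_N} := fun A => (#|A :\: doneset ord n| <= 1)%N.

(** For distinct [v] and [w] outside [D], such a hyperedge meets the complement of [D] in exactly
    these two vertices: the families of different [w] are disjoint. *)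
Definition arms (D : {set 'I_N}) (v w : 'I_N) : pred {set 'I_N} :=
  fun A => [&& v \in A, w \in A & A \subset v |: (w |: D)].

Lemma bfs_joined_eq E E' ord v w n :
  (forall A, arms (doneset ord n) v w A -> (0 < E A)%N = (0 < E' A)%N) ->
  bfs_joined E (take n ord) v w = bfs_joined E' (take n ord) v w.
Proof.
move=> EE; apply: eq_existsb => A.
case: (boolP (arms (doneset ord n) v w A)) => [aA|].
  by rewrite EE.
by rewrite /arms /doneset => /negbTE ->; rewrite !andbF.
Qed.

Lemma doneset_sub ord s n : (n <= size ord)%N -> doneset ord n \subset doneset (ord ++ s) n.+1.
Proof.
move=> nle; apply/fintype.subsetP => x; rewrite !inE.
rewrite (_ : take n ord = take n (take n.+1 (ord ++ s))); first exact: mem_take.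
by rewrite take_takel// takel_cat.
Qed.

Lemma doneset_mem ord n v s : onth ord n = Some v -> v \in doneset (ord ++ s) n.+1.
Proof.
move=> ov; have /onth_mem[h _] := ov; rewrite inE.
have nlt : (n < size ord)%N by rewrite ltnNge; apply/negP => ns; move: ov; rewrite onth_default.
by rewrite takel_cat.
Qed.

Lemma card_doneset ord n : uniq ord -> (n <= size ord)%N -> #|doneset ord n| = n.
Proof.
move=> u nle; rewrite /doneset cardsE; have /card_uniqP -> := take_uniq n u.
by rewrite size_takel.
Qed.

Lemma explored_sub (ord s : seq 'I_N) n A : (n <= size ord)%N -> explored ord n A -> explored (ord ++ s) n.+1 A.
Proof.
move=> nle; apply: leq_trans; apply: subset_leq_card; apply: finset.setDS.
exact: doneset_sub.
Qed.

Lemma arms_explored ord n v w A s : (n <= size ord)%N -> onth ord n = Some v ->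
  arms (doneset ord n) v w A -> explored (ord ++ s) n.+1 A.
Proof.
move=> nle ov /and3P[_ _ AS].
apply: (@leq_trans #|[set w]%SET|); last by rewrite cards1.
apply: subset_leq_card; apply/fintype.subsetP => x; rewrite !inE => /andP[xn xA].
have := fintype.subsetP AS x xA; rewrite !inE => /or3P[/eqP xv|//|xd].
  by have := doneset_mem s ov; rewrite inE -xv (negbTE xn).
by have /fintype.subsetP/(_ x) := doneset_sub s nle; rewrite !inE xd (negbTE xn) => /(_ isT).
Qed.

Lemma kids_eq E E' ord1 n v : (forall w A, w \notin ord1 -> arms (doneset ord1 n) v w A -> (0 < E A)%N = (0 < E' A)%N) ->
  kids E ord1 n v = kids E' ord1 n v.
Proof.
move=> EE; apply: eq_filter => w; case: (boolP (w \notin ord1)) => //= wn.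
by apply: bfs_joined_eq => A; exact: EE.
Qed.

(** The explored hyperedges depend on the run itself, as with a stopping time: agreement on those
    explored by the run of [E] forces [E'] to have the same run. *)
Lemma bfs_run_local E E' n : (n <= N)%N ->
  (forall A, explored (bfs_run E n).1 n A -> (0 < E A)%N = (0 < E' A)%N) ->
  bfs_run E n = bfs_run E' n.
Proof.
elim: n => [//|n IH] nN; rewrite !bfs_runS => EE.
have [u nle sz num] := bfs_run_inv E (ltnW nN).
have [fu fs [s fE] [v fv]] := fillP u nle nN.
rewrite (bfs_stepE _ fv) /= in EE *.
have nf : (n <= size (fill (bfs_run E n).1 n))%N by rewrite fs; lia.
have <- : bfs_run E n = bfs_run E' n.
  apply: IH (ltnW nN) _ => A eA; apply: EE; apply: explored_sub => //.
  rewrite /explored fE; move: eA; apply: leq_trans; apply: subset_leq_card; apply: finset.setDS.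
  by apply/fintype.subsetP => x; rewrite !inE takel_cat.
rewrite (bfs_stepE _ fv) /=.
have -> // : kids E (fill (bfs_run E n).1 n) n v = kids E' (fill (bfs_run E n).1 n) n v.
apply: kids_eq => w A wn aA; apply: EE.
exact: arms_explored aA.
Qed.
End Exploration.

(** * The numbers of children as a binomial chain *)

Section ChainLaw.
Context {R : realType} (N : nat) (m : nat -> R).
Local Notation bits := {ffun {set 'I_N} -> bool}.
Implicit Types (ord : seq 'I_N) (b : bits).

Definition edge_prob (A : {set 'I_N}) : R := 1 - expR (- m #|A|).
Local Notation EB := (prodE edge_prob).
Definition edges b : {set 'I_N} -> nat := fun A => nat_of_bool (b A).

Definition join_rate (n : nat) : R := \sum_(a < n.+1) 'C(n, a)%:R * m a.+2.
Definition join_prob n : R := 1 - expR (- join_rate n).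

Lemma sum_arms (D : {set 'I_N}) v w : v \notin D -> w \notin D -> v != w ->
  \sum_(A | arms D v w A) m #|A| = join_rate #|D|.
Proof.
move=> vD wD vw.
transitivity (\sum_(S in powerset D) m (#|S|.+2)).
  rewrite (reindex_onto (fun S => v |: (w |: S)) (fun A => A :\ v :\ w)) /=; last first.
    move=> A /and3P[vA wA _]; apply/setP => x; rewrite !inE.
    by case: (x =P v) => [->|_] //=; case: (x =P w) => [->|].
  apply: eq_big => [S|S].
    rewrite powersetE; apply/idP/idP => [/andP[/and3P[_ _ h1] /eqP h2]|SD].
      apply/fintype.subsetP => x xS; have := fintype.subsetP h1 x; rewrite !inE xS !orbT => /(_ isT).
      by move: xS; rewrite -h2 !inE => /andP[/negbTE-> /andP[/negbTE-> _]].
    have vS : v \notin S by apply: contra vD; exact: fintype.subsetP SD v.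
    have wS : w \notin S by apply: contra wD; exact: fintype.subsetP SD w.
    apply/andP; split.
      apply/and3P; split; [by rewrite !inE eqxx|by rewrite !inE eqxx orbT|].
      by apply: finset.setUS; exact: finset.setUS.
    apply/eqP/setP => x; rewrite !inE.
    by case: (x =P v) => [->|_] /=; [rewrite (negbTE vS) andbF|case: (x =P w) => [->|_]//=; rewrite (negbTE wS)].
  move=> /andP[_ /eqP h2]; congr m.
  have vS : v \notin S by rewrite -h2 !inE eqxx andbF.
  have wS : w \notin S by rewrite -h2 !inE eqxx.
  by rewrite !cardsU1 !inE negb_or vw vS wS.
rewrite (partition_big (fun S : {set 'I_N} => inord #|S| : 'I_#|D|.+1) predT)//=.
apply: eq_bigr => a _.
rewrite (eq_bigl [in [set S : {set 'I_N} | S \subset D & #|S| == a]]); last first.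
  move=> S; rewrite !inE; case: (boolP (S \subset D)) => //= SD.
  by rewrite -val_eqE /= inordK// ltnS subset_leq_card.
rewrite (eq_bigr (fun=> m a.+2)); last by move=> S; rewrite inE => /andP[_ /eqP->].
by rewrite sumr_const cards_draws mulr_natl.
Qed.

Lemma depends_joined D v w : depends (arms D v w) (fun b => bfs_joined (edges b) (enum D) v w).
Proof.
move=> b b' bb; apply: eq_existsb => A.
rewrite set_enum; case: (boolP (arms D v w A)) => [/bb aA|].
  by rewrite /edges aA.
by rewrite /arms => /negbTE h; rewrite !h !andbF.
Qed.

Lemma prob_joined (D : {set 'I_N}) v w : v \notin D -> w \notin D -> v != w ->
  EB (fun b => (bfs_joined (edges b) (enum D) v w)%:R) = join_prob #|D|.
Proof.
move=> vD wD vw.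
have E b : (bfs_joined (edges b) (enum D) v w)%:R =
   1 + (-1) * \prod_A (if arms D v w A then (~~ b A)%:R else 1) :> R.
  case: (boolP (bfs_joined _ _ _ _)) => [/existsP[A /and4P[bA vA wA AS]]|/existsPn h].
    rewrite (bigD1 A)//= /arms vA wA; move: AS; rewrite set_enum => -> /=.
    by move: bA; rewrite /edges lt0b => ->; rewrite mul0r mulr0 addr0.
  rewrite big1 ?mulr1 ?subrr// => A _; case: (boolP (arms D v w A)) => // aA.
  have := h A; rewrite set_enum; move: aA; rewrite /arms => /andP[-> ->]; rewrite !andbT lt0b.
  by move=> ->.
rewrite (eq_prodE _ E) prodED prodEZ prodE_cst mulN1r /join_prob; congr (1 - _).
rewrite -(sum_arms vD wD vw) (prodE_prod _ (fun A x => if arms D v w A then (~~ x)%:R else 1)).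
rewrite -sumrN expR_sum [RHS]big_mkcond /=; apply: eq_bigr => A _.
by case: ifP => _; rewrite /edge_prob /=; ring.
Qed.

(** Induction on the candidates: hyperedges that can join [w] cannot join another candidate, so its
    indicator is independent of the count over the others. *)
Lemma count_law (D : {set 'I_N}) v (U : seq 'I_N) (phi : nat -> R) : v \notin D ->
  uniq U -> (forall w, w \in U -> (w \notin D) && (v != w)) ->
  EB (fun b => phi (count (fun w => bfs_joined (edges b) (enum D) v w) U)) =
  binE (join_prob #|D|) (size U) phi.
Proof.
move=> vD; elim: U phi => [|w U IH] phi; first by rewrite /= prodE_cst.
rewrite /= => /andP[wU uU] hU.
have /andP[wD vw] := hU w (mem_head _ _).
have {}hU w' : w' \in U -> (w' \notin D) && (v != w') by move=> h; apply: hU; rewrite inE h orbT.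
pose J b := bfs_joined (edges b) (enum D) v w.
pose c b := count (fun w => bfs_joined (edges b) (enum D) v w) U.
have E b : phi (J b + c b)%N = (J b)%:R * phi (c b).+1 + (1 + (-1) * (J b)%:R) * phi (c b).
  by case: (J b) => /=; rewrite ?add1n ?add0n; ring.
rewrite (eq_prodE _ E) prodED.
have dJ (T : Type) (F : bool -> T) : depends (arms D v w) (fun b => F (J b)).
  by move=> b b' bb; congr F; exact: depends_joined bb.
have dc (T : Type) (F : nat -> T) : depends (predC (arms D v w)) (fun b => F (c b)).
  move=> b b' bb; congr F; apply: eq_in_count => w' w'U.
  apply: depends_joined => A aA; apply: bb => /=.
  have /andP[w'D vw'] := hU w' w'U.
  apply/negP => /and3P[_ wA _]; move: aA => /and3P[_ _ /fintype.subsetP/(_ w wA)].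
  rewrite !inE eq_sym (negbTE vw) (negbTE wD) orbF /= => /eqP ww'.
  by move: wU; rewrite ww' w'U.
rewrite (prodE_indep _ (dJ R (fun x => x%:R)) (dc R (fun n => phi n.+1))).
rewrite (prodE_indep _ (dJ R (fun x => 1 + (-1) * x%:R)) (dc R phi)).
rewrite prodED prodE_cst prodEZ (prob_joined vD wD vw) mulN1r.
by rewrite (IH phi uU hU) (IH (fun n => phi n.+1) uU hU).
Qed.

Lemma joined_doneset E ord n v w :
  bfs_joined E (take n ord) v w = bfs_joined E (enum (doneset ord n)) v w.
Proof. by apply: eq_existsb => A; rewrite set_enum. Qed.

Lemma size_notin (s : seq 'I_N) : uniq s -> size [seq w <- enum 'I_N | w \notin s] = (N - size s)%N.
Proof.
move=> u; rewrite size_filter.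
have cs : count (mem s) (enum 'I_N) = size s.
  rewrite -size_filter; apply: perm_size; apply: uniq_perm => //.
    by rewrite filter_uniq ?enum_uniq.
  by move=> x; rewrite mem_filter mem_enum andbT.
have := count_predC (mem s) (enum 'I_N); rewrite cs size_enum_ord => h.
by rewrite -[LHS](addKn (size s)) h.
Qed.

(* The counts of step [n] depend on hyperedges with two unprocessed vertices, none of which belongs to
   [explored r.1 n]: they are independent of the event [bfs_run (edges b) n == r]. *)
Lemma exploration_chain (f : seq nat -> R) k n r (H : bits -> R) : (n + k = N)%N ->
  depends (explored r.1 n) H ->
  EB (fun b => H b * (bfs_run (edges b) n == r)%:R * f (rev (bfs_run (edges b) N).2)) =
  EB (fun b => H b * (bfs_run (edges b) n == r)%:R) * chE N join_prob k (rev r.2) f.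
Proof.
elim: k n r H => [|k IH] n r H nk dH.
  rewrite mulrC -prodEZ; apply: eq_prodE => b; rewrite addn0 in nk; rewrite nk.
  by case: eqP => [->|_]; rewrite ?mulr1 ?mulr0 ?mul0r//= mulrC.
have nN : (n < N)%N by lia.
(* If no configuration leads to [r], both sides vanish; otherwise [b0] supplies the invariants of
   [r]. *)
case: (pickP (fun b => bfs_run (edges b) n == r)) => [b0 /eqP rb0|nr]; last first.
  rewrite (eq_prodE _ (g := fun=> 0)); last by move=> b; rewrite nr mulr0 mul0r.
  by rewrite [X in _ = X * _](eq_prodE _ (g := fun=> 0)) ?prodE_cst ?mul0r// => b; rewrite nr mulr0.
have [u nle sz num] := bfs_run_inv (edges b0) (ltnW nN); rewrite rb0 in u nle sz num.
have [fu fs [s fE] [v fv]] := fillP u nle nN.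
set ord1 := fill r.1 n in fu fs fE fv.
pose D := doneset ord1 n.
have nf : (n <= size ord1)%N by rewrite fs; lia.
have DE : D = doneset r.1 n by apply/setP => x; rewrite !inE fE takel_cat.
have vD : v \notin D by rewrite inE; exact: onth_notin fv.
pose U := [seq w <- enum 'I_N | w \notin ord1].
have kE b : kids (edges b) ord1 n v = [seq w <- U | bfs_joined (edges b) (enum D) v w].
  rewrite /kids /U -[RHS]filter_predI; apply: eq_filter => w /=.
  by rewrite andbC joined_doneset.
(* The children are recorded as a set, their order being restored by [klist]: the outcomes of a step
   then range over a finite type. *)
pose K b : {set 'I_N} := [set w in kids (edges b) ord1 n v].
pose klist (S : {set 'I_N}) := [seq w <- U | w \in S].
have kK b : kids (edges b) ord1 n v = klist (K b).
  rewrite kE /klist; apply: eq_in_filter => w wU.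
  by rewrite inE kE mem_filter wU andbT.
pose r' S := (ord1 ++ klist S, rcons r.2 (size (klist S))).
have runS b : bfs_run (edges b) n = r -> bfs_run (edges b) n.+1 = r' (K b).
  by move=> rb; rewrite bfs_runS rb (bfs_stepE _ fv) /r' -kK.
(* This is what the weight [H] is for: it absorbs the event that the children form [S] and still
   depends only on what is explored one step later. *)
pose H' S b := H b * (bfs_run (edges b) n == r)%:R * (K b == S)%:R.
have H'E S b : H' S b * (bfs_run (edges b) n.+1 == r' S)%:R = H' S b.
  rewrite /H'; case: eqP => [rb|_]; last by rewrite mulr0 !mul0r.
  case: eqP => [<-|_]; last by rewrite mulr0 mul0r.
  by rewrite runS// eqxx !mulr1.
have exS S A : explored r.1 n A -> explored (r' S).1 n.+1 A.
  move=> eA; apply: explored_sub => //; rewrite /explored fE; move: eA; apply: leq_trans.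
  apply: subset_leq_card; apply: finset.setDS.
  by apply/fintype.subsetP => x; rewrite !inE takel_cat.
have runD b b' : (forall A, explored r.1 n A -> b A = b' A) ->
    (bfs_run (edges b) n == r) = (bfs_run (edges b') n == r).
  move=> bb; apply/eqP/eqP => rb; rewrite -rb; apply/esym;
    by apply: bfs_run_local (ltnW nN) _ => A; rewrite rb => eA; rewrite /edges bb.
have dH' S : depends (explored (r' S).1 n.+1) (H' S).
  move=> b b' bb; rewrite /H'.
  have bb1 A : explored r.1 n A -> b A = b' A by move=> /(exS S); exact: bb.
  rewrite (dH _ _ bb1) (runD _ _ bb1); congr (_ * (_ == _)%:R).
  rewrite /K; have -> // : kids (edges b) ord1 n v = kids (edges b') ord1 n v.
  apply: kids_eq => w A _ aA; rewrite /edges bb//.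
  exact: arms_explored aA.
pose phi c := chE N join_prob k (c :: rev r.2) f.
transitivity (EB (fun b => \sum_S H' S b * (bfs_run (edges b) n.+1 == r' S)%:R *
    f (rev (bfs_run (edges b) N).2))).
  apply: eq_prodE => b; rewrite -mulr_suml; congr (_ * _).
  under eq_bigr do rewrite H'E.
  rewrite -mulr_sumr (bigD1 (K b))//= eqxx big1 ?addr0 ?mulr1// => S.
  by rewrite eq_sym => /negbTE->.
rewrite prodE_sum.
transitivity (\sum_S EB (fun b => phi (size (klist S)) * H' S b)).
  apply: eq_bigr => S _; rewrite IH//; last by lia.
  rewrite (eq_prodE _ (H'E S)) prodEZ mulrC /phi; congr (_ * _).
  by rewrite /r' /= rev_rcons.
rewrite -prodE_sum.
transitivity (EB (fun b => (H b * (bfs_run (edges b) n == r)%:R) *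
    phi (count (fun w => bfs_joined (edges b) (enum D) v w) U))).
  apply: eq_prodE => b; rewrite (bigD1 (K b))//= big1 ?addr0 => [|S].
    by rewrite /H' eqxx mulr1 mulrC -kK kE size_filter.
  by rewrite eq_sym /H' => /negbTE->; rewrite !mulr0.
have szU : size U = fresh N (rev r.2).
  by rewrite size_notin// fs /fresh size_rev sz num.
rewrite (@prodE_indep _ _ _ (explored r.1 n)).
- rewrite count_law//.
  + by rewrite /D card_doneset// szU /= size_rev sz.
  + by rewrite filter_uniq ?enum_uniq.
  + move=> w; rewrite mem_filter => /andP[wo _]; apply/andP; split.
      by rewrite inE; apply: contra wo => /mem_take.
    apply: contraNneq wo => <-; have /onth_mem[h _] := fv; exact: mem_take h.
- by move=> b b' bb; rewrite (dH _ _ bb) (runD _ _ bb).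
- move=> b b' bb; congr phi; apply: eq_in_count => w; rewrite mem_filter => /andP[wo _].
  apply: depends_joined => A /and3P[vA wA _]; apply: bb => /=.
  rewrite /explored -ltnNge -DE.
  have wD : w \notin D by rewrite inE; apply: contra wo => /mem_take.
  have vw : v != w.
    by apply: contraNneq wo => <-; have /onth_mem[h _] := fv; exact: mem_take h.
  apply: (@leq_trans #|[set v; w]%SET|); first by rewrite cards2 vw.
  apply: subset_leq_card; apply/fintype.subsetP => x; rewrite !inE => /orP[] /eqP->.
    by rewrite vA andbT; move: vD; rewrite inE.
  by rewrite wA andbT; move: wD; rewrite inE.
Qed.

Lemma exploration_law (f : seq nat -> R) :
  EB (fun b => f (rev (bfs_run (edges b) N).2)) = chE N join_prob N [::] f.
Proof.
have := @exploration_chain f N 0 ([::], [::]) (fun=> 1) erefl.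
rewrite (eq_prodE _ (g := fun b => f (rev (bfs_run (edges b) N).2))); last first.
  by move=> b; rewrite eqxx !mul1r.
rewrite [X in _ = X * _](eq_prodE _ (g := fun=> 1)); last by move=> b; rewrite eqxx mulr1.
by rewrite prodE_cst mul1r; apply.
Qed.
End ChainLaw.

(** * From Poisson hyperedges to independent bits *)

Section HypergraphLaw.
Context {R : realType} (beta : nat -> R) (N : nat).
Context d (Om : measurableType d) (P : probability Om R) (X : {set 'I_N} -> Om -> nat).
Hypothesis hX : poisson_hypergraph beta P X.

Definition edge_mean (j : nat) : R := if (2 <= j)%N then N%:R * beta j / 'C(N, j)%:R else 0.

(** The law is prescribed for sets of at least two vertices. The bits of smaller sets are put to
    false, in accordance with the mean 0 in [edge_mean]; a join of two distinct vertices never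
    consults them. *)
Let bits_of (w : Om) : {ffun {set 'I_N} -> bool} := [ffun A : {set 'I_N} => (0 < X A w)%N && (2 <= #|A|)%N].

Lemma bfs_run_bits (w : Om) n : (n <= N)%N -> bfs_run (fun A => X A w) n = bfs_run (edges (bits_of w)) n.
Proof.
elim: n => [//|n IH] nN; rewrite !bfs_runS -IH ?(ltnW nN)//.
set E := fun A => X A w; have [u nle sz num] := bfs_run_inv E (ltnW nN).
have [fu fs [s fE] [v fv]] := fillP u nle nN.
rewrite !(bfs_stepE _ fv) /=.
have -> // : kids E (fill (bfs_run E n).1 n) n v = kids (edges (bits_of w)) (fill (bfs_run E n).1 n) n v.
apply: kids_eq => w' A wn /and3P[vA wA _].
rewrite /edges ffunE lt0b; suff -> : (2 <= #|A|)%N by rewrite andbT.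
have vw : v != w'.
  by apply: contraNneq wn => <-; have /onth_mem[h _] := fv; exact: mem_take h.
apply: (@leq_trans #|[set v; w']%SET|); first by rewrite cards2 vw.
by apply: subset_leq_card; apply/fintype.subsetP => x; rewrite !inE => /orP[] /eqP->.
Qed.

Let mbits b : measurable (bits_of @^-1` [set b]).
Proof.
have [mX _ _] := hX.
rewrite (_ : _ @^-1` _ = \bigcap_(A in [set: {set 'I_N}]) (X A @^-1` [set x | (0 < x)%N && (2 <= #|A|)%N = b A])).
  by apply: fin_bigcap_measurable => // A _; exact: mX.
apply/seteqP; split => w /=; first by move=> <- A _ /=; rewrite ffunE.
by move=> h; apply/ffunP => A; rewrite ffunE; exact: h.
Qed.

Let bits_law b : fine (P (bits_of @^-1` [set b])) = \prod_A bern (@edge_prob R N edge_mean) A (b A).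
Proof.
have [mX pX iX] := hX.
have small (A : {set 'I_N}) : (#|A| < 2)%N -> edge_prob edge_mean A = 0.
  by move=> A2; rewrite /edge_prob /edge_mean leqNgt A2 /= oppr0 expR0 subrr.
have [/existsP[A /andP[A2 bA]]|/existsPn nb] := boolP [exists A : {set 'I_N}, (#|A| < 2)%N && b A].
  rewrite (bigD1 A)//= /bern bA small// mul0r.
  rewrite (_ : _ @^-1` _ = set0) ?measure0//.
  apply/seteqP; split => w //= /ffunP/(_ A); rewrite ffunE bA => /andP[_].
  by rewrite leqNgt A2.
pose J : {set {set 'I_N}} := [set A : {set 'I_N} | (2 <= #|A|)%N]%SET.
rewrite (_ : _ @^-1` _ = [set w | forall A, A \in J -> [set x | (0 < x)%N = b A] (X A w)]); last first.
  apply/seteqP; split => w /=.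
    by move=> <- A; rewrite inE ffunE => ->; rewrite andbT.
  move=> h; apply/ffunP => A; rewrite ffunE; case: (leqP 2 #|A|) => A2.
    by rewrite andbT h// inE.
  by rewrite andbF; have := nb A; rewrite A2 /= => /negbTE.
rewrite (iX J (fun A => [set x | (0 < x)%N = b A])); last by move=> A; rewrite inE.
have term A : A \in J -> P (X A @^-1` [set x | (0 < x)%N = b A]) =
    (bern (@edge_prob R N edge_mean) A (b A))%:E.
  rewrite inE => A2.
  have p0 : P (X A @^-1` [set 0%N]) = (expR (- edge_mean #|A|))%:E.
    by have := pX A 0%N A2; rewrite /= expr0 fact0 divr1 mul1r /edge_mean A2.
  case bA : (b A); rewrite /bern /edge_prob.
    rewrite (_ : _ @^-1` _ = ~` (X A @^-1` [set 0%N])); last first.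
      by apply/seteqP; split => w /=; case: (X A w).
    by rewrite probability_setC ?p0//; exact: mX.
  rewrite (_ : _ @^-1` _ = X A @^-1` [set 0%N]); last first.
    by apply/seteqP; split => w /=; case: (X A w).
  by rewrite p0; congr EFin; ring.
rewrite (eq_bigr _ term) prodEFin /=.
rewrite big_mkcond /=; apply: eq_bigr => A _; case: ifP => // /negbT.
rewrite inE -ltnNge => A2; have := nb A; rewrite A2 /= => /negbTE->.
by rewrite /bern small// subr0.
Qed.

Lemma hypergraph_expect (f : seq nat -> R) :
  (\int[P]_w (f (rev (bfs_run (fun A => X A w) N).2))%:E =
   (chE N (join_prob edge_mean) N [::] f)%:E)%E.
Proof.
pose g (b : {ffun {set 'I_N} -> bool}) := f (rev (bfs_run (edges b) N).2).
have [mg Eg] := finite_expect P g mbits.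
have If : P.-integrable setT (EFin \o (g \o bits_of)).
  apply: (@bounded_integrable _ _ _ _ _ (\sum_b `|g b|)) => // w /=.
  by rewrite (bigD1 (bits_of w))//= lerDl sumr_ge0.
under eq_integral do rewrite bfs_run_bits//.
rewrite -[LHS]fineK; last exact: (integrable_fin_num measurableT If).
transitivity (\int[P]_w g (bits_of w))%:E => //; congr EFin; rewrite Eg -exploration_law.
by rewrite /prodE; apply: eq_bigr => b _; rewrite bits_law mulrC.
Qed.

Lemma join_prob_joinp i : join_prob edge_mean i = joinp beta N i.
Proof. by rewrite /join_prob /joinp /join_rate /rate. Qed.
End HypergraphLaw.

(** * Convergence of Lipschitz functionals *)

Section TimeSlices.
Implicit Types h s : seq nat.

(** Past histories are suffixes, the latest count being first. For [i] beyond [size h] the value is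
    [h] itself, so paths are frozen at the end. *)
Definition at_time h i : seq nat := drop (size h - i) h.

Lemma at_time_cat s h i : (i <= size h)%N -> at_time (s ++ h) i = at_time h i.
Proof.
move=> ih; rewrite /at_time size_cat drop_cat.
case: ltnP => [|_]; first by lia.
by congr drop; lia.
Qed.

Lemma at_time_size h : at_time h (size h) = h.
Proof. by rewrite /at_time subnn drop0. Qed.

Lemma at_time_last s h : at_time (s ++ h) (size h) = h.
Proof. by rewrite at_time_cat ?at_time_size. Qed.

Lemma size_at_time h i : (i <= size h)%N -> size (at_time h i) = i.
Proof. by move=> ih; rewrite /at_time size_drop subKn. Qed.

Lemma drop_at_time h i j : (i <= j)%N -> (j <= size h)%N -> at_time h i = drop (j - i) (at_time h j).
Proof. by move=> ij jh; rewrite /at_time drop_drop; congr drop; lia. Qed.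
End TimeSlices.

(** * Lindeberg replacement across blocks *)

Section BlockReplacement.
Context {R : realType} d (Om : measurableType d) (Q : probability Om R) (B : R -> Om -> R).
Hypothesis hB : brownian_motion Q B.
Variables (N : nat) (pr : nat -> R) (nmax : nat) (tau : R).
Hypothesis pr01 : forall i, 0 <= pr i <= 1.
Hypothesis tau0 : 0 < tau.
Hypothesis mean_le2 : forall h, (size h < nmax)%N -> mean N pr h <= 2.
Local Notation stau := (Num.sqrt tau).
Local Notation mart := (mart N pr).
Local Notation chE := (chE N pr).
Variables (bad : pred (seq nat)) (eta : R).
Hypothesis eta0 : 0 <= eta.
Hypothesis bad_mono : forall c h, bad h -> bad (c :: h).
Hypothesis var_ok : forall h, (size h < nmax)%N -> ~~ bad h ->
  `|mean N pr h * (1 - pr (size h)) - 1| <= eta.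

(** [4 * L * e] pays for smoothing [phi] in both means, [2 * L * e] each; the rest is
    [lindeberg_block] with the constants of [smooth_approx], where [3456 = 4 * 864]. *)
Definition block_error (L K e n p : R) : R :=
  4 * L * e + n * tau * (e ^- 2 * (2 * K) * (eta + p) + 3456 * expR 1 * L * e ^- 2 * stau).

Lemma lipschitz_block (phi : R -> R) (L K e : R) : 0 < e -> 0 <= L -> lipschitzR L phi ->
  (forall x, `|phi x| <= K) -> forall n h, (size h + n <= nmax)%N ->
  `|chE n h (fun s => phi (stau * (mart s - mart h))) - heat Q B (n%:R * tau) phi 0| <=
  block_error L K e n%:R (chE n h (fun s => (bad s)%:R)).
Proof.
move=> e0 L0 Lphi bphi n h hn.
have [f [f1 [f2 [[Lf cf1 cf2] [bf bf1 bf2] fphi tay]]]] := smooth_approx e0 L0 Lphi bphi.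
have K0 : 0 <= K := le_trans (normr_ge0 _) (bphi 0).
have ei : 0 <= e ^- 2 by rewrite invr_ge0 exprn_ge0// ltW.
have := @lindeberg_block R d Om Q B hB N pr nmax tau pr01 tau0 mean_le2 bad eta eta0 bad_mono var_ok
  f f1 f2 L K (e^-1 * (2 * K)) (e ^- 2 * (4 * K)) (e ^- 2 * (4 * L)).
move=> /(_ _ _ Lf cf1 cf2 (And3 bf bf1 bf2) tay n h 0 hn) lb.
have {lb} := lb (mulr_ge0 ei (mulr_ge0 (ler0n _ 4) K0)) (mulr_ge0 ei (mulr_ge0 (ler0n _ 4) L0)).
rewrite (@eq_chE _ _ _ pr01 _ _ _ (fun s => f (stau * (mart s - mart h)))); last by move=> s _; rewrite add0r.
set p := chE n h (fun s => (bad s)%:R).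
set E1 := chE n h _; set H1 := heat _ _ _ _ _ => lb.
have a1 : `|chE n h (fun s => phi (stau * (mart s - mart h))) - E1| <= 2 * L * e.
  rewrite -chEB; apply: le_trans (ler_norm_chE _ pr01 _ _ _) _.
  by apply: chE_leC => // s _; rewrite distrC.
have a2 : `|H1 - heat Q B (n%:R * tau) phi 0| <= 2 * L * e.
  apply: (heat_close hB _ _ (lipschitzR_continuous Lf) (lipschitzR_continuous Lphi) bf bphi fphi).
rewrite (_ : _ - _ = (chE n h (fun s => phi (stau * (mart s - mart h))) - E1) + (E1 - H1) +
   (H1 - heat Q B (n%:R * tau) phi 0)); last by ring.
apply: le_trans (ler_normD _ _) _.
apply: le_trans (lerD (le_trans (ler_normD _ _) (lerD a1 lb)) a2) _.
by rewrite /block_error; move: (e ^- 2) => c; rewrite le_eqVlt; apply/orP; left; apply/eqP; field.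
Qed.

Variables (m : nat) (nn : nat -> nat).
Hypothesis nn0 : nn 0%N = 0%N.
Hypothesis nn_lt : forall i, (i < m)%N -> (nn i < nn i.+1)%N.
Hypothesis nn_max : (nn m <= nmax)%N.

Definition block_incr (h : seq nat) (i : nat) : R :=
  stau * (mart (at_time h (nn i.+1)) - mart (at_time h (nn i))).

Let tt i : R := (nn i)%:R * tau.

Let nn_le i j : (i <= j)%N -> (j <= m)%N -> (nn i <= nn j)%N.
Proof.
elim: j => [|j IH]; first by rewrite leqn0 => /eqP->.
rewrite leq_eqVlt => /orP[/eqP-> //|ij] jm.
by apply: leq_trans (IH ij (ltnW jm)) (ltnW (nn_lt jm)).
Qed.

Let mix j h y : nat -> R := fun i => if (i < j)%N then block_incr h i else y i.

(* Lindeberg's method on the scale of blocks: the mean in which the first [j] increments come from the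
   chain and the others from [B] is compared for consecutive [j]. *)
Lemma block_replacement (g : (nat -> R) -> R) (L K e : R) : 0 < e -> 0 <= L -> lipN m L g ->
  (forall y, `|g y| <= K) ->
  `|chE (nn m) [::] (fun s => g (block_incr s)) - \int[Q]_w g ((incr B tt)^~ w)| <=
  m%:R * (4 * L * e) + (nn m)%:R * tau * (e ^- 2 * (2 * K) *
    (eta + chE (nn m) [::] (fun s => (bad s)%:R)) + 3456 * expR 1 * L * e ^- 2 * stau).
Proof.
move=> e0 L0 Lg gK.
have K0 : 0 <= K := le_trans (normr_ge0 _) (gK (fun=> 0)).
have ei : 0 <= e ^- 2 by rewrite invr_ge0 exprn_ge0// ltW.
pose A j := chE (nn j) [::] (fun s => \int[Q]_w g (mix j s ((incr B tt)^~ w))).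
set p := chE (nn m) [::] (fun s => (bad s)%:R).
set W := _ + _ * stau.
have tt_lt i : (i < m)%N -> tt i < tt i.+1.
  by move=> im; rewrite /tt ltr_pM2r// ltr_nat nn_lt.
have tt0 : tt 0%N = 0 by rewrite /tt nn0 mul0r.
have lip_mix j s : lipN m L (fun y => g (mix j s y)).
  move=> y z; apply: le_trans (Lg _ _) _; rewrite ler_wpM2l//; apply: ler_sum => i _.
  by rewrite /mix; case: ifP => // _; rewrite subrr normr0.
have lip_upd y i : (i < m)%N -> lipschitzR L (fun x => g (upd y i x)).
  move=> im x x'; apply: le_trans (Lg _ _) _; rewrite ler_wpM2l//.
  rewrite (bigD1 (Ordinal im))//= /upd eqxx big1 ?addr0// => l /eqP li.
  by case: eqP => [il|_]; [case: li; exact/val_inj|rewrite subrr normr0].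
have mI i : (i < m)%N -> measurable_fun setT (incr B tt i) by move=> _; exact: (measurable_incr hB).
have step j : (j < m)%N -> `|A j.+1 - A j| <= block_error L K e ((nn j.+1 - nn j)%N)%:R p.
  move=> jm; have njm : (nn j < nn j.+1)%N := nn_lt jm.
  set D := (nn j.+1 - nn j)%N; rewrite /A.
  rewrite {1}(_ : nn j.+1 = (nn j + D)%N); last by rewrite /D subnKC// ltnW.
  rewrite chE_add -chEB.
  (* Earlier increments are frozen and later ones averaged; what remains is a bounded Lipschitz
     function of one variable, as [lipschitz_block] requires. *)
  pose ph s x := \int[Q]_w g (upd (mix j s ((incr B tt)^~ w)) j x).
  have mph s x : measurable_fun setT (fun w => g (upd (mix j s ((incr B tt)^~ w)) j x)).
    apply: (lipN_measurable Q Lg (Y := fun i w => upd (mix j s ((incr B tt)^~ w)) j x i)) => i im.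
    rewrite /upd /mix; case: (i == j) => //; case: (i < j)%N => //; exact: mI.
  have bph s x : `|ph s x| <= K by exact: ler_norm_expect.
  have lph s : lipschitzR L (ph s).
    move=> x x'; rewrite /ph -RintegralB//; [|exact: bounded_integrable (mph s _) _..].
    apply: ler_norm_expect; first exact: measurable_funB.
    by move=> w; exact: lip_upd.
  have E1 s : size s = nn j -> chE D s (fun s' => \int[Q]_w g (mix j.+1 s' ((incr B tt)^~ w))) =
      chE D s (fun s' => ph s (stau * (mart s' - mart s))).
    move=> ss; apply: eq_chE => // s' ss'; rewrite /ph; apply: eq_Rintegral => w _; congr g.
    apply/funext => i; rewrite /upd /mix ltnS leq_eqVlt; case: eqP => [->|_] /=.
      have e1 : size (s' ++ s) = nn j.+1 by rewrite size_cat ss' ss subnK// ltnW.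
      by rewrite /block_incr -e1 at_time_size -ss at_time_last.
    case: ltnP => // ij; rewrite /block_incr !at_time_cat// ss; apply: nn_le => //; exact: ltnW.
  have E2 s : size s = nn j -> \int[Q]_w g (mix j s ((incr B tt)^~ w)) = heat Q B (D%:R * tau) (ph s) 0.
    move=> ss; apply: (etrans (@brownian_resample _ _ _ _ _ hB m tt tt0 tt_lt L K (fun y => g (mix j s y)) j jm (lip_mix j s) (fun=> gK _))).
    rewrite /heat; apply: eq_Rintegral => w _; rewrite add0r /ph.
    rewrite (_ : D%:R * tau = tt j.+1 - tt j); last by rewrite /tt /D natrB 1?ltnW// mulrBl.
    apply: eq_Rintegral => w' _; congr g; apply/funext => i; rewrite /upd /mix.
    by case: eqP => [->|//]; rewrite ltnn.
  apply: le_trans (ler_norm_chE _ pr01 _ _ _) _.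
  apply: le_trans (_ : _ <= chE (nn j) [::] (fun s => block_error L K e D%:R (chE D s (fun s => (bad s)%:R)))) _.
    apply: le_chE => // s ss; rewrite cats0 E1// E2//; apply: lipschitz_block => //.
    by rewrite ss (subnKC (ltnW njm)); apply: leq_trans nn_max; exact: nn_le.
  rewrite /block_error; set c1 := 3456 * _ * _ * _ * _.
  rewrite (@eq_chE _ _ _ pr01 _ _ _ (fun s => (4 * L * e + D%:R * tau * (e ^- 2 * (2 * K) * eta + c1)) +
    (D%:R * tau * (e ^- 2 * (2 * K))) * chE D s (fun s => (bad s)%:R))); last by move=> s _; ring.
  rewrite chED chE_cst chEZ -chE_add.
  have -> : 4 * L * e + D%:R * tau * (e ^- 2 * (2 * K) * (eta + p) + c1) =
    (4 * L * e + D%:R * tau * (e ^- 2 * (2 * K) * eta + c1)) + (D%:R * tau * (e ^- 2 * (2 * K))) * p by ring.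
  rewrite lerD2l ler_wpM2l//; first by rewrite !mulr_ge0// ltW.
  rewrite /p /D subnKC; last exact: ltnW.
  (* Badness is monotone, so its probability at the end of block [j] is at most that at the end of
     the last block. *)
  rewrite -(subnKC (nn_le jm (leqnn m))) chE_add; apply: le_chE => // s ss; rewrite cats0.
  case: (boolP (bad s)) => [bs|_]; last by apply: chE_ge0.
  rewrite (@eq_chE _ _ _ pr01 _ _ _ (fun=> 1)) ?chE_cst// => s' _; suff -> : bad (s' ++ s) by [].
  by elim: s' => //= c s' IH; exact: bad_mono.
have tel j : (j <= m)%N -> `|A j - A 0%N| <= j%:R * (4 * L * e) + (nn j)%:R * tau * W.
  elim: j => [_|j IH jm]; first by rewrite subrr normr0 nn0 !mul0r addr0.
  rewrite (_ : _ - _ = (A j.+1 - A j) + (A j - A 0%N)); last by ring.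
  apply: le_trans (ler_normD _ _) _; apply: le_trans (lerD (step j jm) (IH (ltnW jm))) _.
  rewrite /block_error -/W natrB; last exact/ltnW/nn_lt.
  by rewrite -[j.+1%:R]natr1 le_eqVlt; apply/orP; left; apply/eqP; ring.
have := tel m (leqnn m); congr (_ <= _); congr `|_ - _|.
- rewrite /A; apply: eq_chE => // s _; rewrite cats0 (@eq_Rintegral _ _ _ _ _ (cst (g (block_incr s)))).
    exact: expect_cst.
  move=> w _; rewrite /=; apply/eqP; rewrite -subr_eq0 -normr_le0.
  apply: le_trans (Lg _ _) _; rewrite big1 ?mulr0// => i _.
  by rewrite /mix ltn_ord subrr normr0.
- by rewrite /A nn0 /=; apply: eq_Rintegral => w _; congr g; apply/funext.
Qed.
End BlockReplacement.

(** Any upper bound [eta] of the distance is allowed, so paths need not be bounded and no supremum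
    appears. *)
Definition sup_lipschitz {R : realType} (T L : R) (G : (R -> R) -> R) :=
  forall f f' eta, (forall t, 0 <= t <= T -> `|f t - f' t| <= eta) -> `|G f - G f'| <= L * eta.

(** * Comparison of the walk with its block increments *)

Section Paths.
Context {R : realType}.
Variables (beta : nat -> R) (k N : nat) (pr : nat -> R) (tau delta : R) (m : nat).
Hypothesis pr01 : forall i, 0 <= pr i <= 1.
Hypothesis tau0 : 0 < tau.
Hypothesis tau_delta : tau <= delta.
Hypothesis m0 : (0 < m)%N.
Local Notation stau := (Num.sqrt tau).
Local Notation mart := (mart N pr).
Local Notation chE := (chE N pr).
Local Notation drift := (drift N pr).
Local Notation c := (mu beta k / (k%:R - 1)).
Local Notation T := (m%:R * delta).

Let delta0 : 0 < delta := lt_le_trans tau0 tau_delta.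

Definition step_path (y : nat -> R) (t : R) : R := \sum_(l < m | l.+1%:R * delta <= t) y l.

Definition hist_path (h : seq nat) (t : R) : R :=
  if t < 0 then 0 else stau * walk (at_time h (Num.truncn (t / tau))).

(** Blocks consist of whole steps, so mesh points are rounded down; [tau <= delta] keeps every block
    nonempty. *)
Definition grid (j : nat) : nat := Num.truncn (j%:R * delta / tau).

Lemma grid0 : grid 0 = 0%N.
Proof. by rewrite /grid !mul0r truncn0. Qed.

Let grid_arg j : 0 <= j%:R * delta / tau.
Proof. by rewrite divr_ge0 ?mulr_ge0// ltW. Qed.

Lemma grid_lt j : (grid j < grid j.+1)%N.
Proof.
rewrite /grid -[ltnLHS]/(Num.truncn _) truncn_ge_nat// -[(Num.truncn _).+1%:R]natr1 -[j.+1%:R]natr1.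
rewrite mulrDl mul1r mulrDl; apply: lerD.
  by have /andP[] := truncn_itv (grid_arg j).
by rewrite ler_pdivlMr// mul1r.
Qed.

Lemma grid_mono i j : (i <= j)%N -> (grid i <= grid j)%N.
Proof.
elim: j => [|j IH]; first by rewrite leqn0 => /eqP->.
by rewrite leq_eqVlt => /orP[/eqP->//|/IH]; move/leq_trans; apply; exact/ltnW/grid_lt.
Qed.

Lemma grid_le j : (grid j)%:R * tau <= j%:R * delta.
Proof. by rewrite -ler_pdivlMr//; have /andP[] := truncn_itv (grid_arg j). Qed.

Lemma grid_gt j : j%:R * delta - tau < (grid j)%:R * tau.
Proof.
rewrite ltrBlDr -[X in _ + X]mul1r -mulrDl natr1 -ltr_pdivrMr//.
by have /andP[] := truncn_itv (grid_arg j).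
Qed.

Lemma step_path_lip y z t : `|step_path y t - step_path z t| <= \sum_(l < m) `|y l - z l|.
Proof.
rewrite /step_path -sumrB big_mkcond /=; apply: le_trans (ler_norm_sum _ _ _) _.
by apply: ler_sum => l _; case: ifP; rewrite ?normr0.
Qed.

Lemma Wk_close (f g : R -> R) t : 0 <= t -> Wk beta k f t - Wk beta k g t = f t - g t.
Proof. by rewrite /Wk ltNge => -> /=; ring. Qed.

Lemma step_functional_lip L (G : (R -> R) -> R) : sup_lipschitz T L G ->
  lipN m L (fun y => G (Wk beta k (step_path y))).
Proof.
move=> GL y z; apply: GL => t /andP[t0 _].
by rewrite Wk_close// step_path_lip.
Qed.

Lemma step_path_index (y : nat -> R) t : 0 <= t <= T ->
  exists2 j, [/\ (j <= m)%N, j%:R * delta <= t & t < j.+1%:R * delta] & step_path y t = \sum_(l < j) y l.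
Proof.
move=> /andP[t0 tT]; pose j := Num.truncn (t / delta).
have td0 : 0 <= t / delta by rewrite divr_ge0// ltW.
have /andP[j1 j2] := truncn_itv td0.
have jm : (j <= m)%N by rewrite /j truncn_le_nat ltr_pdivrMr// (le_lt_trans tT)// ltr_pM2r// ltr_nat.
have jd : j%:R * delta <= t by rewrite -ler_pdivlMr.
have jd' : t < j.+1%:R * delta by rewrite -ltr_pdivrMr.
exists j => //.
rewrite /step_path (big_ord_widen m _ jm); apply: eq_bigl => l.
by rewrite -ler_pdivlMr// -truncn_ge_nat.
Qed.

Lemma sum_block_incr h j : \sum_(l < j) block_incr N pr tau grid h l = stau * mart (at_time h (grid j)).
Proof.
have m00 : mart (at_time h (grid 0)) = 0 by rewrite grid0 /at_time subn0 drop_size.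
elim: j => [|j IH]; first by rewrite big_ord0 m00 mulr0.
by rewrite big_ord_recr /= IH /block_incr; ring.
Qed.

Lemma hist_path_close h x r : (grid m <= size h)%N -> 0 <= x ->
  (forall j i, (j < m)%N -> (grid j <= i <= grid j.+1)%N ->
     stau * `|mart (at_time h i) - mart (at_time h (grid j))| <= x) ->
  (forall i, (i <= grid m)%N -> `|stau * drift (at_time h i) - c * (i%:R * tau) ^+ k.-1| <= r) ->
  forall t, 0 <= t <= T ->
  `|hist_path h t - Wk beta k (step_path (block_incr N pr tau grid h)) t| <=
   x + (r + `|c| * (k.-1%:R * T ^+ k.-2) * tau).
Proof.
move=> hm x0 osc dr t tT; have /andP[t0 tT'] := tT.
have [j [jm jt tj] ->] : exists2 j, [/\ (j <= m)%N, j%:R * delta <= t & t < j.+1%:R * delta] &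
    Wk beta k (step_path (block_incr N pr tau grid h)) t = stau * mart (at_time h (grid j)) + c * t ^+ k.-1.
  have [j hj e] := step_path_index (block_incr N pr tau grid h) tT.
  by exists j => //; rewrite /Wk ltNge t0 /= e sum_block_incr.
rewrite /hist_path ltNge t0 /=; set i := Num.truncn (t / tau).
have tt0 : 0 <= t / tau by rewrite divr_ge0// ltW.
have /andP[i1 i2] := truncn_itv tt0; rewrite -/i in i1 i2.
have it : i%:R * tau <= t by rewrite -ler_pdivlMr.
have ti : t - i%:R * tau <= tau.
  by rewrite lerBlDr -[X in X + _]mul1r -mulrDl addrC natr1 -ler_pdivrMr// ltW.
have gi : (grid j <= i)%N by rewrite /grid le_truncn// ler_pM2r ?invr_gt0.
have im : (i <= grid m)%N by rewrite /grid le_truncn// ler_pM2r ?invr_gt0.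
have a1 : stau * `|mart (at_time h i) - mart (at_time h (grid j))| <= x.
  (* [j = m] occurs only at [t = T], where no block follows; then [i] is [grid m]. *)
  move: jm; rewrite leq_eqVlt => /orP[/eqP jm|jm].
    rewrite (_ : i = grid j) ?subrr ?normr0 ?mulr0//.
    by apply/eqP; rewrite eqn_leq gi jm im.
  apply: osc => //; rewrite gi /grid le_truncn// ler_pM2r ?invr_gt0//; exact: ltW.
have a2 := dr i im.
have a3 : `|(i%:R * tau) ^+ k.-1 - t ^+ k.-1| <= k.-1%:R * T ^+ k.-2 * tau.
  have it0 : 0 <= i%:R * tau by rewrite mulr_ge0// ltW.
  rewrite distrC subrXX normrM mulrC ger0_norm; last first.
    by apply: sumr_ge0 => l _; rewrite mulr_ge0 ?exprn_ge0.
  rewrite ger0_norm ?subr_ge0//; apply: ler_pM => //; rewrite ?subr_ge0//.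
    by apply: sumr_ge0 => l _; rewrite mulr_ge0 ?exprn_ge0.
  have -> : k.-1%:R * T ^+ k.-2 = \sum_(l < k.-1) T ^+ k.-2 by rewrite sumr_const card_ord mulr_natl.
  apply: ler_sum => l _.
  have kl : (k.-2 - l + l)%N = k.-2 by rewrite subnK//; have := ltn_ord l; clear; lia.
  rewrite -[in leRHS]kl exprD; apply: ler_pM; rewrite ?exprn_ge0// lerXn2r ?nnegrE//;
    by [exact: le_trans tT'|exact: le_trans it (le_trans _ tT')|exact: le_trans t0 tT'].
rewrite (walkE N pr) mulrDr.
rewrite (_ : _ - _ = stau * (mart (at_time h i) - mart (at_time h (grid j))) +
  ((stau * drift (at_time h i) - c * (i%:R * tau) ^+ k.-1) + c * ((i%:R * tau) ^+ k.-1 - t ^+ k.-1))); last by ring.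
apply: le_trans (ler_normD _ _) _; apply: lerD.
  by rewrite normrM ger0_norm ?sqrtr_ge0.
apply: le_trans (ler_normD _ _) _; apply: lerD => //.
by rewrite normrM -mulrA ler_wpM2l.
Qed.

Variable (nmax : nat).
Hypothesis mean_le2 : forall h, (size h < nmax)%N -> mean N pr h <= 2.
Hypothesis nn_max : (grid m <= nmax)%N.

Definition oscillates (x : R) (j : nat) (h : seq nat) : bool :=
  ever (fun u => x / stau < `|mart u - mart (at_time h (grid j))|) (grid j.+1 - grid j)
    (at_time h (grid j.+1)).

Lemma oscillation_prob x j : 0 < x -> x * stau <= 8 * delta -> (j < m)%N ->
  chE (grid m) [::] (fun h => (oscillates x j h)%:R) <= 2 * expR (- (x ^+ 2 / (32 * delta))).
Proof.
move=> x0 xd jm; have st0 : 0 < stau by rewrite sqrtr_gt0.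
have s2 : stau * stau = tau by rewrite -expr2 sqr_sqrtr// ltW.
have gj := grid_lt j; have gm := grid_mono jm.
pose D := (grid j.+1 - grid j)%N.
have -> : grid m = (grid j + (D + (grid m - grid j.+1)))%N by rewrite /D; lia.
rewrite chE_add; apply: chE_leC => // s sj; rewrite cats0.
rewrite chE_add.
(* A block lasts at most [2 delta], and this [th] minimizes the resulting exponent
   [8 delta th^2 - th x]. The condition [th * stau <= 1/2] is the hypothesis
   [x * stau <= 8 delta]. *)
pose th := x / (16 * delta).
have th0 : 0 < th by rewrite divr_gt0// mulr_gt0.
have tst : 0 < th * stau <= 2^-1.
  rewrite mulr_gt0//= /th mulrAC ler_pdivrMr ?mulr_gt0//; lra.
have hm u : (size u < D)%N -> mean N pr (u ++ s) <= 2.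
  by move=> uD; apply: mean_le2; apply: leq_trans nn_max; rewrite size_cat sj; rewrite /D in uD; lia.
have := mart_maximal pr01 (x / stau) tst hm.
have -> : chE D s (fun s' => chE (grid m - grid j.+1) s' (fun h => (oscillates x j h)%:R)) =
    chE D s (fun s' => (ever (fun u => x / stau < `|mart u - mart s|) D s')%:R).
  apply: eq_chE => // s' sD.
  have szs : size (s' ++ s) = grid j.+1 by rewrite size_cat sD sj /D; lia.
  rewrite -[RHS](chE_cst N pr (grid m - grid j.+1) (s' ++ s)); apply: eq_chE => // u _.
  rewrite /oscillates -{2}szs at_time_last -[in at_time _ (grid j)]sj catA.
  by rewrite at_time_last.
move/le_trans; apply; rewrite ler_pM2l// ler_expR.
have Dd : D%:R * tau <= 2 * delta.
  rewrite /D natrB; last exact: ltnW.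
  have := grid_le j.+1; have := grid_gt j; rewrite -[j.+1%:R]natr1 mulrBl mulrDl mul1r; move: tau_delta; lra.
have -> : th * stau * (x / stau) = th * x by field; rewrite gt_eqF.
have -> : 4 * (th * stau) ^+ 2 * D%:R = 4 * th ^+ 2 * (D%:R * tau) by transitivity (4 * th ^+ 2 * (D%:R * (stau * stau))); [ring|rewrite s2].
have e1 : x ^+ 2 / (32 * delta) = th * x / 2 by rewrite /th; field; rewrite gt_eqF.
have e2 : 4 * th ^+ 2 * (2 * delta) = th * x / 2 by rewrite /th; field; rewrite gt_eqF.
have : 4 * th ^+ 2 * (D%:R * tau) <= 4 * th ^+ 2 * (2 * delta).
  by rewrite ler_wpM2l// mulr_ge0// exprn_ge0// ltW.
by rewrite e1 e2; lra.
Qed.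

Lemma path_comparison (bad : pred (seq nat)) (G : (R -> R) -> R) (K L x r : R) :
  sup_lipschitz T L G -> (forall f, `|G f| <= K) -> 0 <= L -> 0 <= r -> 0 < x -> x * stau <= 8 * delta ->
  (forall h, size h = grid m -> ~~ bad h -> forall i, (i <= grid m)%N ->
     `|stau * drift (at_time h i) - c * (i%:R * tau) ^+ k.-1| <= r) ->
  chE (grid m) [::] (fun h =>
    `|G (hist_path h) - G (Wk beta k (step_path (block_incr N pr tau grid h)))|) <=
  L * (x + (r + `|c| * (k.-1%:R * T ^+ k.-2) * tau)) +
  2 * K * (chE (grid m) [::] (fun h => (bad h)%:R) + m%:R * (2 * expR (- (x ^+ 2 / (32 * delta))))).
Proof.
move=> GL GK L0 r0 x0 xd dr; set W := x + _.
have W0 : 0 <= W.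
  rewrite /W; apply: addr_ge0; first exact: ltW.
  by apply: addr_ge0 => //; rewrite mulr_ge0 ?(ltW tau0)// mulr_ge0// mulr_ge0// exprn_ge0// mulr_ge0 ?(ltW delta0).
have K0 : 0 <= K := le_trans (normr_ge0 _) (GK (fun=> 0)).
have st0 : 0 < stau by rewrite sqrtr_gt0.
apply: (@le_trans _ _ (chE (grid m) [::] (fun h => L * W + 2 * K * ((bad h)%:R +
    \sum_(j < m) (oscillates x j h)%:R)))); last first.
  rewrite chED chE_cst chEZ lerD2l ler_wpM2l ?mulr_ge0// chED lerD2l.
  have -> : chE (grid m) [::] (fun h => \sum_(j < m) (oscillates x j h)%:R) =
      \sum_(j < m) chE (grid m) [::] (fun h => (oscillates x j h)%:R).
    move: (index_enum _) => idx; elim: idx => [|j idx IH].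
      by rewrite big_nil -[RHS](chE_cst N pr (grid m) [::]); apply: eq_chE => // s _; rewrite big_nil.
    by rewrite big_cons -IH -chED; apply: eq_chE => // s _; rewrite big_cons.
  rewrite mulr_natl -[X in _ *+ X]card_ord -sumr_const; apply: ler_sum => j _.
  exact: oscillation_prob.
apply: le_chE => // h hs; rewrite cats0.
have s0 : 0 <= \sum_(j < m) (oscillates x j h)%:R :> R by apply: sumr_ge0.
have G2 f f' : `|G f - G f'| <= 2 * K.
  apply: le_trans (ler_normB _ _) _; have := GK f; have := GK f'; lra.
have [b|nb] := boolP (bad h).
  apply: le_trans (G2 _ _) _; rewrite [X in _ + X]mulrDr mulr1.
  by have := mulr_ge0 L0 W0; have := mulr_ge0 (mulr_ge0 (ler0n R 2) K0) s0; lra.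
have [/existsP[j oj]|/existsPn no] := boolP [exists j : 'I_m, oscillates x j h].
  apply: le_trans (G2 _ _) _; rewrite add0r.
  have s1 : 1 <= \sum_(j < m) (oscillates x j h)%:R :> R by rewrite (bigD1 j)//= oj lerDl sumr_ge0.
  by have := mulr_ge0 L0 W0; have := ler_wpM2l (mulr_ge0 (ler0n R 2) K0) s1; lra.
apply: (@le_trans _ _ (L * W)); last by rewrite lerDl mulr_ge0 ?addr_ge0 ?mulr_ge0.
apply: GL => t tT; apply: hist_path_close => //; [by rewrite hs|exact: ltW| |exact: dr].
move=> j i jm /andP[ji ij].
have := no (Ordinal jm); apply: contraNle => /= lt; apply/everP.
have gjm : (grid j.+1 <= size h)%N by rewrite hs grid_mono.
exists (grid j.+1 - i)%N; first by rewrite leq_sub2l.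
by rewrite -drop_at_time// ltr_pdivrMr// mulrC.
Qed.
End Paths.

(** * Refining the mesh along a continuous path *)

Section MeshLimit.
Context {R : realType}.
Variables (beta : nat -> R) (k : nat).

Lemma uniform_continuity_segment (f : R -> R) (T e : R) :
  {within [set t | 0 <= t], continuous f} -> 0 < e ->
  exists2 d, 0 < d & forall x y, 0 <= x <= T -> 0 <= y -> `|x - y| < d -> `|f x - f y| < e.
Proof.
move=> /subspace_continuousP cf e0.
have e2 : 0 < e / 2 by rewrite divr_gt0.
have := (compact_near_coveringP `[0, T]).1 (@segment_compact R 0 T).
move=> /(_ nat \oo (fun n x => forall y, 0 <= x -> 0 <= y -> `|x - y| < n.+1%:R^-1 -> `|f x - f y| < e) _).
case=> [x /=|M _ /(_ M (leqnn M)) HM].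
  rewrite in_itv /= => /andP[x0 xT].
  have /cvgrPdist_lt/(_ _ e2) := cf x x0.
  rewrite near_withinE /= => /nbhs_ballP[d /= d0 hd].
  have d2 : 0 < d / 2 by rewrite divr_gt0.
  exists (ball x (d / 2), [set n | n.+1%:R^-1 < d / 2]) => /=.
    split; first exact: nbhsx_ballx.
    by have := near_infty_natSinv_lt (PosNum d2).
  move=> [x' n] /= [bx nd] y x'0 y0 xy.
  have h1 : `|f x - f x'| < e / 2.
    by apply: hd => //; rewrite /ball /=; apply: lt_trans bx _; rewrite ltr_pdivrMr// ltr_pMr// ltrDl.
  have h2 : `|f x - f y| < e / 2.
    apply: hd => //; rewrite /ball /= (_ : x - y = (x - x') + (x' - y)); last by ring.
    apply: le_lt_trans (ler_normD _ _) _; rewrite [ltRHS]splitr; apply: ltrD => //.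
    exact: lt_trans xy nd.
  rewrite (_ : f x' - f y = (f x' - f x) + (f x - f y)); last by ring.
  apply: le_lt_trans (ler_normD _ _) _; rewrite [ltRHS]splitr; apply: ltrD => //.
  by rewrite distrC.
exists M.+1%:R^-1; first by rewrite invr_gt0.
move=> x y xT y0 xy; by apply: (HM x) => //=; case/andP: xT.
Qed.

Lemma mesh_limit (f : R -> R) (G : (R -> R) -> R) (T L : R) :
  {within [set t | 0 <= t], continuous f} -> f 0 = 0 -> 0 < T -> 0 <= L -> sup_lipschitz T L G ->
  G (Wk beta k (step_path (T / m.+1%:R) m.+1 (fun i => f (i.+1%:R * (T / m.+1%:R)) - f (i%:R * (T / m.+1%:R)))))
    @[m --> \oo] --> G (Wk beta k f).
Proof.
move=> cf f0 T0 L0 GL; apply/cvgrPdist_le => e e0.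
have e1 : 0 < e / (L + 1) by rewrite divr_gt0// ltr_wpDl.
have [d d0 hd] := uniform_continuity_segment T cf e1.
near=> m.
have dm0 : 0 < T / m.+1%:R by rewrite divr_gt0.
set dm := T / m.+1%:R in dm0 *.
have dmd : dm < d.
  rewrite /dm ltr_pdivrMr// -ltr_pdivrMl// mulrC.
  near: m; apply: filterS (nbhs_infty_gtr (T / d)) => n /lt_trans; apply.
  by rewrite ltr_nat.
apply: (@le_trans _ _ (L * (e / (L + 1)))); last first.
  by rewrite mulrCA ger_pMr// ler_pdivrMr ?mul1r ?lerDl// ltr_wpDl.
apply: GL => t tT; have /andP[t0 tT'] := tT; rewrite Wk_close//.
have tT2 : 0 <= t <= m.+1%:R * dm by rewrite t0 /dm mulrC divfK.
have [j [jm jt tj] ->] := step_path_index dm0 (lexx dm) (fun i => f (i.+1%:R * dm) - f (i%:R * dm)) tT2.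
have -> : \sum_(l < j) (f (l.+1%:R * dm) - f (l%:R * dm)) = f (j%:R * dm).
  by rewrite -(big_mkord predT (fun l => f (l.+1%:R * dm) - f (l%:R * dm))) telescope_sumr// mul0r f0 subr0.
apply/ltW/hd => //; first by rewrite mulr_ge0// ltW.
rewrite ger0_norm ?subr_ge0//; apply: lt_trans dmd.
by move: tj; rewrite -[j.+1%:R]natr1 mulrDl mul1r; lra.
Unshelve. all: by end_near. Qed.

End MeshLimit.

(** * Scaling limit of Lipschitz functionals *)

Section Scaling.
Context {R : realType}.
Variables (beta : nat -> R) (k : nat) (Cb : R).
Hypothesis beta_ge0 : forall j, (2 <= j)%N -> 0 <= beta j.
Hypothesis beta_bd : forall j, (2 <= j)%N -> j%:R * beta j <= Cb.
Hypothesis k_ge3 : (3 <= k)%N.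
Hypothesis beta_crit : forall j, (2 <= j <= k.-1)%N -> beta j = (j%:R * (j%:R - 1))^-1.
Context d (Om : measurableType d) (Q : probability Om R) (B : R -> Om -> R).
Hypothesis hB : brownian_motion Q B.
Variables (tau rho : nat -> R).
Hypothesis scales : forall N, (0 < N)%N ->
  [/\ 0 < tau N, 0 < rho N, tau N * rho N * N%:R = 1 & rho N ^+ k.-2 = Num.sqrt (tau N)].
Hypothesis rho_cvg : rho @ \oo --> 0.
Hypothesis tau_cvg : tau @ \oo --> 0.
Local Notation c := (mu beta k / (k%:R - 1)).
Local Notation chE N := (chE N (joinp beta N)).
Let stau N := Num.sqrt (tau N).

Let stau_cvg : stau @ \oo --> 0.
Proof.
have -> : 0 = Num.sqrt 0 :> R by rewrite sqrtr0.
by apply: continuous_cvg => //; exact: sqrt_continuous.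
Qed.

Lemma near_small (u : nat -> R) (C e : R) : u @ \oo --> 0 -> 0 < e -> \forall N \near \oo, C * u N <= e.
Proof.
move=> u0 e0; have Cu : C * u N @[N --> \oo] --> 0 by rewrite -[X in _ --> X](mulr0 C); exact: cvgMr.
have /cvgrPdist_le/(_ _ e0) := Cu; apply: filterS => N; rewrite sub0r normrN.
exact/le_trans/ler_norm.
Qed.

(** [mart_maximal] with parameter [stau N], which turns the level [a / stau N] into [a] and the [n]
    steps into at most [4 T]. *)
Lemma escape_prob N T a n : 0 < tau N -> stau N <= 2^-1 -> n%:R * tau N <= T ->
  (forall h, (size h)%:R * tau N <= T -> mean N (joinp beta N) h <= 2) ->
  chE N n [::] (fun h => (escapes beta N (a / stau N) h)%:R) <= 2 * expR (4 * T - a).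
Proof.
move=> tau0 st2 nT hm; have st0 : 0 < stau N by rewrite sqrtr_gt0.
have s2 : stau N ^+ 2 = tau N by rewrite sqr_sqrtr// ltW.
have := @mart_maximal R N (joinp beta N) (fun i => joinp01 beta_ge0 N i) n [::] (stau N) (a / stau N).
rewrite st0 st2 => /(_ isT) mm.
apply: (@le_trans _ _ (2 * expR (4 * stau N ^+ 2 * n%:R - stau N * (a / stau N)))).
  apply: le_trans (mm _); last first.
    move=> s sn; rewrite cats0; apply: hm; apply: le_trans nT.
    by rewrite ler_pM2r// ler_nat ltnW.
  rewrite le_eqVlt; apply/orP; left; apply/eqP; apply: eq_chE => [|s sn].
    exact: joinp01.
  by rewrite cats0 /escapes sn; congr ((nat_of_bool _)%:R); apply: eq_has => j; rewrite /= subr0.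
rewrite ler_pM2l// ler_expR s2 mulrCA divff ?gt_eqF// mulr1 lerB//.
by rewrite -mulrA ler_pM2l// mulrC.
Qed.

Lemma escapes_drop N b j h : escapes beta N b (drop j h) -> escapes beta N b h.
Proof.
rewrite -{2}(cat_take_drop j h); elim: (take j h) => //= n s IH hb.
exact: escapes_cons (IH hb).
Qed.

Variables (G : (R -> R) -> R) (T L K : R).
Hypothesis T0 : 0 < T.
Hypothesis L0 : 0 <= L.
Hypothesis GL : sup_lipschitz T L G.
Hypothesis GK : forall f, `|G f| <= K.

Let incr_at (delta : R) (w : Om) (i : nat) : R := B (i.+1%:R * delta) w - B (i%:R * delta) w.

Let measurable_grid m delta (tt : nat -> R) : T = m%:R * delta ->
  measurable_fun setT (fun w => G (Wk beta k (step_path delta m ((incr B tt)^~ w)))).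
Proof.
move=> TE; have GL' := GL; rewrite TE in GL'.
apply: (lipN_measurable Q (step_functional_lip beta k GL')) => i _; exact: (measurable_incr hB).
Qed.

Let grid_cvg m delta : (0 < m)%N -> 0 < delta -> T = m%:R * delta ->
  \int[Q]_w G (Wk beta k (step_path delta m ((incr B (fun i => (grid (tau N) delta i)%:R * tau N))^~ w))) @[N --> \oo]
  --> \int[Q]_w G (Wk beta k (step_path delta m (incr_at delta w))).
Proof.
move=> m0 d0 TE; have GL' := GL; rewrite TE in GL'.
have lip := step_functional_lip beta k GL'.
have [|N w|w|_ //] := @expect_cvg _ _ _ Q (fun N w => G (Wk beta k (step_path delta m
    ((incr B (fun i => (grid (tau N) delta i)%:R * tau N))^~ w))))
    (fun w => G (Wk beta k (step_path delta m (incr_at delta w)))) K.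
- by move=> N; exact: measurable_grid.
- exact: GK.
apply/cvgrPdist_le => e e0; pose e' := e / (L * (2 * m%:R) + 1).
have LM : 0 <= L * (2 * m%:R) by rewrite !mulr_ge0.
have e'0 : 0 < e' by rewrite divr_gt0// ltr_wpDl.
have gc i : \forall N \near \oo, `|B (i%:R * delta) w - B ((grid (tau N) delta i)%:R * tau N) w| < e'.
  have [_ _ cB _ _] := hB; have /subspace_continuousP cw := cB w.
  have id0 : 0 <= i%:R * delta by rewrite mulr_ge0// ltW.
  have /cvgrPdist_lt/(_ _ e'0) := cw _ id0.
  rewrite near_withinE => /nbhs_ballP[r /= r0 hr].
  near=> N; have N0 : (0 < N)%N by near: N; exact: nbhs_infty_gt.
  have [tau0 _ _ _] := scales N0.
  have td : tau N <= delta by rewrite -[tau N]mul1r; near: N; exact: near_small.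
  have tr : 1 * tau N <= r / 2 by near: N; apply: near_small => //; rewrite divr_gt0.
  apply: hr; last by rewrite /= mulr_ge0// ltW.
  rewrite /ball /= ger0_norm ?subr_ge0 ?(grid_le tau0 td)//.
  by have := grid_gt tau0 td i; lra.
have gca : \forall N \near \oo, forall i, (i <= m)%N ->
    `|B (i%:R * delta) w - B ((grid (tau N) delta i)%:R * tau N) w| < e'.
  elim: (m) => [|n IH]; first by apply: filterS (gc 0%N) => N h i; rewrite leqn0 => /eqP->.
  apply: filterS2 IH (gc n.+1) => N h1 h2 i.
  by rewrite leq_eqVlt => /orP[/eqP->//|]; exact: h1.
apply: filterS gca => N gN.
apply: le_trans (lip _ _) _.
apply: (@le_trans _ _ (L * (\sum_(i < m) (2 * e')))).
  rewrite ler_wpM2l//; apply: ler_sum => i _.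
  rewrite /incr_at /incr.
  have h1 := gN i (ltnW (ltn_ord i)); have h2 := gN i.+1 (ltn_ord i).
  set a := B _ _ in h2 *; set b := B _ _ in h1 *; set a' := B (_ * tau N) _ in h2 *.
  set b' := B (_ * tau N) _ in h1 *.
  rewrite (_ : _ - _ = (a - a') - (b - b')); last by ring.
  by apply: le_trans (ler_normB _ _) _; lra.
rewrite sumr_const card_ord.
have -> : L * (2 * e' *+ m) = L * (2 * m%:R) * e' by rewrite -[_ *+ m]mulr_natr; ring.
by rewrite /e' mulrCA ger_pMr// ler_pdivrMr ?mul1r ?lerDl// ltr_wpDl.
Unshelve. all: by end_near. Qed.

Lemma hist_path_prefix N n s h : 0 < tau N -> T < n.+1%:R * tau N -> size s = n ->
  G (hist_path (tau N) (h ++ s)) = G (hist_path (tau N) s).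
Proof.
move=> tau0 Tn sn; apply/eqP; rewrite -subr_eq0 -normr_le0 -(mulr0 L).
apply: GL => t /andP[t0 tT]; rewrite /hist_path; case: ifP => _; first by rewrite subrr normr0.
rewrite at_time_cat ?subrr ?normr0// sn truncn_le_nat ltr_pdivrMr//.
exact: le_lt_trans Tn.
Qed.

(** For a fixed mesh two errors survive as [N] grows: the threshold [x] and the probability that
    some block oscillates beyond it. *)
Lemma fixed_mesh m delta x e : (0 < m)%N -> 0 < delta -> T = m%:R * delta -> 0 < x -> 0 < e ->
  \forall N \near \oo,
  `|chE N N [::] (fun h => G (hist_path (tau N) h)) -
    \int[Q]_w G (Wk beta k (step_path delta m (incr_at delta w)))| <=
  L * x + 2 * K * (m%:R * (2 * expR (- (x ^+ 2 / (32 * delta))))) + e.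
Proof.
move=> m0 d0 TE x0 e0.
have GL' : sup_lipschitz (m%:R * delta) L G by rewrite -TE.
have K0 : 0 <= K := le_trans (normr_ge0 _) (GK (fun=> 0)).
(* Seven errors: compensator, rounding of time, escape probability, smoothing, variance defect,
   third moments, and rounding of the mesh in the Brownian increments. *)
pose e7 := e / 7; have e70 : 0 < e7 by rewrite divr_gt0.
pose sm := e7 / (4 * m%:R * (L + 1)).
have L1 : 0 < L + 1 by rewrite ltr_wpDl.
have mR : 0 < m%:R :> R by rewrite ltr0n.
have sm0 : 0 < sm by rewrite divr_gt0// !mulr_gt0.
have smE : m%:R * (4 * L * sm) <= e7.
  have -> : m%:R * (4 * L * sm) = e7 * (L / (L + 1)).
    by rewrite /sm; field; rewrite !gt_eqF.
  by rewrite ger_pMr// ler_pdivrMr ?mul1r ?lerDl.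
have i2 : 0 <= sm ^- 2 by rewrite invr_ge0 exprn_ge0// ltW.
pose C := (2 * K + T * (sm ^- 2 * (2 * K))) * 2.
have C0 : 0 <= C by rewrite mulr_ge0// addr_ge0 ?mulr_ge0// ltW.
(* [C] is the total coefficient of the escape probability, the factor 2 of [escape_prob] included,
   and [expR (C / e7) >= C / e7] gives the required smallness. The level [a] is fixed before
   [critical_window] is invoked, since [A] depends on it. *)
pose a := 4 * T + C / e7.
have a0 : 0 <= a.
  have : 0 <= C / e7 by rewrite divr_ge0// ltW.
  by rewrite /a; move: T0; lra.
have aE : C * expR (4 * T - a) <= e7.
  rewrite /a opprD addrA subrr add0r.
  have := expR_ge1Dx (C / e7); have Ee := expR_gt0 (C / e7).
  rewrite expRN ler_pdivrMr// => h.
  apply: le_trans (_ : e7 * (1 + C / e7) <= _); last by rewrite ler_pM2l.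
  have -> : e7 * (1 + C / e7) = e7 + C by field; rewrite gt_eqF.
  by rewrite lerDr ltW.
have [A [rho0 [A0 rho00 crit]]] := @critical_window R beta k Cb beta_ge0 beta_bd k_ge3 beta_crit T a (ltW T0) a0.
have /cvgrPdist_le/(_ _ e70) gcv := grid_cvg m0 d0 TE.
near=> N.
have N0 : (0 < N)%N by near: N; exact: nbhs_infty_gt.
have [tau0 r0 tr rs] := scales N0.
have st0 : 0 < stau N by rewrite sqrtr_gt0.
have rr : rho N <= rho0 by rewrite -[rho N]mul1r; near: N; exact: near_small.
have rT : T * rho N <= 1 by near: N; exact: near_small.
have td : tau N <= delta by rewrite -[tau N]mul1r; near: N; exact: near_small.
have xs : x * stau N <= 8 * delta by near: N; apply: near_small => //; exact: mulr_gt0.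
have s2 : stau N <= 2^-1 by rewrite -[stau N]mul1r; near: N; exact: near_small.
have n1 : (L * A) * rho N <= e7 by near: N; exact: near_small.
have n2 : (L * (`|c| * (k.-1%:R * (m%:R * delta) ^+ k.-2))) * tau N <= e7 by near: N; exact: near_small.
have n3 : (T * (sm ^- 2 * (2 * K)) * A) * stau N <= e7 by near: N; exact: near_small.
have n4 : (T * (3456 * expR 1 * L * sm ^- 2)) * stau N <= e7 by near: N; exact: near_small.
have n5 : `|\int[Q]_w G (Wk beta k (step_path delta m (incr_at delta w))) -
   \int[Q]_w G (Wk beta k (step_path delta m ((incr B (fun i => (grid (tau N) delta i)%:R * tau N))^~ w)))| <= e7.
  by near: N; exact: gcv.
set E0 := \int[Q]_w _ in n5 *; set E1 := \int[Q]_w _ in n5.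
have {}crit := crit N (tau N) (rho N) tau0 r0 rr tr rs.
pose n := grid (tau N) delta m.
have nT : n%:R * tau N <= T by rewrite TE; exact: grid_le.
have nN : (n <= N)%N.
  rewrite -(ler_nat R) -(ler_pM2r tau0); apply: le_trans nT _.
  rewrite -(ler_pM2r r0); apply: le_trans rT _.
  by rewrite -mulrA [leRHS]mulrC tr.
have Tn : T < n.+1%:R * tau N.
  by have := grid_gt tau0 td m; rewrite -TE -/n -[n.+1%:R]natr1 mulrDl mul1r ltrBlDr.
have p01 i := joinp01 beta_ge0 N i.
have hT (h : seq nat) : (size h < n)%N -> (size h)%:R * tau N <= T.
  by move=> hn; apply: le_trans nT; rewrite ler_pM2r// ler_nat ltnW.
have mean2 h : (size h < n)%N -> mean N (joinp beta N) h <= 2.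
  by move=> hn; have [] := crit h (hT h hn).
have bad_p := @escape_prob N T a n tau0 s2 nT (fun h hh => let: And3 x _ _ := crit h hh in x).
set p := chE N n [::] _ in bad_p.
pose g y := G (Wk beta k (step_path delta m y)).
have lg : lipN m L g by exact: step_functional_lip.
have EE : chE N N [::] (fun h => G (hist_path (tau N) h)) = chE N n [::] (fun h => G (hist_path (tau N) h)).
  transitivity (chE N (n + (N - n))%N [::] (fun h => G (hist_path (tau N) h))); first by rewrite subnKC.
  rewrite chE_add; apply: eq_chE => // s sn; rewrite cats0.
  rewrite -[RHS](chE_cst N (joinp beta N) (N - n) s); apply: eq_chE => // h _.
  exact: hist_path_prefix Tn sn.
have c1 := @path_comparison R beta k N (joinp beta N) (tau N) delta m p01 tau0 td m0 n mean2 (leqnn _)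
  (escapes beta N (a / stau N)) G K L x (A * rho N) GL' GK L0 (mulr_ge0 A0 (ltW r0)) x0 xs.
have c2 := @block_replacement R d Om Q B hB N (joinp beta N) n (tau N) p01 tau0 mean2
  (escapes beta N (a / stau N)) (A * stau N) (mulr_ge0 A0 (ltW st0)) (fun c h => @escapes_cons _ beta N _ c h) _
  m (grid (tau N) delta) (grid0 _ _) (fun i _ => grid_lt tau0 td i) (leqnn _)
  g L K sm sm0 L0 lg (fun=> GK _).
have {}c2 := c2 (fun h hn nb => let: And3 _ y _ := crit h (hT h hn) in y nb).
have dr h : size h = n -> ~~ escapes beta N (a / stau N) h -> forall i, (i <= n)%N ->
    `|stau N * drift N (joinp beta N) (at_time h i) - c * (i%:R * tau N) ^+ k.-1| <= A * rho N.
  move=> hn nb i hi; have si : size (at_time h i) = i by rewrite size_at_time// hn.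
  have iT : (size (at_time h i))%:R * tau N <= T.
    by rewrite si; apply: le_trans nT; rewrite ler_pM2r// ler_nat.
  have [_ _] := crit _ iT; rewrite si; apply.
  by apply: contra nb; exact: escapes_drop.
have {}c1 := c1 dr; rewrite -/n -/p in c1 c2.
rewrite EE; set X := chE N n [::] _.
set Y := chE N n [::] (fun s => g _) in c2.
have XY : `|X - Y| <= L * (x + (A * rho N + `|c| * (k.-1%:R * (m%:R * delta) ^+ k.-2) * tau N)) +
    2 * K * (p + m%:R * (2 * expR (- (x ^+ 2 / (32 * delta))))).
  by rewrite -chEB; apply: le_trans (ler_norm_chE _ p01 _ _ _) c1.
rewrite (_ : X - E0 = (X - Y) + (Y - E1) + (E1 - E0)); last by ring.
have p0 : 0 <= p by exact: chE_ge0.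
have W0 : 0 <= sm ^- 2 * (2 * K) * (A * stau N + p) + 3456 * expR 1 * L * sm ^- 2 * stau N.
  apply: addr_ge0.
    apply: mulr_ge0; first by apply: mulr_ge0 => //; exact: mulr_ge0.
    by apply: addr_ge0 => //; exact: mulr_ge0 A0 (ltW st0).
  apply: mulr_ge0 (ltW st0); apply: mulr_ge0 i2; apply: mulr_ge0 L0.
  exact: mulr_ge0 (ler0n _ _) (expR_ge0 _).
have nW := ler_wpM2r W0 nT.
have {}c2 := le_trans c2 (lerD (lexx _) nW).
apply: le_trans (ler_normD _ _) _; rewrite (distrC E1).
apply: le_trans (lerD (le_trans (ler_normD _ _) (lerD XY c2)) n5) _.
have pC : (2 * K + T * (sm ^- 2 * (2 * K))) * p <= e7.
  apply: le_trans aE; rewrite /C -mulrA ler_wpM2l//.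
  by rewrite addr_ge0 ?mulr_ge0// ltW.
set M := m%:R * (2 * _); set Z := k.-1%:R * _ in n2 *.
rewrite (_ : e = e7 + e7 + e7 + e7 + e7 + e7 + e7); last by rewrite /e7; field.
have ringE (l y b r z v t y' u q st m' s' : R) :
    l * (y + (b * r + v * z * t)) + 2 * y' * (p + M) + (m' * (4 * l * s') +
      T * (q * (2 * y') * (b * st + p) + u * l * q * st)) + e7 =
    l * y + 2 * y' * M + (l * b * r + l * (v * z) * t + (2 * y' + T * (q * (2 * y'))) * p + m' * (4 * l * s') +
      T * (q * (2 * y')) * b * st + T * (u * l * q) * st + e7) by ring.
by rewrite ringE lerD2l; do !apply: lerD.
Unshelve. all: by end_near. Qed.

Lemma functional_limit : measurable_fun setT (fun w => G (Wk beta k (B^~ w))) /\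
  chE N N [::] (fun h => G (hist_path (tau N) h)) @[N --> \oo] --> \int[Q]_w G (Wk beta k (B^~ w)).
Proof.
have K0 : 0 <= K := le_trans (normr_ge0 _) (GK (fun=> 0)).
pose dl m := T / m.+1%:R.
have dl0 m : 0 < dl m by rewrite divr_gt0.
have TE m : T = m.+1%:R * dl m by rewrite mulrC divfK.
have [|m w|w|mG mcv] := @expect_cvg _ _ _ Q (fun m w => G (Wk beta k (step_path (dl m) m.+1 (incr_at (dl m) w))))
  (fun w => G (Wk beta k (B^~ w))) K.
- by move=> m; exact: (@measurable_grid m.+1 (dl m) (fun i => i%:R * dl m) (TE m)).
- exact: GK.
- have [_ B0 cB _ _] := hB.
  exact: (mesh_limit (cB w) (B0 w) T0 L0 GL).
split=> //; apply/cvgrPdist_le => e e0.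
have e4 : 0 < e / 4 by rewrite divr_gt0.
pose x := e / 4 / (L + 1).
have L1 : 0 < L + 1 by rewrite ltr_wpDl.
have x0 : 0 < x by rewrite divr_gt0.
have Lx : L * x <= e / 4 by rewrite /x mulrCA ger_pMr// ler_pdivrMr ?mul1r ?lerDl.
have [m [h1 h2]] : exists m,
    `|\int[Q]_w G (Wk beta k (B^~ w)) - \int[Q]_w G (Wk beta k (step_path (dl m) m.+1 (incr_at (dl m) w)))| <= e / 4 /\
    2 * K * (m.+1%:R * (2 * expR (- (x ^+ 2 / (32 * dl m))))) <= e / 4.
  have /cvgrPdist_le/(_ _ e4) hm := mcv.
  (* For the mesh [T / (m + 1)] the exponent is [q (m + 1)], which beats the number of blocks;
     [expR y >= y^2 / 4] is already enough. *)
  pose q := x ^+ 2 / (32 * T); have q0 : 0 < q.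
    by apply: divr_gt0; [exact: exprn_gt0|exact: mulr_gt0].
  near \oo => m.
  exists m; split; first by near: m.
  have -> : x ^+ 2 / (32 * dl m) = q * m.+1%:R by rewrite /q /dl; field; rewrite gt_eqF//= pnatr_eq0.
  rewrite expRN; set y := q * m.+1%:R.
  have y0 : 0 < y by rewrite mulr_gt0.
  have ye : y ^+ 2 / 4 <= expR y.
    have -> : expR y = expR (y / 2) ^+ 2 by rewrite -expRM_natl; congr expR; field.
    have -> : y ^+ 2 / 4 = (y / 2) ^+ 2 by field.
    by rewrite lerXn2r ?nnegrE ?expR_ge0 ?divr_ge0 ?(ltW y0)// (le_trans _ (expR_ge1Dx _))// lerDr.
  have y2 : 0 < y ^+ 2 / 4 by rewrite divr_gt0// exprn_gt0.
  have le1 : (expR y)^-1 <= 4 / y ^+ 2 by rewrite -[leRHS]invf_div lef_pV2 ?posrE ?expR_gt0.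
  apply: (@le_trans _ _ (2 * K * (m.+1%:R * (2 * (4 / y ^+ 2))))).
    by rewrite ler_wpM2l ?mulr_ge0// ler_wpM2l// ler_wpM2l.
  have -> : 2 * K * (m.+1%:R * (2 * (4 / y ^+ 2))) = (16 * K / q ^+ 2) / m.+1%:R.
    have n0 : m.+1%:R != 0 :> R by rewrite pnatr_eq0.
    by rewrite /y; move: n0; move: (m.+1%:R : R) => n n0; field; rewrite n0 gt_eqF.
  rewrite ler_pdivrMr// [leRHS]mulrC -ler_pdivrMr//.
  near: m; apply: filterS (nbhs_infty_gtr (16 * K / q ^+ 2 / (e / 4))) => m /ltW/le_trans; apply.
  by rewrite ler_nat.
have h3 := fixed_mesh (ltn0Sn m) (dl0 m) (TE m) x0 e4.
apply: filterS h3 => N h3.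
set X := chE N N [::] _ in h3 *; set E1 := \int[Q]_w _ in h1.
rewrite -/E1 (_ : E1 - X = (E1 - \int[Q]_w G (Wk beta k (step_path (dl m) m.+1 (incr_at (dl m) w)))) -
  (X - \int[Q]_w G (Wk beta k (step_path (dl m) m.+1 (incr_at (dl m) w))))); last by ring.
apply: le_trans (ler_normB _ _) _; apply: le_trans (lerD h1 h3) _.
by move: h2 Lx; lra.
Unshelve. all: by end_near. Qed.
End Scaling.

(** * From Lipschitz to continuous functionals *)

Section LowerApproximation.
Context {R : realType}.
Variables (F : (R -> R) -> R) (M : R).
Hypothesis F_bd : forall f, `|F f| <= M.
Hypothesis F_cont : D_continuous F.

(** [e] bounds the distance of [f] and [g] on [[0, m]], truncated at 1. Only cadlag [g] compete,
    because [D_continuous] speaks of cadlag sequences; [f] is arbitrary, because [sup_lipschitz]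
    quantifies over all paths. *)
Let penalized (m : nat) (f : R -> R) : set R :=
  [set r | exists g e, [/\ cadlag g, 0 <= e, 1 <= e \/ (forall t, 0 <= t <= m%:R -> `|f t - g t| <= e) &
     r = F g + m%:R * e]].

(* Truncating the distance at [1] makes the infimum finite on every path. *)
Definition lower_approx (m : nat) (f : R -> R) : R := inf (penalized m f).

Lemma cadlag0 : cadlag (fun=> 0 : R).
Proof. by split => // t _; [exact: cvg_cst|exists 0; exact: cvg_cst]. Qed.

Let penalized_lb m f : lbound (penalized m f) (- M).
Proof.
move=> r [g [e [_ e0 _ ->]]]; have /andP[Fg _] : - M <= F g <= M by rewrite -ler_norml.
by rewrite -[leLHS]addr0 lerD// mulr_ge0.
Qed.

Let penalized_has_inf m f : has_inf (penalized m f).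
Proof.
split; last by exists (- M); exact: penalized_lb.
by exists (F (fun=> 0) + m%:R * 1), (fun=> 0), 1; split => //; [exact: cadlag0|left].
Qed.

Lemma lower_approx_bounded m f : `|lower_approx m f| <= M + m%:R.
Proof.
have [ne lb] := penalized_has_inf m f.
rewrite ler_norml; apply/andP; split.
  apply: (@le_trans _ _ (- M)); first by rewrite lerN2 lerDl.
  exact: lb_le_inf ne (@penalized_lb m f).
apply: (@le_trans _ _ (F (fun=> 0) + m%:R * 1)).
  by apply: ge_inf => //; exists (fun=> 0), 1; split => //; [exact: cadlag0|left].
by rewrite mulr1 lerD2r (le_trans (ler_norm _)).
Qed.

Lemma lower_approx_lipschitz m : sup_lipschitz m%:R m%:R (lower_approx m).
Proof.
have half f f' eta : (forall t, 0 <= t <= m%:R -> `|f t - f' t| <= eta) ->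
    lower_approx m f' <= lower_approx m f + m%:R * eta.
  move=> ff'; rewrite -lerBlDr; have [ne _] := penalized_has_inf m f.
  apply: lb_le_inf => // r [g [e [cg e0 he ->]]]; rewrite lerBlDr -addrA -mulrDr.
  have eta0 : 0 <= eta by apply: le_trans (ff' 0 _); rewrite ?normr_ge0 ?lexx/=.
  apply: ge_inf; first by have [] := penalized_has_inf m f'.
  exists g, (e + eta); split => //; first exact: addr_ge0.
  case: he => [e1|fg]; [by left; rewrite (le_trans e1)// lerDl|right => t tm].
  rewrite (_ : f' t - g t = (f t - g t) - (f t - f' t)); last by ring.
  by apply: le_trans (ler_normB _ _) _; rewrite lerD ?fg ?ff'.
move=> f f' eta ff'; rewrite ler_norml; apply/andP; split.
  by rewrite lerNl opprB lerBlDl; exact: half.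
by rewrite lerBlDl; apply: half => t tm; rewrite distrC ff'.
Qed.

Lemma lower_approx_le m f : cadlag f -> lower_approx m f <= F f.
Proof.
move=> cf; apply: ge_inf; first by have [] := penalized_has_inf m f.
by exists f, 0; split => //; [right => t _; rewrite subrr normr0|rewrite mulr0 addr0].
Qed.

Lemma lower_approx_ge m f : - M <= lower_approx m f.
Proof. by have [ne _] := penalized_has_inf m f; exact: lb_le_inf ne (@penalized_lb m f). Qed.

(* Near-minimizers converge to [f] locally uniformly, so [D_continuous F] applies to them. *)
Lemma lower_approx_cvg f : cadlag f -> lower_approx m f @[m --> \oo] --> F f.
Proof.
move=> cf.
have near_opt m : exists g, exists e, [/\ cadlag g, 0 <= e,
     1 <= e \/ (forall t, 0 <= t <= m%:R -> `|f t - g t| <= e) &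
     F g + m%:R * e < lower_approx m f + m.+1%:R^-1].
  have i0 : 0 < m.+1%:R^-1 :> R by rewrite invr_gt0.
  have [r [g [e [cg e0 he rE]]] rlt] := inf_adherent i0 (penalized_has_inf m f).
  by exists g, e; split => //; rewrite -rE.
have [g gP] := choice near_opt; have [e eP] := choice gP.
(* Near-minimality against the competitor [f] itself: hence [e m] tends to 0, and the alternative
   [1 <= e m] eventually fails. *)
have em m : m%:R * e m <= 2 * M + 1.
  have [_ _ _ h] := eP m.
  have h1 : m.+1%:R^-1 <= 1 :> R by rewrite invf_le1 ?ler1n.
  have h2 := lower_approx_le m cf.
  have := F_bd (g m); have := F_bd f; rewrite !ler_norml => /andP[_ h3] /andP[h4 _].
  move: h h1 h2 h3 h4; move: (m.+1%:R^-1) (m%:R * e m) (F (g m)) (F f) (lower_approx m f).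
  by move=> u v x y z; lra.
have gf : loc_unif_cvg g f.
  move=> T eps eps0; near=> m => t /andP[t0 tT].
  have m0 : 0 < m%:R :> R by rewrite ltr0n; near: m; exact: nbhs_infty_gt.
  have Tm : T <= m%:R by near: m; exact: nbhs_infty_ger.
  have e_small c : 0 < c -> (2 * M + 1) / c < m%:R -> e m < c.
    move=> c0; rewrite ltr_pdivrMr// => h.
    by rewrite -(ltr_pM2l m0); apply: le_lt_trans h; exact: em.
  have e1 : e m < 1.
    by apply: e_small => //; near: m; exact: nbhs_infty_gtr.
  have e2 : e m < eps.
    by apply: e_small => //; near: m; exact: nbhs_infty_gtr.
  have [_ _ he _] := eP m; case: he => [|h]; first by rewrite leNgt e1.
  by rewrite distrC; apply: le_lt_trans (h t _) e2; rewrite t0 (le_trans tT).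
have Fg : F (g m) @[m --> \oo] --> F f.
  by apply: F_cont => // m; have [] := eP m.
have sq : \forall m \near \oo, F (g m) - m.+1%:R^-1 <= lower_approx m f <= F f.
  apply: nearW => m; rewrite lower_approx_le// andbT lerBlDr.
  have [_ e0 _ /ltW] := eP m; apply: le_trans.
  by rewrite lerDl mulr_ge0.
apply: (squeeze_cvgr sq).
- rewrite -[X in _ --> X]subr0; apply: cvgB => //; exact: cvg_harmonic.
- exact: cvg_cst.
Unshelve. all: by end_near. Qed.
End LowerApproximation.

(** * Cadlag paths *)

Section CadlagPaths.
Context {R : realType}.

Lemma cadlag_step (tau : R) (a : nat -> R) : 0 < tau ->
  cadlag (fun t => if t < 0 then 0 else a (Num.truncn (t / tau))).
Proof.
move=> tau0; split => [t ->//|t t0|t t0].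
  have tt0 : 0 <= t / tau by rewrite divr_ge0// ltW.
  have /andP[i1 i2] := truncn_itv tt0; set i := Num.truncn _ in i1 i2.
  apply: cvg_near_cst; near=> x.
  have tx : t <= x by apply/ltW; near: x; exact: nbhs_right_gt.
  have xi : x < i.+1%:R * tau.
    by near: x; apply: nbhs_right_lt; rewrite -ltr_pdivrMr.
  rewrite !ltNge t0 (le_trans t0 tx) /=; congr a; apply/eqP; rewrite eqn_leq.
  rewrite truncn_le_nat -/i ltr_pdivrMr// xi /=.
  by rewrite le_truncn// ler_pM2r ?invr_gt0.
(* The index in force just before [t] is one less when [t] is a multiple of [tau]. *)
pose i := (Num.truncn (t / tau) - (t == (Num.truncn (t / tau))%:R * tau)%R)%N.
have [it ti] : i%:R * tau < t /\ t <= i.+1%:R * tau.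
  have tt0 : 0 <= t / tau by rewrite divr_ge0// ltW.
  have /andP[] := truncn_itv tt0; rewrite /i; set n := Num.truncn _.
  rewrite ler_pdivlMr// ltr_pdivrMr// => i1 i2.
  case: eqP => [tn|/eqP tn] /=; last by rewrite subn0 lt_neqAle eq_sym tn i1 ltW.
  have n0 : (0 < n)%N by move: t0; rewrite tn pmulr_lgt0// ltr0n.
  by rewrite subn1 prednK// -tn lexx tn ltr_pM2r// ltr_nat prednK.
exists (a i); apply: cvg_near_cst; near=> x.
have xt : x < t by near: x; exact: nbhs_left_lt.
have ix : i%:R * tau < x by near: x; exact: nbhs_left_gt.
have x0 : 0 <= x by apply: le_trans (ltW ix); rewrite mulr_ge0// ltW.
rewrite ltNge x0 /=; congr a; apply/eqP; rewrite eqn_leq.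
rewrite truncn_le_nat ltr_pdivrMr// (lt_le_trans xt ti)/=.
by rewrite truncn_ge_nat ?divr_ge0 ?(ltW tau0)// ler_pdivlMr// ltW.
Unshelve. all: by end_near. Qed.

Lemma cadlag_Wk beta k (f : R -> R) : {within [set t | 0 <= t], continuous f} -> cadlag (Wk beta k f).
Proof.
move=> /subspace_continuousP cf.
have near_t t e : 0 <= t -> 0 < e -> exists2 d, 0 < d & forall x, 0 <= x -> `|t - x| < d ->
    `|Wk beta k f t - Wk beta k f x| < e.
  move=> t0 e0; have e2 : 0 < e / 2 by rewrite divr_gt0.
  have /cvgrPdist_lt/(_ _ e2) := cf t t0; rewrite near_withinE => /nbhs_ballP[d1 /= d10 h1].
  have cp : (fun x => mu beta k / (k%:R - 1) * x ^+ k.-1) x @[x --> t] --> mu beta k / (k%:R - 1) * t ^+ k.-1.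
    by apply: cvgMr; exact: exprn_continuous.
  have /cvgrPdist_lt/(_ _ e2)/nbhs_ballP[d2 /= d20 h2] := cp.
  exists (Num.min d1 d2); first by rewrite lt_min d10.
  move=> x x0; rewrite lt_min => /andP[xd1 xd2]; rewrite /Wk [t < 0]ltNge [x < 0]ltNge t0 x0 /=.
  rewrite opprD addrACA; apply: le_lt_trans (ler_normD _ _) _; rewrite [ltRHS]splitr; apply: ltrD.
    exact: h1.
  exact: h2.
split => [t t0|t t0|t t0]; first by rewrite /Wk t0.
  apply/cvgrPdist_lt => e e0; have [d d0 hd] := near_t t e t0 e0.
  near=> x; have tx : t < x by near: x; exact: nbhs_right_gt.
  have xd : x < t + d by near: x; apply: nbhs_right_lt; rewrite ltrDl.
  apply: hd; first exact: le_trans (ltW tx).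
  by rewrite distrC ger0_norm ?subr_ge0 ?(ltW tx)// ltrBlDl.
exists (Wk beta k f t); apply/cvgrPdist_lt => e e0; have [d d0 hd] := near_t t e (ltW t0) e0.
near=> x; have xt : x < t by near: x; exact: nbhs_left_lt.
have xd : t - d < x by near: x; apply: nbhs_left_gt; rewrite ltrBlDr ltrDl.
have x0 : 0 < x by near: x; exact: nbhs_left_gt.
apply: hd; first exact: ltW.
by rewrite ger0_norm ?subr_ge0 ?(ltW xt)// ltrBlDr -ltrBlDl.
Unshelve. all: by end_near. Qed.
End CadlagPaths.

(** * The exponents and the rescaled walk *)

Section ScalingExponents.
Context {R : realType}.
Variable k : nat.
Hypothesis k_ge3 : (3 <= k)%N.
Local Notation a := (@alpha R k).

Definition time_scale (N : nat) : R := N%:R `^ (- a).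
Definition fraction_scale (N : nat) : R := N%:R `^ (a - 1).

Let k2 : 0 < 2 * k%:R - 3 :> R.
Proof. by have : 3%:R <= k%:R :> R; [rewrite ler_nat|lra]. Qed.

Lemma alpha_gt0 : 0 < a.
Proof.
rewrite /alpha divr_gt0//; have : 3%:R <= k%:R :> R by rewrite ler_nat.
by lra.
Qed.

Lemma alpha_lt1 : a < 1.
Proof. by rewrite /alpha ltr_pdivrMr// mul1r; lra. Qed.

(** The last equality is [(alpha - 1) (k - 2) = - alpha / 2], the equation that determines
    [alpha]. *)
Lemma scales (N : nat) : (0 < N)%N ->
  [/\ 0 < time_scale N, 0 < fraction_scale N, time_scale N * fraction_scale N * N%:R = 1 &
   fraction_scale N ^+ k.-2 = Num.sqrt (time_scale N)].
Proof.
move=> N0; have NR : 0 < N%:R :> R by rewrite ltr0n.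
have Nn : N%:R != 0 :> R by rewrite gt_eqF.
rewrite /time_scale /fraction_scale; split; [exact: powR_gt0|exact: powR_gt0| |].
  rewrite -[X in _ * _ * X]powRr1 ?ltW// -!powRD ?Nn ?implybT//.
  by rewrite (_ : - a + (a - 1) + 1 = 0) ?powRr0//; ring.
rewrite -powR12_sqrt ?powR_ge0// -powRrM -powR_mulrn ?powR_ge0// -powRrM; congr (_ `^ _).
rewrite (_ : k.-2%:R = k%:R - 2 :> R); last by rewrite -natrB//; [congr _%:R|]; move: k_ge3; clear; lia.
by rewrite /alpha; field; rewrite gt_eqF.
Qed.

Lemma powR_decay (c : R) : 0 < c -> (N%:R : R) `^ (- c) @[N --> \oo] --> 0.
Proof.
move=> c0; apply/cvgrPdist_le => e e0.
near=> N.
have N0 : 0 < N%:R :> R by rewrite ltr0n; near: N; exact: nbhs_infty_gt.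
rewrite sub0r normrN ger0_norm ?powR_ge0//.
have -> : e = (e^-1 `^ c^-1) `^ (- c).
  by rewrite -powRrM mulrN mulVf ?gt_eqF// powR_inv1 ?invr_ge0 ?ltW// invrK.
have ei : 0 < e^-1 by rewrite invr_gt0.
have y0 : 0 < e^-1 `^ c^-1 by exact: powR_gt0.
rewrite !powRN lef_pV2 ?posrE ?powR_gt0//.
apply: ge0_ler_powR; rewrite ?nnegrE ?(ltW y0) ?(ltW N0) ?(ltW c0)//.
by near: N; exact: nbhs_infty_ger.
Unshelve. all: by end_near. Qed.

Lemma time_scale_cvg : time_scale @ \oo --> 0.
Proof. exact: powR_decay alpha_gt0. Qed.

Lemma fraction_scale_cvg : fraction_scale @ \oo --> 0.
Proof.
rewrite /fraction_scale (_ : a - 1 = - (1 - a)); last by ring.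
by apply: powR_decay; rewrite subr_gt0 alpha_lt1.
Qed.

Lemma bfs_walk_at_time N (E : {set 'I_N} -> nat) i :
  bfs_walk E i = walk (at_time (rev (bfs_run E N).2) i) :> R.
Proof.
have [_ _ sc _] := bfs_run_inv E (leqnn N).
set h := rev _; have sh : size h = N by rewrite size_rev.
have nthh m : (m < N)%N -> nth 0%N (bfs_run E N).2 m = nth 0%N h (N - m.+1).
  by move=> mN; rewrite /h nth_rev sc; [congr nth; lia|lia].
rewrite /bfs_walk (_ : at_time h i = at_time h (minn i N)); last by rewrite /at_time sh; congr drop; lia.
have : (minn i N <= N)%N by rewrite geq_minr.
elim: (minn i N) => [_|n IH nN]; first by rewrite big_geq// /at_time subn0 drop_size.
rewrite big_nat_recr//= IH ?(ltnW nN)//.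
rewrite [in RHS]/at_time (drop_nth 0%N) ?sh; last by lia.
rewrite /= /bfs_children /= nthh//; congr (walk _ + _).
by rewrite /at_time sh; congr drop; lia.
Qed.

Lemma Zbar_hist_path N (E : {set 'I_N} -> nat) : (0 < N)%N ->
  Zbar k E = hist_path (time_scale N) (rev (bfs_run E N).2) :> (R -> R).
Proof.
move=> N0; have NR : 0 < N%:R :> R by rewrite ltr0n.
apply/funext => t; rewrite /Zbar /hist_path; case: ifP => // _.
rewrite bfs_walk_at_time; congr (_ * _).
  by rewrite /time_scale -powR12_sqrt ?powR_ge0// -powRrM.
by rewrite /time_scale powRN invrK mulrC.
Qed.
End ScalingExponents.

(** * Convergence for bounded continuous functionals *)

Section ScalingLimit.
Context {R : realType}.
Variables (beta : nat -> R) (k : nat) (Cb : R).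
Hypothesis beta_ge0 : forall j, (2 <= j)%N -> 0 <= beta j.
Hypothesis beta_bd : forall j, (2 <= j)%N -> j%:R * beta j <= Cb.
Hypothesis k_ge3 : (3 <= k)%N.
Hypothesis beta_crit : forall j, (2 <= j <= k.-1)%N -> beta j = (j%:R * (j%:R - 1))^-1.
Context d (Om : measurableType d) (Q : probability Om R) (B : R -> Om -> R).
Hypothesis hB : brownian_motion Q B.
Local Notation walk_mean F N :=
  (chE N (joinp beta N) N [::] (fun h => F (hist_path (time_scale k N) h))).

Let path_cadlag w : cadlag (Wk beta k (B^~ w)).
Proof. by have [_ _ cB _ _] := hB; exact: cadlag_Wk. Qed.

Lemma expect_lower_bound (F : (R -> R) -> R) : bounded_functional F -> D_continuous F ->
  measurable_fun setT (fun w => F (Wk beta k (B^~ w))) /\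
  forall e, 0 < e -> \forall N \near \oo, \int[Q]_w F (Wk beta k (B^~ w)) - e <= walk_mean F N.
Proof.
move=> [M F_bd] F_cont.
(* The index is shifted because [functional_limit] asks for an interval of positive length. *)
pose G m := lower_approx F m.+1.
have lim m := functional_limit beta_ge0 beta_bd k_ge3 beta_crit hB (scales k_ge3)
  (fraction_scale_cvg k_ge3) (time_scale_cvg k_ge3) (ltr0Sn R m) (ler0n R m.+1)
  (@lower_approx_lipschitz R F M F_bd m.+1)
  (@lower_approx_bounded R F M F_bd m.+1).
have [|m w|w|mF cvF] := @expect_cvg _ _ _ Q (fun m w => G m (Wk beta k (B^~ w)))
  (fun w => F (Wk beta k (B^~ w))) M.
- by move=> m; have [] := lim m.
- rewrite ler_norml (lower_approx_ge F_bd)/=.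
  by apply: le_trans (lower_approx_le F_bd _ (path_cadlag w)) _; exact: le_trans (ler_norm _) _.
- have := lower_approx_cvg F_bd F_cont (path_cadlag w).
  by rewrite -(cvg_shiftS (fun m => lower_approx F m (Wk beta k (B^~ w)))).
split=> // e e0; have e2 : 0 < e / 2 by rewrite divr_gt0.
have /cvgrPdist_le/(_ _ e2)[m _ /(_ m (leqnn m)) hm] := cvF.
have [_ /cvgrPdist_le/(_ _ e2)] := lim m.
apply: filterS2 (nbhs_infty_gt 0) => N N0 hN.
apply: (@le_trans _ _ (walk_mean (G m) N)); last first.
  apply: le_chE => [|s _]; first exact: joinp01.
  apply: (lower_approx_le F_bd); apply: (cadlag_step (fun i => Num.sqrt (time_scale k N) * walk (at_time (s ++ [::]) i))).
  by have [] := @scales R k k_ge3 N N0.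
have := le_trans (ler_norm _) hN; have := le_trans (ler_norm _) hm; rewrite /G; lra.
Qed.

Lemma expect_limit (F : (R -> R) -> R) : bounded_functional F -> D_continuous F ->
  measurable_fun setT (fun w => F (Wk beta k (B^~ w))) /\
  walk_mean F N @[N --> \oo] --> \int[Q]_w F (Wk beta k (B^~ w)).
Proof.
move=> F_bd F_cont; have [mF low] := expect_lower_bound F_bd F_cont.
have [M FM] := F_bd.
have NF_bd : bounded_functional (fun f => - F f) by exists M => f; rewrite normrN.
have NF_cont : D_continuous (fun f => - F f).
  by move=> f g cf cg gf; apply: cvgN; exact: F_cont.
have [_ up] := expect_lower_bound NF_bd NF_cont.
split=> //; apply/cvgrPdist_le => e e0.
apply: filterS2 (low e e0) (up e e0) => N h1; rewrite chEN.
have -> : \int[Q]_w (- F (Wk beta k (B^~ w))) = - \int[Q]_w F (Wk beta k (B^~ w)).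
  rewrite -mulN1r -RintegralZl//; last by apply: (@bounded_integrable _ _ _ Q _ M mF) => w; exact: FM.
  by apply: eq_Rintegral => w _; rewrite mulN1r.
move=> h2; rewrite ler_norml; apply/andP; split; lra.
Qed.
End ScalingLimit.

Theorem theorem3p1 (R : realType) (beta : nat -> R)
  (beta_ge0 : forall j, (2 <= j)%N -> 0 <= beta j)
  (dbeta1_fin : (\sum_(2 <= j <oo) (j%:R * beta j)%:E < +oo)%E)
  (k : nat) (k_ge3 : (3 <= k)%N)
  (beta_crit : forall j, (2 <= j <= k.-1)%N -> beta j = (j%:R * (j%:R - 1))^-1)
  (d : nat -> measure_display) (Om : forall N, measurableType (d N))
  (P : forall N, probability (Om N) R)
  (X : forall N, {set 'I_N} -> Om N -> nat)
  (hX : forall N, poisson_hypergraph beta (P N) (X N))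
  (dB : measure_display) (OmB : measurableType dB) (Q : probability OmB R)
  (B : R -> OmB -> R) (hB : brownian_motion Q B)
  (F : (R -> R) -> R) (F_bd : bounded_functional F) (F_cont : D_continuous F) :
  (\int[P N]_w (F (Zbar k (fun A => X N A w)))%:E)%E @[N --> \oo] -->
  (\int[Q]_w (F (Wk beta k (fun t => B t w)))%:E)%E.
Proof.
have t0 j : (2 <= j)%N -> (0 <= (j%:R * beta j)%:E)%E.
  by move=> j2; rewrite lee_fin mulr_ge0// beta_ge0.
set S := (\sum_(2 <= j <oo) _)%E in dbeta1_fin.
have S0 : (0 <= S)%E by apply: nneseries_ge0 => j j2 _; exact: t0.
have Sfin : S \is a fin_num by rewrite ge0_fin_numE.
(* Each term of the series for [beta'(1)] is at most its sum; this uniform bound is what the tail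
   estimate of [rate_expansion] uses. *)
have beta_bd j : (2 <= j)%N -> j%:R * beta j <= fine S.
  move=> j2; rewrite -lee_fin fineK//.
  apply: le_trans (nneseries_lim_ge j.+1 (fun n n2 _ => t0 n n2)).
  rewrite big_nat_recr//= leeDr//.
  by rewrite big_nat_cond; apply: sume_ge0 => i /andP[/andP[i2 _] _]; exact: t0.
have [mF lim] := expect_limit beta_ge0 beta_bd k_ge3 beta_crit hB F_bd F_cont.
have [M FM] := F_bd.
have -> : (\int[Q]_w (F (Wk beta k (fun t => B t w)))%:E)%E = (\int[Q]_w F (Wk beta k (B^~ w)))%:E.
  rewrite fineK//; apply: (integrable_fin_num measurableT).
  by apply: (@bounded_integrable _ _ _ Q _ M mF) => w; exact: FM.
apply: cvg_trans (cvg_EFin (f := fun N => (chE N (joinp beta N) N [::] (fun h => F (hist_path (time_scale k N) h)))%:E) _ lim); last exact: nearW.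
apply: near_eq_cvg; apply: filterS (nbhs_infty_gt 0) => N N0.
under [RHS]eq_integral do rewrite Zbar_hist_path//.
rewrite (hypergraph_expect (hX N) (fun h => F (hist_path (time_scale k N) h))).
by rewrite (funext (join_prob_joinp beta N)).
Qed.
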